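(* Let $h,k,\ell\in\mathbb{N}$ be fixed, let $\theta_j\in(0,1]$ be an exponent of distribution for $d_j(n)$ for $j\in\{\ell,k,k-1\}$, and let $0<A<\theta_{\ell}$ and $0<B<\min(\theta_k,A\theta_{k-1})$ be fixed. Then, as $x\to\infty$, $$\sum_{n\leq x}d_k(n+h,A)\left(d_{\ell}(n)-B^{1-\ell}d_{\ell}(n,B)\right)=O_{A,B,h,k,\ell}\left( x\log^{k+\ell-3} x \right).$$
   Context: $\mathbb{N}$ denotes the positive integers, and $(m,n)$ denotes the greatest common divisor. $d_k(n)$ is the number of ways of writing $n$ as an ordered product of $k$ positive integer factors (so $d_1(n)=1$, and $d_0(n)=1$ if $n=1$ and $0$ otherwise). For $A\in(0,1]$, $$d_k(n,A)=\sum_{\substack{q\mid n\\ q\leq n^A}}d_{k-1}(q).$$ Exponent of distribution: for $g\in\mathbb{N}$, a real number $0<\theta_{g,k}\leq 1$ is an exponent of distribution for $d_k(n)$ (with respect to $g$) if for every fixed $\epsilon>0$ there is a fixed $\delta>0$ such that for every $q\leq x^{\theta_{g,k}-\epsilon}$ and each residue class $h\not\equiv 0\pmod q$ with $(h,q)=g$, $$\sum_{\substack{n\leq x\\ n\equiv h \pmod q}} d_k(n)= \frac{1}{\phi(q/g)}\,\mathrm{Res}\left(\frac{x^{s}}{s}\sum_{(n,q)=g}\frac{d_k(n)}{n^s},\ s=1\right)+O_{\epsilon,\delta,k}\left(\frac{x^{1-\delta}}{\phi(q/g)}\right),$$ where $\phi$ is Euler's function and the Dirichlet series is meromorphically continued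 to a neighbourhood of $s=1$. Convention: $\theta_k$ denotes a single number that is an exponent of distribution for $d_k(n)$ for all $g$ simultaneously, i.e. one may take $\theta_{g,k}=\theta_k$ for every $g$. *)

(* Defs.v *)
From HB Require Import structures.
From mathcomp Require Import all_boot all_order all_algebra.
From mathcomp Require Import complex.
From mathcomp Require Import all_classical all_reals all_analysis.

Set Implicit Arguments.
Unset Strict Implicit.
Unset Printing Implicit Defensive.

Import Order.TTheory GRing.Theory Num.Theory.
Import numFieldNormedType.Exports.

Local Open Scope classical_set_scope.
Local Open Scope ring_scope.
Local Open Scope complex_scope.

(* d_k(n); a positive factor of n > 0 lies in 'I_n.+1. *)
Definition divisor_fun (k n : nat) : nat :=
  #|[set t : {ffun 'I_k -> 'I_n.+1} |
      [forall i, (0 < t i)%N] && ((\prod_(i < k) t i)%N == n)]%SET|.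

(* d_k(n, A), meaningful for 0 < k and 0 < n only. *)
Definition divisor_fun_trunc (R : realType) (k n : nat) (A : R) : nat :=
  (\sum_(q <- divisors n | (q%:R <= n%:R `^ A)%R) divisor_fun k.-1 q)%N.

(* x ^ s = exp (s log x), for x > 0 real and s complex. *)
Definition cpow (R : realType) (x : R) (s : R[i]) : R[i] :=
  (expR (complex.Re s * ln x))%:C *
  (cos (complex.Im s * ln x) +i* sin (complex.Im s * ln x)).

(* R[i]^o carries the topology of the complex norm.
   Sum of d_k(n) / n^s over (n, q) = g, convergent for Re s > 1. *)
Definition divisor_dirichlet (R : realType) (k q g : nat) (s : R[i]) : R[i] :=
  limn (fun N : nat => \sum_(1 <= n < N.+1 | gcdn n q == g)
    (divisor_fun k n)%:R / cpow n%:R s : R[i]^o).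

(* F s = \sum_j c_j (s - s0)^(j - m) in a punctured neighbourhood of s0;
   c_0 may vanish, so m only bounds the order of the pole. *)
Definition laurent_expansion (R : realType) (F : R[i] -> R[i]) (s0 : R[i])
    (m : nat) (c : nat -> R[i]) : Prop :=
  \forall s \near (s0 : R[i]^o)^',
    series (fun j : nat => c j * (s - s0) ^ (j%:Z - m%:Z) : R[i]^o) @ \oo
      --> (F s : R[i]^o).

Definition meromorphic_at (R : realType) (F : R[i] -> R[i]) (s0 : R[i]) : Prop :=
  exists m c, laurent_expansion F s0 m c.

(* The coefficient of (s - s0)^(-1) (0 if F is not meromorphic at s0). *)
Definition residue (R : realType) (F : R[i] -> R[i]) (s0 : R[i]) : R[i] :=
  xget 0 [set r | exists m c, laurent_expansion F s0 m c /\
                    r = if m is m'.+1 then c m' else 0].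

(* A meromorphic continuation to a neighbourhood of s = 1 of a function D
   given on Re s > 1; it is determined by D up to its germ in a punctured
   neighbourhood of 1, on which residues at 1 depend only. *)
Definition continuation_at1 (R : realType) (D : R[i] -> R[i]) : R[i] -> R[i] :=
  xget D [set F | meromorphic_at F 1 /\
                  \forall s \near (1 : R[i]^o), 1 < complex.Re s -> F s = D s].

(* The x-range x >= 1 is equivalent to x large, as the range of q is finite
   for bounded x.  C may depend on g, which is fixed beforehand. *)
Definition exponent_of_distribution_at (R : realType) (g k : nat) (theta : R)
    : Prop :=
  0 < theta <= 1 /\
  forall eps : R, 0 < eps -> exists2 delta : R, 0 < delta &
  exists C : R, forall x : R, 1 <= x ->
  forall q : nat, (0 < q)%N -> q%:R <= x `^ (theta - eps) ->
  forall h : nat, ~~ (q %| h)%N -> gcdn h q = g ->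
    `| (\sum_(1 <= n < (Num.truncn x).+1 | (n == h %[mod q])%N)
          divisor_fun k n)%:R
       - (totient (q %/ g))%:R^-1 *
         residue (fun s => cpow x s / s *
                    continuation_at1 (divisor_dirichlet k q g) s) 1 |
    <= (C * (x `^ (1 - delta) / (totient (q %/ g))%:R))%:C.

Definition exponent_of_distribution (R : realType) (k : nat) (theta : R)
    : Prop :=
  forall g : nat, (0 < g)%N -> exponent_of_distribution_at g k theta.

(* Main.v *)
(* For l = 1 every summand vanishes, so let l >= 2.

   Averaging the hypothesis over the classes a mod q with a given gcd (a, q)
   eliminates the residue: the sum of d_j over n = a (mod q) is 1/phi(q/(a,q))
   times the sum over (n, q) = (a, q), up to a power saving.  Open d_k(n+h, A)
   as a sum over r | n+h and apply this to d_l; in the second sum open d_l(n, B)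
   as a sum over q | n and apply it to d_k and, after passing to the
   complementary divisor m/r for the r > m^A, to d_(k-1).  Both sums become
     N sum_r d_(k-1)(r) sum_q d_(l-1)(q) [(q, r) | h] / lcm(q, r)
   over r <= (N+h)^A and q <= N, respectively q <= N^B, with admissible error.
   The inner sum over q <= y is c_r log^(l-1) y with an error of order
   log^(l-2) y times (1/r) sum_(d | r) d^(-1/2), so that passing from y = N to
   y = N^B multiplies it by B^(l-1) up to an admissible error. *)

Require Import Defs.
From HB Require Import structures.
From mathcomp Require Import all_boot all_order all_algebra.
From mathcomp Require Import all_classical all_reals all_analysis.
From mathcomp Require Import complex ring lra zify.

Set Implicit Arguments.
Unset Strict Implicit.
Unset Printing Implicit Defensive.

Import Order.TTheory GRing.Theory Num.Theory.
Import numFieldNormedType.Exports.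

Local Open Scope classical_set_scope.
Local Open Scope ring_scope.

(** * Divisor functions as sums over divisors *)

(** Both main terms have order N log^(k+l-2) N, one logarithm above the bound to be proved, so every
    error has to save a logarithm. The condition r <= (n+h)^A depends on n; for fixed r it says n+h
    >= [tau A r], and the missing initial segment costs about [tau A r]/r. Summed against d_(k-1)(r)
    over r <= M^A this is M log^(k-2) M, because r^(1/A-1) puts the mass at the upper end and no
    logarithmic integral arises. Such segments can be too short for the level of distribution, hence
    a bound for all lengths with an extra term q^(1/eta), eta < theta. The factors r/phi(r) and the
    errors of coprimality counts are unbounded in r; they are dominated by divisor sums [wt a r]
    with a > 0, which are bounded on average and cost no logarithm. The condition B < A theta_(k-1)
    reflects that a complementary divisor is at most M^(1-A), which leaves sums of length at least
    M^A to moduli q <= M^B. *)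

Definition factor_tuples (m k n : nat) : {set {ffun 'I_k -> 'I_m.+1}} :=
  [set t : {ffun 'I_k -> 'I_m.+1} |
    [forall i, (0 < t i)%N] && ((\prod_(i < k) t i)%N == n)]%SET.

Definition ffun_cons (m k : nat) (i : 'I_m.+1) (t : {ffun 'I_k -> 'I_m.+1}) :
    {ffun 'I_k.+1 -> 'I_m.+1} :=
  [ffun j => if unlift ord0 j is Some j' then t j' else i].

Lemma ffun_cons_inj m k (i : 'I_m.+1) : injective (@ffun_cons m k i).
Proof.
move=> t u tu; apply/ffunP => j.
by have /ffunP/(_ (lift ord0 j)) := tu; rewrite !ffunE liftK.
Qed.

Lemma card_factor_tuplesS m k n : (0 < n)%N ->
  #|factor_tuples m k.+1 n| =
  (\sum_(i < m.+1 | (0 < i) && (i %| n)) #|factor_tuples m k (n %/ i)|)%N.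
Proof.
move=> n0.
rewrite -sum1dep_card (partition_big (fun t : {ffun 'I_k.+1 -> 'I_m.+1} => t ord0)
   (fun i : 'I_m.+1 => (0 < i)%N && (i %| n)%N)) /=; last first.
  move=> t /andP[/forallP t0 /eqP <-]; rewrite t0 /=.
  by rewrite big_ord_recl dvdn_mulr.
apply: eq_bigr => i /andP[i0 /dvdnP[c cE]].
rewrite -(card_imset _ (@ffun_cons_inj m k i)) -sum1_card.
apply: eq_bigl => t.
apply/idP/imsetP.
  move=> /andP[/andP[/forallP t0 /eqP tn] /eqP ti].
  exists [ffun j => t (lift ord0 j)].
    rewrite inE; apply/andP; split.
      by apply/forallP => j; rewrite ffunE.
    rewrite -tn big_ord_recl ti mulKn //.
    by apply/eqP/eq_bigr => j _; rewrite ffunE.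
  apply/ffunP => j; rewrite ffunE.
  by case: unliftP => [j' ->|->]; rewrite ?ffunE.
move=> [u]; rewrite inE => /andP[/forallP u0 /eqP un] ->.
apply/andP; split; last by rewrite ffunE unlift_none.
apply/andP; split.
  apply/forallP => j; rewrite ffunE; by case: (unlift ord0 j).
rewrite big_ord_recl ffunE unlift_none.
under eq_bigr do rewrite ffunE liftK.
by rewrite un cE mulnK // mulnC.
Qed.

Lemma card_factor_tuples0 m n : #|factor_tuples m 0 n| = (n == 1%N).
Proof.
case: eqP => [->|n1]; last first.
  apply/eqP; rewrite cards_eq0; apply/eqP/setP => t.
  by rewrite !inE big_ord0 andbC; case: eqP => // /esym.
rewrite (_ : factor_tuples m 0 1 = [set: _]%SET).
  by rewrite cardsT card_ffun !card_ord.
apply/setP => t; rewrite !inE big_ord0 eqxx andbT.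
by apply/forallP => -[].
Qed.

(** Removing a factor shrinks [n] but not the box ['I_m.+1], so the recursion runs with [m] as a
    free parameter; the count depends only on [n] as soon as the box holds all its divisors. *)
Lemma card_factor_tuples m k n : (0 < n <= m)%N ->
  #|factor_tuples m k n| = divisor_fun k n.
Proof.
rewrite -[divisor_fun k n]/#|factor_tuples n k n|.
elim: k n m => [|k IH] n m /andP[n0 nm].
  by rewrite !card_factor_tuples0.
rewrite !card_factor_tuplesS //.
have aux p : (n <= p)%N ->
    (\sum_(i < p.+1 | (0 < i) && (i %| n)) #|factor_tuples p k (n %/ i)|)%N =
    (\sum_(i <- iota 0 n.+1 | (0 < i) && (i %| n)) #|factor_tuples (n %/ i) k (n %/ i)|)%N.
  move=> np; rewrite -(big_mkord (fun i => (0 < i) && (i %| n))%N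
     (fun i => #|factor_tuples p k (n %/ i)|)) -[iota _ _]/(index_iota 0 n.+1).
  rewrite (big_cat_nat (n := n.+1)) //= [X in (_ + X)%N]big1_seq ?addn0.
    apply: eq_bigr => i /andP[i0 idvd]; apply: IH.
    by rewrite divn_gt0 // dvdn_leq //= (leq_trans (leq_div _ _)).
  move=> i /andP[/andP[_ /(dvdn_leq n0) le_in]]; rewrite mem_index_iota.
  by move=> /andP[/(leq_ltn_trans le_in)]; rewrite ltnn.
by rewrite !aux.
Qed.

Lemma divisor_fun0 n : divisor_fun 0 n = (n == 1%N).
Proof. exact: (card_factor_tuples0 n n). Qed.

Lemma sum_divisors (V : nmodType) (n N : nat) (F : nat -> V) :
  (0 < n <= N)%N ->
  \sum_(q <- divisors n) F q = \sum_(1 <= q < N.+1 | (q %| n)%N) F q.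
Proof.
move=> /andP[n0 nN]; rewrite -[RHS]big_filter; apply: perm_big.
apply: uniq_perm; rewrite ?divisors_uniq ?filter_uniq ?iota_uniq // => q.
rewrite -dvdn_divisors // mem_filter mem_index_iota ltnS.
case: (boolP (q %| n)%N) => //= qn.
by rewrite (dvdn_gt0 n0 qn) (leq_trans (dvdn_leq n0 qn)).
Qed.

Lemma sum_divisors_rev (V : nmodType) (n : nat) (F : nat -> V) : (0 < n)%N ->
  \sum_(q <- divisors n) F (n %/ q)%N = \sum_(q <- divisors n) F q.
Proof.
move=> n0; rewrite -(big_map (fun q => n %/ q)%N predT F).
have inv q : (q %| n)%N -> (n %/ (n %/ q))%N = q.
  move=> qn; have q0 := dvdn_gt0 n0 qn.
  by rewrite -{1}(divnK qn) mulKn // divn_gt0 // dvdn_leq.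
apply: perm_big; apply: uniq_perm; rewrite ?divisors_uniq //.
  rewrite map_inj_in_uniq ?divisors_uniq // => a b.
  by rewrite -!dvdn_divisors // => an bn e; rewrite -(inv a) // e inv.
move=> q; apply/mapP/idP => [[d + ->]|].
  by rewrite -!dvdn_divisors //; exact: dvdn_div.
rewrite -dvdn_divisors // => qn; exists (n %/ q)%N; last by rewrite inv.
by rewrite -dvdn_divisors // dvdn_div.
Qed.

Lemma divisor_funS k n : (0 < n)%N ->
  divisor_fun k.+1 n = (\sum_(q <- divisors n) divisor_fun k q)%N.
Proof.
move=> n0; rewrite -(@sum_divisors_rev nat) // (@sum_divisors nat n n) ?n0 //=.
rewrite -(@card_factor_tuples n) ?n0 ?leqnn //= card_factor_tuplesS //.
rewrite -(big_mkord (fun i => (0 < i) && (i %| n))%N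
     (fun i => #|factor_tuples n k (n %/ i)|)) big_ltn_cond //=.
rewrite big_nat_cond [RHS]big_nat_cond.
rewrite (eq_bigl (fun i => (1 <= i < n.+1) && (i %| n))%N); last first.
  by case.
apply: eq_bigr => i /andP[/andP[i0 _] idvd]; apply: card_factor_tuples.
by rewrite leq_div divn_gt0 // dvdn_leq.
Qed.

Lemma sum_multiples (V : nmodType) (q N : nat) (F : nat -> V) : (0 < q)%N ->
  \sum_(1 <= n < N.+1 | (q %| n)%N) F n =
  \sum_(1 <= b < (N %/ q).+1) F (q * b)%N.
Proof.
move=> q0; rewrite -[LHS]big_filter -(big_map (muln q) predT F).
apply: perm_big; apply: uniq_perm; rewrite ?filter_uniq ?iota_uniq //.
  rewrite map_inj_uniq ?iota_uniq // => a b /eqP.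
  by rewrite eqn_pmul2l // => /eqP.
move=> n; rewrite mem_filter mem_index_iota; apply/idP/mapP.
  move=> /andP[/dvdnP[b ->] /andP[b1 b2]]; exists b; last by rewrite mulnC.
  rewrite mem_index_iota !ltnS in b2 *; rewrite leq_divRL // b2 andbT.
  by move: b1; rewrite muln_gt0 => /andP[].
move=> [b]; rewrite mem_index_iota ltnS leq_divRL // => /andP[b1 b2] ->.
by rewrite dvdn_mulr //= muln_gt0 q0 b1 /= ltnS mulnC.
Qed.

Lemma sum_sum_divisors (V : nmodType) (N : nat) (G : nat -> nat -> V) :
  \sum_(1 <= n < N.+1) \sum_(q <- divisors n) G q n =
  \sum_(1 <= q < N.+1) \sum_(1 <= b < (N %/ q).+1) G q (q * b)%N.
Proof.
under eq_big_nat => n nN do rewrite (@sum_divisors _ n N) // big_mkcond.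
rewrite exchange_big /=; apply: eq_big_nat => q /andP[q0 _].
by rewrite -big_mkcond sum_multiples.
Qed.

Lemma sum_sum_divisors_rev (V : nmodType) (N : nat) (G : nat -> nat -> V) :
  \sum_(1 <= n < N.+1) \sum_(q <- divisors n) G q n =
  \sum_(1 <= b < N.+1) \sum_(1 <= q < (N %/ b).+1) G q (q * b)%N.
Proof.
under eq_big_nat => n /andP[n0 _] do rewrite -sum_divisors_rev //.
rewrite sum_sum_divisors; apply: eq_big_nat => b /andP[b0 _].
by apply: eq_big_nat => q _; rewrite mulKn // mulnC.
Qed.

(** * Moebius function *)

(** The least prime p is stripped off; p dividing n/p reveals a square factor. The argument [k] is
    fuel, and any value at least [n] gives the same result. *)
Fixpoint mobius_rec (k n : nat) : int :=
  if k is k'.+1 then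
    if (n <= 1)%N then 1
    else if (pdiv n %| n %/ pdiv n)%N then 0 else - mobius_rec k' (n %/ pdiv n)
  else 1.

Definition mobius n := mobius_rec n n.

Lemma ltn_div_pdiv n : (1 < n)%N -> (n %/ pdiv n < n)%N.
Proof. by move=> n1; rewrite ltn_Pdiv ?prime_gt1 ?pdiv_prime // ltnW. Qed.

Lemma mobius_recE k l n : (n <= k)%N -> (n <= l)%N ->
  mobius_rec k n = mobius_rec l n.
Proof.
elim: k l n => [|k IH] [|l] n //=.
- by rewrite leqn0 => /eqP ->.
- by rewrite leqn0 => _ /eqP ->.
move=> nk nl; case: leqP => // n1; case: ifP => // _; congr (- _).
by have h := ltn_div_pdiv n1; apply: IH; rewrite -ltnS (leq_trans h).
Qed.

Lemma mobius_pdiv n : (1 < n)%N -> mobius n =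
  if (pdiv n %| n %/ pdiv n)%N then 0 else - mobius (n %/ pdiv n).
Proof.
case: n => // n n1; rewrite /mobius /= leqNgt n1 /=; case: ifP => // _.
congr (- _); apply: mobius_recE => //.
by rewrite -ltnS ltn_div_pdiv.
Qed.

(** With p the least prime factor, the divisors p c of n contribute -mu(c) when p does not divide c
    and 0 otherwise, which cancels the divisors of n prime to p. *)
Lemma sum_mobius n : (0 < n)%N -> \sum_(d <- divisors n) mobius d = (n == 1%N)%:R.
Proof.
move=> n0; have [n1|n1] := leqP n 1.
  have -> : n = 1%N by case: n n0 n1 => [|[|]].
  by rewrite [divisors 1]/= big_seq1.
rewrite (gtn_eqF n1); set p := pdiv n.
have pp : prime p := pdiv_prime n1; have p0 := prime_gt0 pp.
have pn : (p %| n)%N := pdiv_dvd n.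
have np0 : (0 < n %/ p)%N by rewrite divn_gt0 // dvdn_leq.
have h1 : (0 < n <= n)%N by rewrite n0 leqnn.
have h2 : (0 < n %/ p <= n)%N by rewrite np0 leq_div.
rewrite (sum_divisors _ h1) (bigID (fun d => p %| d)%N) /=.
rewrite (eq_bigl (fun d => (p %| d) && (d %| n))%N); last by move=> d; rewrite andbC.
rewrite big_mkcondr /= sum_multiples //.
rewrite (eq_big_nat _ _ (F2 := fun c => if (c %| n %/ p)%N && ~~ (p %| c)%N then - mobius c else 0)).
  rewrite -big_mkcond sumrN /=.
  have h3 : (0 < n %/ p <= n %/ p)%N by rewrite np0 leqnn.
  apply/eqP; rewrite addrC subr_eq0; apply/eqP.
  rewrite big_mkcondr [RHS]big_mkcondr /= -(sum_divisors _ h3) (sum_divisors _ h2).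
  rewrite -!big_mkcondr; apply: eq_bigl => d.
  case: (boolP (p %| d)%N) => pd; rewrite ?andbF ?andbT //.
  rewrite -{1}(divnK pn) Gauss_dvdl // coprime_sym prime_coprime //.
move=> c /andP[c0 _]; rewrite -{1}(divnK pn) mulnC dvdn_pmul2r //.
case: (boolP (c %| n %/ p)%N) => //= cnp.
have pc1 : (1 < c * p)%N by rewrite (leq_trans (prime_gt1 pp)) // leq_pmull.
(* The recursion for [c * p] strips off p itself: [c * p] divides n, so it has no smaller prime
   factor. *)
have pE : pdiv (c * p) = p.
  apply/eqP; rewrite eqn_leq pdiv_min_dvd ?prime_gt1 ?dvdn_mull //=.
  apply: pdiv_min_dvd; first by rewrite prime_gt1 // pdiv_prime.
  by apply: dvdn_trans (pdiv_dvd _) _; rewrite -(divnK pn) dvdn_mul.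
by rewrite mobius_pdiv // pE mulnK //; case: (p %| c)%N.
Qed.

Lemma normr_mobius n : `|mobius n| <= 1.
Proof.
rewrite /mobius; move: {1}n => k; elim: k n => [|k IH] n /=; first by rewrite normr1.
case: ifP => _; first by rewrite normr1.
by case: ifP => _; rewrite ?normr0 // normrN.
Qed.

(** * Comparison of complex and real distances *)

Section Complex.
Local Open Scope complex_scope.

Lemma normc_real (R : realType) (x : R) : `|x%:C| = `|x|%:C.
Proof. by rewrite normc_def /= expr0n addr0 sqrtr_sqr. Qed.

(** This eliminates the complex residue: two real sums approximated by the same complex number are
    close to each other, whatever that number is. *)
Lemma normB_le_complex (R : realType) (x y c : R) (z : R[i]) :
  `|x%:C - z| <= c%:C -> `|y%:C - z| <= c%:C -> `|x - y| <= 2 * c.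
Proof.
move=> hx hy; rewrite -lecR -normc_real rmorphB /=.
have -> : x%:C - y%:C = (x%:C - z) - (y%:C - z) by ring.
apply: le_trans (ler_normB _ _) _; rewrite mulrDl mul1r.
by rewrite rmorphD /= lerD.
Qed.
End Complex.

(** * Harmonic sums and bounds for divisor functions *)

Section Real.
Variable R : realType.
Implicit Types (m n N M : nat).

(** The added 1 gives [lg N >= 1] for every N, including 0 where [ln] is 0 by convention, so powers
    of [lg] increase with the exponent. *)
Definition lg N : R := 1 + ln N%:R.

Lemma lg_ge1 N : 1 <= lg N.
Proof. by rewrite lerDl; case: N => [|N]; [rewrite ln0 | rewrite ln_ge0 // ler1n]. Qed.

Lemma lg_ge0 N : 0 <= lg N. Proof. exact: le_trans (lg_ge1 N). Qed.

Lemma lg_homo M N : (M <= N)%N -> lg M <= lg N.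
Proof.
move=> MN; rewrite lerD2l; case: M MN => [|M] MN.
  by rewrite ln0 //; case: N MN => [|N] _; [rewrite ln0 | rewrite ln_ge0 // ler1n].
by rewrite ler_ln ?posrE ?ltr0n ?ler_nat // (leq_trans _ MN).
Qed.

Lemma lnS_bounds n : (0 < n)%N ->
  (n.+1%:R : R)^-1 <= ln n.+1%:R - ln n%:R <= (n%:R : R)^-1.
Proof.
move=> n0; have n0' : (0 : R) < n%:R by rewrite ltr0n.
have n1' : (0 : R) < n.+1%:R by rewrite ltr0n.
rewrite -ln_div ?posrE //; apply/andP; split; last first.
  rewrite -natr1 mulrDl divff ?gt_eqF // mul1r le_ln1Dx //.
  by rewrite (lt_trans _ (_ : 0 < _)) ?invr_gt0 // ltrN10.
rewrite -lerN2 -lnV ?posrE ?divr_gt0 // invf_div.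
have -> : n%:R / n.+1%:R = 1 + - (n.+1%:R : R)^-1.
  by rewrite -{1}[n%:R](addrK 1) natr1 mulrBl divff ?gt_eqF // mul1r.
rewrite le_ln1Dx // ltrN2 invf_lt1 // ltr1n ltnS //.
Qed.

Definition harm N : R := \sum_(1 <= n < N.+1) n%:R^-1.

Lemma harm_le N : harm N <= lg N.
Proof.
rewrite /harm /lg; case: N => [|N]; first by rewrite big_geq // ln0 // addr0.
elim: N => [|N IH]; first by rewrite big_nat1 invr1 ln1 addr0.
rewrite big_nat_recr //= (le_trans (lerD IH (lexx _))) // -addrA lerD2l.
by rewrite -lerBrDl; have /andP[] := @lnS_bounds N.+1 isT.
Qed.

Lemma harm_ge N : ln N.+1%:R <= harm N.
Proof.
elim: N => [|N IH]; first by rewrite ln1 /harm big_geq.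
rewrite /harm big_nat_recr //= (le_trans _ (lerD IH (lexx _))) //.
by rewrite -lerBlDl; have /andP[] := @lnS_bounds N.+1 isT.
Qed.

Lemma harm_diff N d : (0 < d)%N -> harm N - harm (N %/ d) <= lg d.
Proof.
move=> d0; case: (posnP N) => [->|N0].
  by rewrite div0n subrr lg_ge0.
have := harm_ge (N %/ d); have := harm_le N; rewrite /lg.
have : ln N%:R <= ln d%:R + ln (N %/ d).+1%:R :> R.
  rewrite -lnM ?posrE ?ltr0n // -natrM ler_ln ?posrE ?ltr0n ?muln_gt0 ?d0 //.
  by rewrite ler_nat mulnC ltnW // ltn_ceil.
lra.
Qed.

Lemma natr_powR_ge1 n a : (0 < n)%N -> 0 <= a -> 1 <= n%:R `^ a :> R.
Proof.
move=> n0 a0; by rewrite -[leLHS](powRr0 n%:R) ler_powR // ler1n.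
Qed.

(** With e = a/c, the inequality 1 + e log N <= N^e yields lg N <= (1 + 1/e) N^e, which is raised to
    the power c. *)
Lemma lg_pow a (c : nat) : 0 < a -> exists2 C : R, 0 <= C &
  forall N, (0 < N)%N -> lg N ^+ c <= C * N%:R `^ a.
Proof.
move=> a0; case: c => [|c].
  by exists 1 => // N N0; rewrite expr0 mul1r natr_powR_ge1 // ltW.
pose e := a / c.+1%:R.
have e0 : 0 < e by rewrite divr_gt0 // ltr0n.
exists ((1 + e^-1) ^+ c.+1) => [|N N0].
  by rewrite exprn_ge0 // addr_ge0 // invr_ge0 ltW.
have N0' : (N%:R : R) != 0 by rewrite pnatr_eq0 -lt0n.
have -> : N%:R `^ a = (N%:R `^ e) ^+ c.+1.
  by rewrite -powR_mulrn ?powR_ge0 // -powRrM divfK // pnatr_eq0.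
rewrite -exprMn lerXn2r ?nnegrE ?lg_ge0 ?mulr_ge0 ?addr_ge0 ?invr_ge0 ?powR_ge0 ?(ltW e0) //.
rewrite mulrDl mul1r lerD ?natr_powR_ge1 ?(ltW e0) //.
rewrite -ler_pdivrMl ?invr_gt0 // invrK /powR (negPf N0').
by apply: le_trans (expR_ge1Dx _); rewrite lerDr.
Qed.

Lemma powR_nat_recipN n a : (0 < n)%N -> n%:R `^ (- (1 + a)) = n%:R^-1 * n%:R `^ (- a) :> R.
Proof.
move=> n0; rewrite opprD powRD ?powR_inv1 ?ler0n //.
by rewrite pnatr_eq0 -lt0n n0 implybT.
Qed.

Lemma sum_natr_powRN a N : 0 < a ->
  \sum_(1 <= n < N.+1) n%:R `^ (- (1 + a)) <= 1 + a^-1 :> R.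
Proof.
move=> a0; case: N => [|N].
  by rewrite big_geq // addr_ge0 // invr_ge0 ltW.
(* Subtracting the tail of the integral of t^(-1-a) makes the bound inductive. *)
suff : \sum_(1 <= n < N.+2) n%:R `^ (- (1 + a)) <= 1 + a^-1 - a^-1 * N.+1%:R `^ (- a) :> R.
  by move=> /le_trans; apply; rewrite gerBl mulr_ge0 ?powR_ge0 // invr_ge0 ltW.
elim: N => [|N IH]; first by rewrite big_nat1 !powR1 mulr1 addrK.
rewrite big_nat_recr //= (le_trans (lerD IH (lexx _))) //.
rewrite -(ler_pM2l a0) [leLHS]mulrC.
have an0 : a != 0 by rewrite gt_eqF.
set u := N.+1%:R `^ (- a); set v := N.+2%:R `^ (- a).
rewrite powR_nat_recipN // -/v.
suff : a * (N.+2%:R^-1 * v) <= u - v.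
  move=> H; rewrite -subr_ge0; move: H; rewrite -subr_ge0.
  move: (N.+2%:R^-1) u v => t u v H.
  suff -> : a * (1 + a^-1 - a^-1 * v) - (1 + a^-1 - a^-1 * u + t * v) * a =
     (u - v) - a * (t * v) by [].
  by field.
have /andP[lnb _] := @lnS_bounds N.+1 isT.
have uE : u = v * expR (a * (ln N.+2%:R - ln N.+1%:R)).
  rewrite /u /v /powR !pnatr_eq0 /= -expRD; congr expR; ring.
have v0 : 0 <= v by rewrite powR_ge0.
have : 1 + a * (ln N.+2%:R - ln N.+1%:R) <= expR (a * (ln N.+2%:R - ln N.+1%:R)).
  exact: expR_ge1Dx.
have : a * N.+2%:R^-1 <= a * (ln N.+2%:R - ln N.+1%:R) by rewrite ler_pM2l.
rewrite uE; set E := expR _; set t := _^-1; set s := _ - _ => h1 h2.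
have : v * (1 + a * t) <= v * E by rewrite ler_wpM2l //; lra.
lra.
Qed.

Lemma sum_natr_sqrtN N :
  \sum_(1 <= n < N.+1) n%:R `^ (- 2^-1) <= 2 * N%:R `^ (2^-1) :> R.
Proof.
elim: N => [|N IH]; first by rewrite big_geq // powR0 ?mulr0 // gt_eqF.
rewrite big_nat_recr //= (le_trans (lerD IH (lexx _))) //.
rewrite powRN !powR12_sqrt ?ler0n //.
set u := Num.sqrt _; set v := Num.sqrt _.
have v0 : 0 < v by rewrite sqrtr_gt0 ltr0n.
have u0 : 0 <= u by rewrite sqrtr_ge0.
have vv : v ^+ 2 = u ^+ 2 + 1 by rewrite !sqr_sqrtr ?ler0n // natr1.
rewrite -(ler_pM2r v0) mulrDl mulVf ?gt_eqF //.
have : 0 <= (v - u) ^+ 2 by exact: sqr_ge0.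
by nra.
Qed.

Lemma ler_sum_sub (I : eqType) (s t : seq I) (F : I -> R) :
  uniq s -> {subset s <= t} -> (forall i, i \in t -> 0 <= F i) ->
  \sum_(i <- s) F i <= \sum_(i <- t) F i.
Proof.
elim: s t => [|x s IH] t; first by move=> _ _ F0; rewrite big_nil big_seq sumr_ge0.
move=> /= /andP[xs us] st F0; have xt : x \in t by apply: st; rewrite mem_head.
rewrite big_cons (perm_big _ (perm_to_rem xt)) /= big_cons lerD2l.
apply: IH => // [i si|i /mem_rem]; last exact: F0.
apply: rem_mem; first by apply: contraNneq xs => <-.
by apply: st; rewrite inE si orbT.
Qed.

Lemma ler_sum_widen M N (F : nat -> R) : (M <= N)%N ->
  (forall n, (0 < n <= N)%N -> 0 <= F n) ->
  \sum_(1 <= n < M.+1) F n <= \sum_(1 <= n < N.+1) F n.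
Proof.
move=> MN F0; apply: ler_sum_sub; rewrite ?iota_uniq // => i.
  rewrite !mem_index_iota !ltnS => /andP[-> /= iM]; exact: leq_trans MN.
by rewrite mem_index_iota ltnS; exact: F0.
Qed.

Lemma ler_sum_nat_cond N (P : pred nat) (f g : nat -> R) :
  (forall n, (0 < n <= N)%N -> P n -> f n <= g n) ->
  \sum_(1 <= n < N.+1 | P n) f n <= \sum_(1 <= n < N.+1 | P n) g n.
Proof.
move=> fg; rewrite big_mkcond [leRHS]big_mkcond; apply: ler_sum_nat => n hn.
by case: ifP => // Pn; exact: fg.
Qed.

Lemma ler_sum_cond_widen N M (P Q : pred nat) (f : nat -> R) : (N <= M)%N ->
  (forall n, (0 < n <= N)%N -> P n -> Q n) -> (forall n, (0 < n)%N -> 0 <= f n) ->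
  \sum_(1 <= n < N.+1 | P n) f n <= \sum_(1 <= n < M.+1 | Q n) f n.
Proof.
move=> NM PQ f0; rewrite big_mkcond [leRHS]big_mkcond.
apply: (@le_trans _ _ (\sum_(1 <= n < N.+1) if Q n then f n else 0)).
  apply: ler_sum_nat => n hn; case: ifP => [/(PQ n hn) ->//|_].
  by case: ifP => // _; apply: f0; case/andP: hn.
by apply: ler_sum_widen => // n /andP[n0 _]; case: ifP => // _; exact: f0.
Qed.

Lemma sum_divisors_trans N (F : nat -> nat -> R) : (0 < N)%N ->
  \sum_(m <- divisors N) \sum_(q <- divisors m) F q m =
  \sum_(q <- divisors N) \sum_(e <- divisors (N %/ q)) F q (q * e)%N.
Proof.
move=> N0; rewrite (@sum_divisors _ N N) ?N0 ?leqnn //.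
transitivity (\sum_(1 <= m < N.+1) \sum_(q <- divisors m) (if (m %| N)%N then F q m else 0)).
  rewrite big_mkcond /=; apply: eq_bigr => m _; case: ifP => // _.
  by rewrite big1.
rewrite sum_sum_divisors [RHS](@sum_divisors _ N N) ?N0 ?leqnn // [RHS]big_mkcond /=.
apply: eq_big_nat => q /andP[q0 _]; case: (boolP (q %| N)%N) => qN.
  have Nq0 : (0 < N %/ q)%N by rewrite divn_gt0 // dvdn_leq.
  rewrite (@sum_divisors _ _ (N %/ q)) ?Nq0 ?leqnn // [RHS]big_mkcond /=.
  apply: eq_bigr => e _; congr (if _ then _ else _).
  by rewrite -{1}(divnK qN) mulnC dvdn_pmul2r.
apply: big1 => e _; case: ifP => // /(dvdn_trans (dvdn_mulr e (dvdnn q))).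
by rewrite (negPf qN).
Qed.

(** * Mean values and pointwise bounds of divisor functions *)

Definition dk i n : R := (divisor_fun i n)%:R.

Lemma dk_ge0 i n : 0 <= dk i n. Proof. exact: ler0n. Qed.

Lemma dk0 n : dk 0 n = (n == 1%N)%:R. Proof. by rewrite /dk divisor_fun0. Qed.

Lemma dkS i n : (0 < n)%N -> dk i.+1 n = \sum_(q <- divisors n) dk i q.
Proof. by move=> n0; rewrite /dk divisor_funS // natr_sum. Qed.

Lemma sum_dk0 n : (0 < n)%N -> \sum_(q <- divisors n) dk 0 q = 1.
Proof.
move=> n0; rewrite (bigD1_seq 1%N) ?divisors_uniq ?divisor1 //=.
rewrite dk0 big1 ?addr0 // => q q1; by rewrite dk0 (negPf q1).
Qed.

Lemma dk1 n : (0 < n)%N -> dk 1 n = 1.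
Proof. by move=> n0; rewrite dkS // sum_dk0. Qed.

Lemma dk2 n : (0 < n)%N -> dk 2 n = \sum_(q <- divisors n) 1.
Proof.
move=> n0; rewrite dkS // big_seq [RHS]big_seq; apply: eq_bigr => q.
by rewrite -dvdn_divisors // => /(dvdn_gt0 n0) q0; rewrite dk1.
Qed.

(** A divisor q of m n is the product of gcd(q, m), which divides m, and q/gcd(q, m), which divides
    n; the induction hypothesis applies to each such product. *)
Lemma dk_subM i m n : (0 < m)%N -> (0 < n)%N ->
  dk i (m * n) <= dk i m * dk i n.
Proof.
elim: i m n => [|i IH] m n m0 n0.
  by rewrite !dk0 muln_eq1 -natrM ler_nat mulnb.
rewrite !dkS ?muln_gt0 ?m0 // mulr_suml.
pose s := [seq (c * e)%N | c <- divisors m, e <- divisors n].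
apply: (@le_trans _ _ (\sum_(q <- s) dk i q)).
  apply: ler_sum_sub => [|q|q _]; [exact: divisors_uniq| |exact: dk_ge0].
  rewrite -dvdn_divisors ?muln_gt0 ?m0 // => qmn.
  apply/allpairsP; exists (gcdn q m, q %/ gcdn q m)%N => /=; split.
  - by rewrite -dvdn_divisors // dvdn_gcdr.
  - rewrite -dvdn_divisors //.
    have g0 : (0 < gcdn q m)%N by rewrite gcdn_gt0 m0 orbT.
    have cop : coprime (q %/ gcdn q m) (m %/ gcdn q m).
      rewrite /coprime -(@eqn_pmul2r (gcdn q m)) // muln_gcdl mul1n.
      by rewrite !divnK ?dvdn_gcdl ?dvdn_gcdr.
    rewrite -(Gauss_dvdr _ cop) -(@dvdn_pmul2r (gcdn q m)) //.
    by rewrite mulnAC !divnK ?dvdn_gcdl ?dvdn_gcdr.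
  - by rewrite mulnC divnK // dvdn_gcdl.
rewrite big_allpairs_dep big_seq [leRHS]big_seq; apply: ler_sum => c.
rewrite -dvdn_divisors // => /(dvdn_gt0 m0) c0.
rewrite mulr_sumr big_seq [leRHS]big_seq; apply: ler_sum => e.
by rewrite -dvdn_divisors // => /(dvdn_gt0 n0) e0; exact: IH.
Qed.

Definition dksum i N : R := \sum_(1 <= n < N.+1) dk i n / n%:R.

Lemma dksum0 N : (0 < N)%N -> dksum 0 N = 1.
Proof.
move=> N0; rewrite /dksum big_ltn // dk0 eqxx divr1 big1_seq ?addr0 // => n.
by rewrite mem_index_iota dk0 => /andP[_ /andP[/gtn_eqF->]]; rewrite mul0r.
Qed.

Lemma sum_dkS i N (F : nat -> R) :
  \sum_(1 <= n < N.+1) dk i.+1 n * F n =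
  \sum_(1 <= q < N.+1) dk i q * \sum_(1 <= b < (N %/ q).+1) F (q * b)%N.
Proof.
under eq_big_nat => n /andP[n0 _] do rewrite dkS // mulr_suml.
rewrite sum_sum_divisors; apply: eq_bigr => q _; by rewrite mulr_sumr.
Qed.

Lemma sum_dkS_rev i N (F : nat -> R) :
  \sum_(1 <= n < N.+1) dk i.+1 n * F n =
  \sum_(1 <= b < N.+1) \sum_(1 <= q < (N %/ b).+1) dk i q * F (q * b)%N.
Proof.
under eq_big_nat => n /andP[n0 _] do rewrite dkS // mulr_suml.
by rewrite sum_sum_divisors_rev.
Qed.

Lemma dksumS i N : dksum i.+1 N = \sum_(1 <= q < N.+1) dk i q / q%:R * harm (N %/ q).
Proof.
rewrite /dksum sum_dkS; apply: eq_bigr => q _; rewrite -mulrA /harm; congr (_ * _).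
rewrite mulr_sumr; apply: eq_bigr => b _; by rewrite natrM invfM.
Qed.

Lemma dksumS_rev i N : dksum i.+1 N = \sum_(1 <= b < N.+1) b%:R^-1 * dksum i (N %/ b).
Proof.
rewrite /dksum sum_dkS_rev; apply: eq_bigr => b _; rewrite mulr_sumr.
by apply: eq_bigr => q _; rewrite natrM invfM mulrA mulrC.
Qed.

Lemma dksum_le i N : dksum i N <= lg N ^+ i.
Proof.
elim: i N => [|i IH] N.
  case: (posnP N) => [->|N0]; last by rewrite dksum0.
  by rewrite /dksum big_geq // ler01.
rewrite dksumS exprSr (le_trans _ (ler_wpM2r (lg_ge0 _) (IH N))) //.
rewrite mulr_suml; apply: ler_sum => q _; rewrite ler_wpM2l //.
  by rewrite divr_ge0 ?dk_ge0.
by rewrite (le_trans (harm_le _)) // lg_homo // leq_div.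
Qed.

Lemma sum_dkS_le i N : \sum_(1 <= n < N.+1) dk i.+1 n <= N%:R * lg N ^+ i.
Proof.
under eq_bigr do rewrite -[dk _ _]mulr1.
rewrite sum_dkS (le_trans _ (ler_wpM2l (ler0n _ N) (dksum_le i N))) //.
rewrite mulr_sumr; apply: ler_sum_nat => q /andP[q0 _].
rewrite mulrCA ler_wpM2l ?dk_ge0 // sumr_const_nat subSS subn0.
rewrite ler_pdivlMr ?ltr0n // -natrM ler_nat; exact: leq_divM.
Qed.

Lemma sum_dk_le i N : \sum_(1 <= n < N.+1) dk i n <= N%:R * lg N ^+ i.
Proof.
case: i => [|i].
  case: (posnP N) => [->|N0]; first by rewrite big_geq // mul0r.
  rewrite expr0 mulr1 big_ltn // dk0 big1_seq; first by rewrite addr0 ler1n.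
  by move=> n; rewrite mem_index_iota dk0 => /andP[_ /andP[/gtn_eqF->]].
rewrite (le_trans (sum_dkS_le _ _)) // ler_wpM2l // exprS ler_peMl ?lg_ge1 //.
by rewrite exprn_ge0 // lg_ge0.
Qed.

(** Only the innermost harmonic sum changes, by at most [lg d], so one power of [lg N] is traded for
    [lg d]. *)
Lemma dksum_diff i N d : (0 < d)%N ->
  dksum i.+1 N - dksum i.+1 (N %/ d) <= lg d * lg N ^+ i.
Proof.
move=> d0; rewrite [lg d * _]mulrC.
rewrite (le_trans _ (ler_wpM2r (lg_ge0 d) (dksum_le i N))) // mulr_suml.
rewrite !dksumS lerBlDr.
(* The terms with q > N/d are zero, since [harm 0] is an empty sum. *)
have -> : \sum_(1 <= q < (N %/ d).+1) dk i q / q%:R * harm (N %/ d %/ q) =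
   \sum_(1 <= q < N.+1) dk i q / q%:R * harm (N %/ d %/ q).
  rewrite [RHS](big_cat_nat (n := (N %/ d).+1)) ?ltnS ?leq_div //=.
  rewrite [X in _ + X]big1_seq ?addr0 // => q.
  rewrite mem_index_iota => /andP[_ /andP[q1 _]].
  by rewrite [(_ %/ q)%N]divn_small // /harm big_geq // mulr0.
rewrite -big_split /=; apply: ler_sum => q _; rewrite -mulrDr ler_wpM2l //.
  by rewrite divr_ge0 ?dk_ge0.
by rewrite divnAC -lerBlDr harm_diff.
Qed.

Lemma sum_dkS_sqrt i N :
  \sum_(1 <= n < N.+1) dk i.+1 n * n%:R `^ (- 2^-1) <=
  2 * N%:R `^ (2^-1) * lg N ^+ i.
Proof.
rewrite sum_dkS.
have N2 : 0 <= 2 * N%:R `^ (2^-1) :> R by rewrite mulr_ge0 ?powR_ge0.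
rewrite (le_trans _ (ler_wpM2l N2 (dksum_le i N))) //.
rewrite mulr_sumr; apply: ler_sum_nat => q /andP[q0 _].
rewrite mulrCA ler_wpM2l ?dk_ge0 //.
under eq_bigr do rewrite natrM powRM //.
have q0' : (0 : R) < q%:R by rewrite ltr0n.
rewrite -mulr_sumr (le_trans (ler_wpM2l (powR_ge0 _ _) (sum_natr_sqrtN _))) //.
rewrite mulrCA -mulrA ler_pM2l // ler_pdivlMr //.
have -> : (q%:R : R) `^ (- 2^-1) * (N %/ q)%:R `^ (2^-1) * q%:R = (q%:R * (N %/ q)%:R) `^ (2^-1).
  rewrite powRM // mulrAC; congr (_ * _).
  rewrite -{2}[q%:R]powRr1 // -powRD ?(gt_eqF q0') ?implybT //; congr (_ `^ _); lra.
rewrite ge0_ler_powR ?nnegrE ?mulr_ge0 // -natrM ler_nat mulnC; exact: leq_divM.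
Qed.

Lemma sum_dk_sqrt i N :
  \sum_(1 <= n < N.+1) dk i n * n%:R `^ (- 2^-1) <=
  2 * N%:R `^ (2^-1) * lg N ^+ i.
Proof.
have N2 : 0 <= 2 * N%:R `^ (2^-1) :> R by rewrite mulr_ge0 ?powR_ge0.
case: i => [|i]; last first.
  rewrite (le_trans (sum_dkS_sqrt _ _)) // ler_wpM2l // exprS ler_peMl ?lg_ge1 //.
  by rewrite exprn_ge0 // lg_ge0.
case: (posnP N) => [->|N0]; first by rewrite big_geq // mulr1 powR0 ?mulr0 // gt_eqF.
rewrite expr0 mulr1 big_ltn // dk0 powR1 big1_seq.
  rewrite addr0 mulr1 eqxx.
  have : (0 : R) <= 2^-1 by rewrite invr_ge0.
  by move=> /(natr_powR_ge1 N0) h; rewrite (le_trans h) // ler_peMl ?powR_ge0 // ler1n.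
by move=> n; rewrite mem_index_iota dk0 => /andP[_ /andP[/gtn_eqF->]]; rewrite mul0r.
Qed.

Lemma dk2_mono m n : (m %| n)%N -> (0 < n)%N -> dk 2 m <= dk 2 n.
Proof.
move=> mn n0; have m0 := dvdn_gt0 n0 mn; rewrite !dk2 //.
apply: ler_sum_sub => //; first exact: divisors_uniq.
by move=> q; rewrite -!dvdn_divisors // => /dvdn_trans; apply.
Qed.

Lemma divn_dvd_gt0 q n : (0 < n)%N -> (q %| n)%N -> (0 < n %/ q)%N.
Proof. by move=> n0 qn; rewrite divn_gt0 ?(dvdn_gt0 n0) // dvdn_leq. Qed.

Lemma dkSS i n : (0 < n)%N ->
  dk i.+2 n = \sum_(q <- divisors n) dk i q * dk 2 (n %/ q).
Proof.
move=> n0; rewrite dkS //.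
rewrite big_seq (eq_bigr (fun m => \sum_(q <- divisors m) dk i q)); last first.
  by move=> q; rewrite -dvdn_divisors // => /(dvdn_gt0 n0) q0; rewrite dkS.
rewrite -big_seq (sum_divisors_trans (fun q _ => dk i q)) // big_seq [RHS]big_seq.
apply: eq_bigr => q; rewrite -dvdn_divisors // => qn.
by rewrite dk2 ?divn_dvd_gt0 // mulr_sumr; apply: eq_bigr => e _; rewrite mulr1.
Qed.

(** Multiplication by d_2 at most doubles the index. Opening d_(j+1)(n) over q | n, one has d_2(n)
    <= d_2(q) d_2(n/q); induction turns d_2(q) d_j(q) into d_(2j)(q), and summing against d_2(n/q)
    raises the index by two. *)
Lemma dk2_mul_dk j n : (0 < n)%N -> dk 2 n * dk j n <= dk j.*2 n.
Proof.
elim: j n => [|j IH] n n0.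
  rewrite double0 !dk0; case: eqP => [->|_]; last by rewrite mulr0.
  by rewrite dk2 // [divisors 1]/= big_seq1 mulr1.
rewrite doubleS (dkSS j.*2) // [dk j.+1 n]dkS // mulr_sumr big_seq [leRHS]big_seq.
apply: ler_sum => q; rewrite -dvdn_divisors // => qn.
have q0 := dvdn_gt0 n0 qn; have nq0 := divn_dvd_gt0 n0 qn.
rewrite (le_trans _ (ler_wpM2r (dk_ge0 _ _) (IH q q0))) // -mulrA.
rewrite [dk j q * _]mulrC mulrA ler_wpM2r ?dk_ge0 //.
by rewrite -{1}(divnK qn) mulnC dk_subM.
Qed.

Lemma dk2_exp m n : (0 < n)%N -> dk 2 n ^+ m <= dk (2 ^ m) n.
Proof.
move=> n0; elim: m => [|m IH]; first by rewrite expn0 dk1.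
rewrite expnS mul2n exprS (le_trans _ (dk2_mul_dk _ n0)) //.
by rewrite ler_wpM2l ?dk_ge0.
Qed.

Lemma dk_le_dk2 i n : (0 < n)%N -> dk i n <= dk 2 n ^+ i.
Proof.
elim: i n => [|i IH] n n0; first by rewrite dk0 expr0 lern1 leq_b1.
rewrite dkS // exprS [X in X * _]dk2 // mulr_suml big_seq [leRHS]big_seq.
apply: ler_sum => q; rewrite -dvdn_divisors // mul1r => qn.
have q0 := dvdn_gt0 n0 qn.
by rewrite (le_trans (IH _ q0)) // lerXn2r ?nnegrE ?dk_ge0 // dk2_mono.
Qed.

(** A moment argument: d_2(n)^m <= d_(2^m)(n), a single value is at most the sum of all values up to
    n, and that sum is O(n^2). The m-th root with m >= 2/e gives n^e. *)
Lemma dk2_small (e : R) : 0 < e ->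
  exists2 C : R, 0 <= C & forall n, (0 < n)%N -> dk 2 n <= C * n%:R `^ e.
Proof.
move=> e0; pose m := (Num.truncn (2 / e)).+1.
have me : 2 <= m%:R * e.
  by rewrite -ler_pdivrMr // ltW // truncnS_gt.
have [C C0 HC] := @lg_pow 1 (2 ^ m) ltr01.
exists (C `^ (m%:R^-1)) => [|n n0]; first exact: powR_ge0.
have n1 : (1 : R) <= n%:R by rewrite ler1n.
have H : dk 2 n ^+ m <= C * n%:R `^ (m%:R * e).
  rewrite (le_trans (dk2_exp _ n0)) //.
  apply: (@le_trans _ _ (\sum_(1 <= q < n.+1) dk (2 ^ m) q)).
    rewrite big_nat_recr //= lerDr sumr_ge0 // => q _; exact: dk_ge0.
  rewrite (le_trans (sum_dk_le _ _)) //.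
  rewrite (le_trans (ler_wpM2l (ler0n _ n) (HC n n0))) // powRr1 //.
  rewrite mulrCA ler_wpM2l // -expr2 -powR_mulrn // ler_powR //.
have m0 : (m%:R : R) != 0 by rewrite pnatr_eq0.
rewrite -[leLHS]powRr1 ?dk_ge0 // -(divff m0) powRrM powR_mulrn ?dk_ge0 //.
apply: (@le_trans _ _ ((C * n%:R `^ (m%:R * e)) `^ m%:R^-1)).
  by rewrite ge0_ler_powR ?nnegrE ?invr_ge0 ?exprn_ge0 ?mulr_ge0 ?powR_ge0 ?dk_ge0.
by rewrite powRM ?powR_ge0 // -powRrM mulrAC divff // mul1r.
Qed.

Lemma dk_small i (e : R) : 0 < e ->
  exists2 C : R, 0 <= C & forall n, (0 < n)%N -> dk i n <= C * n%:R `^ e.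
Proof.
move=> e0; case: i => [|i].
  exists 1 => // n n0; rewrite mul1r dk0; case: eqP => [->|_]; rewrite ?powR1 ?powR_ge0 //.
have [C C0 HC] := @dk2_small (e / i.+1%:R) (divr_gt0 e0 (ltr0Sn _ _)).
exists (C ^+ i.+1) => [|n n0]; first exact: exprn_ge0.
rewrite (le_trans (dk_le_dk2 _ n0)) //.
have -> : n%:R `^ e = (n%:R `^ (e / i.+1%:R)) ^+ i.+1.
  by rewrite -powR_mulrn ?powR_ge0 // -powRrM divfK // pnatr_eq0.
by rewrite -exprMn lerXn2r ?nnegrE ?dk_ge0 ?mulr_ge0 ?powR_ge0 ?HC.
Qed.

(** * Sums weighted by negative powers of divisors *)

(** This is sigma_(-a)(r). It majorises factors such as r/phi(r) that are bounded on average but not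
    pointwise. *)
Definition wt (a : R) r : R := \sum_(d <- divisors r) d%:R `^ (- a).

Lemma wt_ge0 a r : 0 <= wt a r.
Proof. by apply: sumr_ge0 => d _; exact: powR_ge0. Qed.

Lemma wt_ge1 a r : 1 <= wt a r.
Proof.
rewrite /wt (bigD1_seq 1%N) ?divisors_uniq ?divisor1 //= powR1 lerDl.
by apply: sumr_ge0 => d _; exact: powR_ge0.
Qed.

Lemma wt_dvd a q r : (q %| r)%N -> (0 < r)%N -> wt a q <= wt a r.
Proof.
move=> qr r0; have q0 := dvdn_gt0 r0 qr.
apply: ler_sum_sub => [|d|d _]; [exact: divisors_uniq| |exact: powR_ge0].
by rewrite -!dvdn_divisors // => /dvdn_trans; apply.
Qed.

Lemma wt_anti (a b : R) r : a <= b -> (0 < r)%N -> wt b r <= wt a r.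
Proof.
move=> ab r0; rewrite /wt big_seq [leRHS]big_seq; apply: ler_sum => d.
rewrite -dvdn_divisors // => /(dvdn_gt0 r0) d0.
by rewrite ler_powR ?ler1n // lerN2.
Qed.

Lemma sum_dvd_divisors m r : (m %| r)%N -> (0 < r)%N ->
  \sum_(d <- divisors r) (d %| m)%N%:R = dk 2 m.
Proof.
move=> mr r0; have m0 := dvdn_gt0 r0 mr.
have h1 : (0 < r <= r)%N by rewrite r0 leqnn.
have h2 : (0 < m <= r)%N by rewrite m0 dvdn_leq.
rewrite dk2 // (sum_divisors _ h1) (sum_divisors _ h2).
rewrite big_mkcond [RHS]big_mkcond; apply: eq_bigr => d _.
case: (boolP (d %| m)%N) => [/dvdn_trans/(_ mr) ->//|]; by case: ifP.
Qed.

(** Expanding the square gives pairs d, e of divisors with (d e)^(-a) <= lcm(d, e)^(-a). Sorting by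
    m = lcm(d, e), at most d_2(m)^2 pairs occur, and d_2(m)^2 is O(m^(a-c)). *)
Lemma wt_sqr (a c : R) : 0 < a -> c < a ->
  exists2 C : R, 0 <= C & forall r, (0 < r)%N -> wt a r ^+ 2 <= C * wt c r.
Proof.
move=> a0 ca; have ac0 : 0 < (a - c) / 2 by rewrite divr_gt0 // subr_gt0.
have [C C0 HC] := dk2_small ac0; exists (C ^+ 2) => [|r r0]; first exact: exprn_ge0.
apply: (@le_trans _ _ (\sum_(m <- divisors r) dk 2 m ^+ 2 * m%:R `^ (- a))); last first.
  rewrite /wt mulr_sumr big_seq [leRHS]big_seq; apply: ler_sum => m.
  rewrite -dvdn_divisors // => /(dvdn_gt0 r0) m0.
  apply: (@le_trans _ _ ((C * m%:R `^ ((a - c) / 2)) ^+ 2 * m%:R `^ (- a))).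
    rewrite ler_wpM2r ?powR_ge0 // lerXn2r ?nnegrE ?dk_ge0 ?mulr_ge0 ?powR_ge0 //.
    by apply: HC; rewrite ?subr_gt0.
  rewrite exprMn -mulrA ler_wpM2l ?exprn_ge0 //.
  rewrite -powR_mulrn ?powR_ge0 // -powRrM divfK ?pnatr_eq0 // -powRD; last first.
    by rewrite pnatr_eq0 -lt0n m0 implybT.
  by rewrite (_ : a - c - a = - c) //; ring.
pose F m : R := m%:R `^ (- a).
have F0 m : 0 <= F m by exact: powR_ge0.
apply: (@le_trans _ _ (\sum_(d <- divisors r) \sum_(e <- divisors r)
   \sum_(m <- divisors r) ((d %| m)%N && (e %| m)%N)%:R * F m)).
  rewrite expr2 /wt mulr_suml big_seq [leRHS]big_seq; apply: ler_sum => d.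
  rewrite -dvdn_divisors // => dr; have d0 := dvdn_gt0 r0 dr.
  rewrite mulr_sumr big_seq [leRHS]big_seq; apply: ler_sum => e.
  rewrite -dvdn_divisors // => er; have e0 := dvdn_gt0 r0 er.
  rewrite (bigD1_seq (lcmn d e)) ?divisors_uniq //=; last first.
    by rewrite -dvdn_divisors // dvdn_lcm dr.
  rewrite dvdn_lcml dvdn_lcmr mul1r -powRM //.
  apply: (@le_trans _ _ (F (lcmn d e))); last first.
    by rewrite lerDl sumr_ge0 // => m _; rewrite mulr_ge0.
  have l0 : (0 < lcmn d e)%N by rewrite lcmn_gt0 d0.
  rewrite /F !powRN -natrM lef_pV2 ?posrE ?powR_gt0 ?ltr0n ?muln_gt0 ?d0 //.
  rewrite ge0_ler_powR ?nnegrE ?(ltW a0) // ler_nat dvdn_leq ?muln_gt0 ?d0 //.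
  by rewrite dvdn_lcm dvdn_mulr // dvdn_mull.
under eq_bigr do rewrite exchange_big /=.
rewrite exchange_big /= big_seq [leRHS]big_seq; apply: ler_sum => m.
rewrite -dvdn_divisors // => mr; have m0 := dvdn_gt0 r0 mr.
under eq_bigr do under eq_bigr do rewrite -mulnb natrM.
under eq_bigr => d _.
  rewrite -mulr_suml -mulr_sumr (sum_dvd_divisors mr r0); over.
rewrite -mulr_suml -mulr_suml sum_dvd_divisors //.
Qed.

(** Induction on r, removing the full power of its least prime p. If m is the cofactor, then d and p
    d for d | m are distinct divisors of r, so the weight gains a factor 1 + p^(-1/2), and (p-1)(1 +
    p^(-1/2))^2 >= p. *)
Lemma totient_wt r : (0 < r)%N ->
  r%:R <= (totient r)%:R * wt (2^-1) r ^+ 2.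
Proof.
elim/ltn_ind: r => r IH r0; have [r1|r1] := leqP r 1.
  have -> : r = 1%N by case: r r0 r1 {IH} => [|[|]].
  by rewrite mul1r exprn_ege1 // wt_ge1.
have pp := pdiv_prime r1; set p := pdiv r in pp.
have [m pm rE] := pfactor_coprime pp r0.
set e := logn p r in rE.
have e0 : (0 < e)%N by rewrite logn_gt0 mem_primes pp r0 pdiv_dvd.
have m0 : (0 < m)%N by rewrite rE muln_gt0 in r0; case/andP: r0.
have p1 := prime_gt1 pp; have p0 := ltnW p1.
have mr : (m < r)%N by rewrite rE -[ltnLHS]muln1 ltn_pmul2l // -[1%N](expn0 p) ltn_exp2l.
have IHm := IH m mr m0.
have w : (1 + p%:R `^ (- 2^-1)) * wt (2^-1) m <= wt (2^-1) r.
  rewrite mulrDl mul1r {1 2}/wt mulr_sumr.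
  rewrite [X in _ + X](eq_bigr (fun d => (p * d)%:R `^ (- 2^-1))); last first.
    by move=> d _; rewrite natrM powRM.
  rewrite -(big_map (muln p) predT (fun d => d%:R `^ (- 2^-1))) -big_cat /=.
  apply: ler_sum_sub => [|d|d _]; last exact: powR_ge0.
    rewrite cat_uniq divisors_uniq map_inj_uniq ?divisors_uniq; last first.
      by move=> a b /eqP; rewrite eqn_pmul2l // => /eqP.
    rewrite andbT; apply/hasPn => d /mapP[c _ ->].
    rewrite -dvdn_divisors //; apply/negP => /(dvdn_trans (dvdn_mulr _ (dvdnn p))).
    by move: pm; rewrite prime_coprime // => /negPf ->.
  rewrite mem_cat => /orP[|/mapP[c + ->]]; rewrite -!dvdn_divisors // rE.
    by move=> /dvdn_mulr; apply.
  by move=> cm; rewrite mulnC dvdn_mul // dvdn_exp.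
have w2 : ((1 + p%:R `^ (- 2^-1)) * wt (2^-1) m) ^+ 2 <= wt (2^-1) r ^+ 2.
  by rewrite lerXn2r ?nnegrE ?mulr_ge0 ?wt_ge0 ?addr_ge0 ?powR_ge0.
apply: le_trans (ler_wpM2l (ler0n _ _) w2).
rewrite {1}rE {1}rE totient_coprime ?coprimeXr // 1?coprime_sym //.
rewrite totient_pfactor // !natrM exprMn.
rewrite (_ : _ * _ * _ = ((totient m)%:R * wt 2^-1 m ^+ 2) *
   ((p.-1)%:R * (1 + p%:R `^ (- 2^-1)) ^+ 2 * (p ^ e.-1)%:R)); last by ring.
apply: ler_pM => //.
rewrite -{1}(prednK e0) expnS natrM ler_wpM2r //.
set t := p%:R `^ _.
have tt : p%:R * t ^+ 2 = 1.
  rewrite /t -powR_mulrn ?powR_ge0 // -powRrM mulNr mulVf // powR_inv1 // divff //.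
  by rewrite pnatr_eq0 -lt0n.
have t0 : 0 <= t by exact: powR_ge0.
have pE : (p.-1)%:R = p%:R - 1 :> R by rewrite -subn1 natrB.
have p2 : 2 <= p%:R :> R by rewrite ler_nat.
rewrite pE; move: (p%:R) tt p2 => P tt p2.
have t2 : t ^+ 2 <= 2^-1.
  rewrite -(@ler_pM2l _ P) ?tt; last by lra.
  lra.
(* As p t^2 = 1, the expression equals t^2 ((p-1)(1+t)^2 - p). *)
have : 0 <= t * (2 - 2 * t ^+ 2 - t ^+ 3).
  rewrite mulr_ge0 // exprS; nra.
nra.
Qed.

(** The square of [wt 2^-1] from the totient bound is made linear at the price of the smaller
    exponent 1/4; since g <= h, passing from r to r/g costs a factor h. *)
Lemma totientV_wt h : exists2 C : R, 0 <= C & forall r g, (0 < r)%N ->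
  (g %| r)%N -> (g <= h)%N ->
  ((totient (r %/ g))%:R : R)^-1 <= C * (wt 4^-1 r / r%:R).
Proof.
have [C C0 HC] := @wt_sqr 2^-1 4^-1 ltac:(lra) ltac:(lra).
exists (h%:R * C) => [|r g r0 gr gh]; first exact: mulr_ge0.
have R0 := divn_dvd_gt0 r0 gr; set q := (r %/ g)%N in R0 *.
have r0' : (0 : R) < r%:R by rewrite ltr0n.
have q0' : (0 : R) < q%:R by rewrite ltr0n.
have f0 : (0 : R) < (totient q)%:R by rewrite ltr0n totient_gt0.
have rq : r%:R <= h%:R * q%:R :> R.
  by rewrite -natrM ler_nat -{1}(divnK gr) mulnC leq_mul2r gh orbT.
rewrite mulrA ler_pdivlMr // ler_pdivrMl //.
apply: le_trans rq _.
rewrite (_ : _ * (h%:R * C * _) = h%:R * ((totient q)%:R * (C * wt 4^-1 r))); last by ring.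
rewrite ler_wpM2l //.
apply: le_trans (totient_wt R0) _; rewrite ler_wpM2l //.
apply: le_trans (HC _ R0) _; rewrite ler_wpM2l // wt_dvd //.
exact: dvdn_div.
Qed.

(* The factor d_i of a multiple of d is absorbed by d_i(d b) <= d_i(d) d_i(b). *)
Lemma sum_dk_wt i N a (f : nat -> R) :
  (forall b, 0 <= f b) -> (forall a b, f (a * b)%N = f a * f b) ->
  \sum_(1 <= r < N.+1) dk i r * wt a r * f r <=
  \sum_(1 <= d < N.+1) (dk i d * d%:R `^ (- a) * f d) *
     \sum_(1 <= b < (N %/ d).+1) dk i b * f b.
Proof.
move=> f0 fM.
under eq_bigr do rewrite mulrAC mulr_sumr.
rewrite sum_sum_divisors; apply: ler_sum_nat => d /andP[d0 _].
rewrite mulr_sumr; apply: ler_sum_nat => b /andP[b0 _].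
rewrite fM (_ : _ * _ * (_ * f b) = dk i d * dk i b * (f d * f b * d%:R `^ (- a))); last by ring.
by rewrite -mulrA ler_wpM2r ?dk_subM // !mulr_ge0 ?powR_ge0.
Qed.

Lemma sum_dk_wt_bound i (a : R) : 0 < a -> exists2 C : R, 0 <= C &
  forall N, \sum_(1 <= d < N.+1) dk i d * d%:R `^ (- a) / d%:R <= C.
Proof.
move=> a0; have a2 : 0 < a / 2 by lra.
have [C C0 HC] := @dk_small i _ a2.
exists (C * (1 + (a / 2)^-1)) => [|N].
  by rewrite mulr_ge0 // addr_ge0 // invr_ge0 ltW.
apply: le_trans (ler_wpM2l C0 (sum_natr_powRN N a2)).
rewrite mulr_sumr; apply: ler_sum_nat => d /andP[d0 _].
rewrite powR_nat_recipN // (_ : - a = - (a / 2) + - (a / 2)); last by lra.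
rewrite powRD ?pnatr_eq0 -?lt0n ?d0 ?implybT //.
have := HC d d0; have u0 : 0 < d%:R `^ (a / 2) by apply: powR_gt0; rewrite ltr0n.
rewrite powRN -ler_pdivrMr // => h.
rewrite (_ : _ * _ / _ = dk i d / d%:R `^ (a / 2) * (d%:R^-1 * (d%:R `^ (a / 2))^-1)).
  by rewrite ler_wpM2r // mulr_ge0 // invr_ge0 // ltW.
by rewrite mulrA; ring.
Qed.

Lemma sum_dk_wt_div i (a : R) : 0 < a -> exists2 C : R, 0 <= C &
  forall N, \sum_(1 <= r < N.+1) dk i r * wt a r / r%:R <= C * lg N ^+ i.
Proof.
move=> a0; have [C C0 HC] := sum_dk_wt_bound i a0; exists C => // N.
apply: le_trans (ler_wpM2r (exprn_ge0 _ (lg_ge0 N)) (HC N)).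
apply: le_trans (@sum_dk_wt i N a (fun r => r%:R^-1) _ _) _ => [b|b c|].
- by rewrite invr_ge0.
- by rewrite natrM invfM.
rewrite mulr_suml; apply: ler_sum_nat => d /andP[d0 _].
rewrite ler_wpM2l ?mulr_ge0 ?dk_ge0 ?powR_ge0 ?invr_ge0 //.
apply: le_trans (@dksum_le i (N %/ d)) _; rewrite lerXn2r ?nnegrE ?lg_ge0 //.
by rewrite lg_homo // leq_div.
Qed.

Lemma lg_le N : (0 < N)%N -> lg N <= N%:R.
Proof.
move=> N0; have N0' : (0 : R) < N%:R by rewrite ltr0n.
have h : -1 < N%:R - 1 :> R by rewrite ltrBrDl subrr.
have := le_ln1Dx h; rewrite [1 + _]addrC subrK /lg.
by rewrite lerBrDl.
Qed.

(** The factor [lg N] on the left expresses the bound N log^(i-1) N without a negative exponent at i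
    = 0. *)
Lemma sum_dk_wt_le i (a : R) : 0 < a -> exists2 C : R, 0 <= C &
  forall N, (0 < N)%N ->
  lg N * \sum_(1 <= r < N.+1) dk i r * wt a r <= C * (N%:R * lg N ^+ i).
Proof.
move=> a0; case: i => [|i].
  exists 1 => // N N0; rewrite mul1r expr0 mulr1 big_ltn // dk0 eqxx mul1r.
  rewrite /wt [divisors 1]/= big_seq1 powR1 big1_seq ?addr0 ?mulr1 ?lg_le // => n.
  by rewrite mem_index_iota dk0 => /andP[_ /andP[/gtn_eqF->]]; rewrite mul0r.
have [C C0 HC] := sum_dk_wt_bound i.+1 a0; exists C => // N N0.
have LN : 0 <= N%:R * lg N ^+ i.+1 by rewrite mulr_ge0 ?exprn_ge0 ?lg_ge0.
apply: le_trans (ler_wpM2r LN (HC N)).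
have E (S : R) : S * (N%:R * (lg N * lg N ^+ i)) = lg N * (S * (N%:R * lg N ^+ i)).
  by ring.
rewrite exprS E {E}.
rewrite ler_wpM2l ?lg_ge0 //.
under eq_bigr do rewrite -[dk _ _ * _]mulr1.
apply: le_trans (@sum_dk_wt i.+1 N a (fun=> 1) _ _) _ => [//|b c|].
  by rewrite mulr1.
rewrite mulr_suml; apply: ler_sum_nat => d /andP[d0 _].
rewrite mulr1 -[leRHS]mulrA ler_wpM2l ?mulr_ge0 ?dk_ge0 ?powR_ge0 //.
under eq_bigr do rewrite mulr1.
apply: le_trans (sum_dkS_le _ _) _; rewrite mulrA ler_pM ?exprn_ge0 ?lg_ge0 //.
  rewrite mulrC ler_pdivlMr ?ltr0n // -natrM ler_nat; exact: leq_divM.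
by rewrite lerXn2r ?nnegrE ?lg_ge0 ?lg_homo // leq_div.
Qed.

(** * Thresholds of truncated divisor sums *)

Lemma le_powR_root (A x y : R) : 0 < A -> 0 <= x -> 0 <= y ->
  (x <= y `^ A) = (x `^ A^-1 <= y).
Proof.
move=> A0 x0 y0; have An : A != 0 by rewrite gt_eqF.
apply/idP/idP => h.
  rewrite -[leRHS]powRr1 // -(divff An) powRrM.
  by rewrite ge0_ler_powR ?nnegrE ?powR_ge0 ?invr_ge0 // ltW.
rewrite -[leLHS]powRr1 // -(mulVf An) powRrM.
by rewrite ge0_ler_powR ?nnegrE ?powR_ge0 // ltW.
Qed.

(* The least n with r <= n^A, see [tauP]. *)
Definition tau (A : R) r : nat := `|Num.ceil (r%:R `^ A^-1 : R)|%N.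

Lemma tauP (A : R) r n : 0 < A -> (r%:R <= n%:R `^ A) = (tau A r <= n)%N.
Proof.
move=> A0; rewrite le_powR_root // /tau -lez_nat.
have c0 : (0 <= Num.ceil (r%:R `^ A^-1))%R by rewrite -(ceil0 R) le_ceil // powR_ge0.
by rewrite gez0_abs // ceil_le_int.
Qed.

Lemma tau_gt0 (A : R) r : 0 < A -> (0 < r)%N -> (0 < tau A r)%N.
Proof.
move=> A0 r0; rewrite ltnNge -tauP // powR0 ?gt_eqF //.
by rewrite -ltNge ltr0n.
Qed.

Lemma le_tau_powR (A : R) r : 0 < A -> r%:R <= (tau A r)%:R `^ A.
Proof. by move=> A0; rewrite tauP. Qed.

Lemma tau_le (A : R) r : 0 < A -> (0 < r)%N -> (tau A r)%:R <= 2 * r%:R `^ A^-1.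
Proof.
move=> A0 r0; have r1 : 1 <= r%:R `^ A^-1 by rewrite natr_powR_ge1 // invr_ge0 ltW.
have h : (tau A r).-1%:R < r%:R `^ A^-1.
  rewrite ltNge -le_powR_root // tauP // -ltnNge prednK ?leqnn ?tau_gt0 //.
have : (tau A r)%:R = (tau A r).-1%:R + 1 :> R by rewrite natr1 prednK // tau_gt0.
lra.
Qed.

Lemma truncn_powR (A : R) M : 0 <= A <= 1 -> (0 < M)%N ->
  let Y := Num.truncn (M%:R `^ A) in
  [/\ (0 < Y <= M)%N, Y%:R <= M%:R `^ A & M%:R `^ A <= 2 * Y%:R].
Proof.
move=> /andP[A0 A1] M0 Y.
have M1 : 1 <= M%:R `^ A by rewrite natr_powR_ge1.
have Y1 : Y%:R <= M%:R `^ A by rewrite truncn_le // powR_ge0.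
have Y0 : (0 < Y)%N by rewrite truncn_gt0.
have Y2 : M%:R `^ A < Y.+1%:R by rewrite truncnS_gt.
split => //.
  rewrite Y0 -(ler_nat R) (le_trans Y1) // -[leRHS]powRr1 // ler_powR //.
  by rewrite ler1n.
rewrite (le_trans (ltW Y2)) // -natrM ler_nat; lia.
Qed.

Lemma lg_truncn_powR (A : R) M : 0 < A <= 1 -> (0 < M)%N ->
  lg M <= (1 + A^-1) * lg (Num.truncn (M%:R `^ A)).
Proof.
move=> /andP[A0 A1] M0; have A01 : 0 <= A <= 1 by rewrite ltW.
have [] := truncn_powR A01 M0; set Y := Num.truncn _ => /andP[Y0 _] Y1 Y2.
have lM : A * ln M%:R <= 1 + ln Y%:R :> R.
  rewrite -ln_powR (@le_trans _ _ (ln (2 * Y%:R))) //.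
    by rewrite ler_ln ?posrE ?powR_gt0 ?mulr_gt0 ?ltr0n.
  rewrite lnM ?posrE ?ltr0n // lerD2r.
  by have := @lg_le 2 isT; rewrite /lg; lra.
have lY : 0 <= ln Y%:R :> R by rewrite ln_ge0 // ler1n.
have : ln M%:R <= A^-1 * (1 + ln Y%:R) :> R by rewrite ler_pdivlMl.
rewrite /lg; lra.
Qed.

Lemma sum_tau_truncn (A : R) M (f : nat -> R) : 0 < A <= 1 -> (0 < M)%N ->
  \sum_(1 <= r < M.+1 | (tau A r <= M)%N) f r =
  \sum_(1 <= r < (Num.truncn (M%:R `^ A)).+1) f r.
Proof.
move=> /andP[A0 A1] M0; have A01 : 0 <= A <= 1 by rewrite ltW.
have [] := truncn_powR A01 M0; set Y := Num.truncn _ => /andP[Y0 YM] Y1 _.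
rewrite (big_cat_nat (n := Y.+1)) //= [X in _ + X]big1_seq ?addr0.
  rewrite big_nat_cond [RHS]big_nat_cond; apply: eq_bigl => r.
  rewrite andbT; case: (boolP (0 < r < Y.+1)%N) => //= /andP[_ rY].
  by rewrite -tauP // (le_trans _ Y1) // ler_nat.
move=> r /andP[tr]; rewrite mem_index_iota => /andP[Yr _]; exfalso.
move: tr; rewrite -tauP // => h.
by have := le_lt_trans h (truncnS_gt _); rewrite ltr_nat ltnNge Yr.
Qed.

(** As [tau A r] <= 2 r^(1/A), the last factor is at most 2 (M^A)^(1/A-1) on the whole range r <=
    M^A. What remains is an unweighted sum of length M^A, which has one logarithm less than a sum
    against 1/r. *)
Lemma sum_tau i (A a : R) : 0 < A <= 1 -> 0 < a -> exists2 C : R, 0 <= C &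
  forall M, (0 < M)%N ->
  lg M * \sum_(1 <= r < M.+1 | (tau A r <= M)%N) dk i r * wt a r * ((tau A r)%:R / r%:R)
  <= C * (M%:R * lg M ^+ i).
Proof.
move=> A01 a0; have [C C0 HC] := sum_dk_wt_le i a0.
have /andP[A0 A1] := A01.
have A01' : 0 <= A <= 1 by rewrite ltW.
exists (2 * (1 + A^-1) * C) => [|M M0].
  by rewrite !mulr_ge0 // addr_ge0 // invr_ge0 ltW.
have [] := truncn_powR A01' M0; have := lg_truncn_powR A01 M0.
set Y := Num.truncn _ => lMY /andP[Y0 YM] Y1 Y2.
have M0' : (0 : R) < M%:R by rewrite ltr0n.
set S := \sum_(1 <= r < Y.+1) dk i r * wt a r.
have S0 : 0 <= S by apply: sumr_ge0 => r _; rewrite mulr_ge0 ?dk_ge0 ?wt_ge0.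
have AV : 0 <= A^-1 - 1 by rewrite subr_ge0 invf_ge1.
have H : \sum_(1 <= r < M.+1 | (tau A r <= M)%N) dk i r * wt a r * ((tau A r)%:R / r%:R)
    <= 2 * (M%:R `^ A) `^ (A^-1 - 1) * S.
  rewrite sum_tau_truncn // -/Y.
  rewrite mulr_sumr; apply: ler_sum_nat => r /andP[r0 rY].
  rewrite mulrC ler_wpM2r ?mulr_ge0 ?dk_ge0 ?wt_ge0 //.
  have r0' : (0 : R) < r%:R by rewrite ltr0n.
  rewrite ler_pdivrMr // (le_trans (tau_le A0 r0)) // -mulrA ler_wpM2l //.
  apply: (@le_trans _ _ (r%:R `^ (A^-1 - 1) * r%:R)).
    by rewrite [leRHS]mulrC mulr_powRB1 // invr_gt0.
  rewrite ler_wpM2r // ge0_ler_powR ?nnegrE ?powR_ge0 // (le_trans _ Y1) // ler_nat //.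
apply: le_trans (ler_wpM2l (lg_ge0 _) H) _.
have HY := HC Y Y0.
have P0 : 0 <= (M%:R `^ A) `^ (A^-1 - 1) by exact: powR_ge0.
have L : lg M * S <= (1 + A^-1) * (C * (M%:R `^ A * lg M ^+ i)).
  apply: le_trans (ler_wpM2r S0 lMY) _; rewrite -mulrA ler_wpM2l ?addr_ge0 ?invr_ge0 ?(ltW A0) //.
  apply: le_trans HY _; rewrite ler_wpM2l // ler_pM ?exprn_ge0 ?lg_ge0 //.
  by rewrite lerXn2r ?nnegrE ?lg_ge0 ?lg_homo.
rewrite (_ : lg M * (2 * _ * S) = 2 * (M%:R `^ A) `^ (A^-1 - 1) * (lg M * S)); last by ring.
apply: le_trans (ler_wpM2l (mulr_ge0 _ P0) L) _ => //.
have E : (M%:R `^ A) `^ (A^-1 - 1) * (M%:R `^ A) = M%:R.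
  by rewrite mulrC mulr_powRB1 ?powR_ge0 ?invr_gt0 // -powRrM divff ?gt_eqF // powRr1.
rewrite -[in leRHS]E le_eqVlt; apply/orP; left; apply/eqP; ring.
Qed.

(** * Moebius inversion and counting *)

Definition mu n : R := (mobius n)%:~R.

Lemma mu_le1 n : `|mu n| <= 1.
Proof. by rewrite /mu -intr_norm -[leRHS](mulr1z 1) ler_int normr_mobius. Qed.

Lemma sum_mu n : (0 < n)%N -> \sum_(d <- divisors n) mu d = (n == 1%N)%:R.
Proof.
move=> n0; rewrite /mu -mulrz_sumr sum_mobius //.
by case: (n == 1%N).
Qed.

Definition moebius_inv (w : nat -> R) n := \sum_(f <- divisors n) mu (n %/ f) * w f.

Lemma sum_moebius_inv w n : (0 < n)%N ->
  \sum_(d <- divisors n) moebius_inv w d = w n.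
Proof.
move=> n0; rewrite /moebius_inv (sum_divisors_trans (fun f d => mu (d %/ f) * w f)) //.
rewrite (bigD1_seq n) ?divisors_uniq ?divisors_id //= divnn n0.
rewrite [divisors 1]/= big_seq1 muln1 divnn n0 big1_seq ?addr0.
  by rewrite /mu mul1r.
move=> q /andP[qn]; rewrite -dvdn_divisors // => qdn; have q0 := dvdn_gt0 n0 qdn.
rewrite (eq_bigr (fun e => mu e * w q)) => [|e _]; last by rewrite mulKn.
rewrite -mulr_suml sum_mu ?divn_dvd_gt0 //.
have -> : (n %/ q == 1)%N = false; last by rewrite mul0r.
apply: contraNF qn => /eqP nq1; by rewrite eq_sym -(divnK qdn) nq1 mul1n.
Qed.

Lemma moebius_inv_le w n : `|moebius_inv w n| <= \sum_(f <- divisors n) `|w f|.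
Proof.
apply: le_trans (ler_norm_sum _ _ _) _; apply: ler_sum => f _.
by rewrite normrM ler_piMl // mu_le1.
Qed.

(** Writing w as the divisor sum of its Moebius transform turns dependence on gcd(n, r) into
    divisibility of n by divisors of r. *)
Lemma sum_gcd w F r N : (0 < r)%N ->
  \sum_(1 <= n < N.+1) w (gcdn n r) * F n =
  \sum_(d <- divisors r) moebius_inv w d * \sum_(1 <= n < N.+1 | (d %| n)%N) F n.
Proof.
move=> r0.
have E n : (0 < n)%N -> w (gcdn n r) * F n =
    \sum_(d <- divisors r) (if (d %| n)%N then moebius_inv w d * F n else 0).
  move=> n0; have g0 : (0 < gcdn n r)%N by rewrite gcdn_gt0 n0.
  have h1 : (0 < gcdn n r <= r)%N by rewrite g0 dvdn_leq // dvdn_gcdr.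
  have h2 : (0 < r <= r)%N by rewrite r0 leqnn.
  rewrite -(sum_moebius_inv w g0) (sum_divisors _ h1) (sum_divisors _ h2) mulr_suml.
  rewrite [RHS]big_mkcond [LHS]big_mkcond; apply: eq_bigr => d _.
  by rewrite dvdn_gcd andbC; case: (d %| r)%N => //=; case: (d %| n)%N => //; rewrite mul0r.
under eq_big_nat => n /andP[n0 _] do rewrite E //.
rewrite exchange_big /=; apply: eq_bigr => d _.
by rewrite mulr_sumr [RHS]big_mkcond.
Qed.

Lemma sum1_nat N : \sum_(1 <= n < N.+1) (1 : R) = N%:R.
Proof. by rewrite sumr_const_nat subSS subn0. Qed.

Lemma moebius_inv_delta d : (0 < d)%N -> moebius_inv (fun c => (c == 1%N)%:R) d = mu d.
Proof.
move=> d0; rewrite /moebius_inv (bigD1_seq 1%N) ?divisors_uniq ?divisor1 //=.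
rewrite divn1 mulr1 big1 ?addr0 // => f /negPf ->; by rewrite mulr0.
Qed.

Lemma count_coprime r N : (0 < r)%N ->
  \sum_(1 <= n < N.+1) (coprime n r)%:R =
  \sum_(d <- divisors r) mu d * (N %/ d)%:R :> R.
Proof.
move=> r0; rewrite (eq_bigr (fun n => (gcdn n r == 1%N)%:R * 1)) => [|n _]; last by rewrite mulr1.
rewrite (sum_gcd (fun c => (c == 1%N)%:R) (fun=> 1)) //.
rewrite big_seq [RHS]big_seq; apply: eq_bigr => d.
rewrite -dvdn_divisors // => /(dvdn_gt0 r0) d0.
by rewrite moebius_inv_delta // sum_multiples // sum1_nat.
Qed.

Lemma totient_count r : (0 < r)%N ->
  (totient r)%:R = \sum_(1 <= n < r.+1) (coprime n r)%:R :> R.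
Proof.
move=> r0; rewrite totient_count_coprime natr_sum big_nat_recr //= big_ltn //.
rewrite addrC /coprime gcdn0 gcdnn; congr (_ + _).
by apply: eq_bigr => d _; rewrite gcdnC.
Qed.

Lemma sum_mu_div r : (0 < r)%N ->
  \sum_(d <- divisors r) mu d / d%:R = (totient r)%:R / r%:R.
Proof.
move=> r0; have r0' : (r%:R : R) != 0 by rewrite pnatr_eq0 -lt0n.
apply: (mulIf r0'); rewrite divfK // mulr_suml.
rewrite totient_count // count_coprime // big_seq [RHS]big_seq; apply: eq_bigr => d.
rewrite -dvdn_divisors // => dr; have d0 := dvdn_gt0 r0 dr.
have d0' : (d%:R : R) != 0 by rewrite pnatr_eq0 -lt0n.
by rewrite -{1}(divnK dr) natrM -mulrA [_ * d%:R]mulrC mulKf.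
Qed.

(** The error is at most min(1, N/m), hence at most the square root. In this form it splits over m =
    c d, and summing over d | r gives [wt 2^-1 r] instead of the number of divisors. *)
Lemma floor_err N m : (0 < m)%N ->
  `|(N %/ m)%:R - N%:R / m%:R| <= (N%:R / m%:R) `^ (2^-1) :> R.
Proof.
move=> m0; have m0' : (0 : R) < m%:R by rewrite ltr0n.
set z := N%:R / m%:R; have z0 : 0 <= z by rewrite divr_ge0.
have h1 : (N %/ m)%:R <= z by rewrite ler_pdivlMr // -natrM ler_nat leq_divM.
have h2 : z < (N %/ m)%:R + 1 by rewrite ltr_pdivrMr // natr1 -natrM ltr_nat ltn_ceil.
have h3 : (0 : R) <= (N %/ m)%:R by [].
rewrite distrC ger0_norm ?subr_ge0 //.
have [z1|z1] := leP 1 z.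
  apply: (@le_trans _ _ 1); first by lra.
  by rewrite -[leLHS](powRr0 z) ler_powR // invr_ge0.
case: (eqVneq z 0) => [ze|zn].
  by rewrite (le_trans _ (powR_ge0 _ _)) // ze sub0r oppr_le0.
apply: (@le_trans _ _ z); first by lra.
have zz : 0 < z <= 1 by rewrite lt0r zn z0 ltW.
have i2 : 2^-1 <= 1 :> R by rewrite invf_le1 // ler1n.
exact: ger1_powR.
Qed.

Lemma count_coprime_err r c N : (0 < r)%N -> (0 < c)%N ->
  `|\sum_(1 <= n < (N %/ c).+1) (coprime n r)%:R -
    N%:R / c%:R * ((totient r)%:R / r%:R)| <=
  (N%:R / c%:R) `^ (2^-1) * wt (2^-1) r :> R.
Proof.
move=> r0 c0; rewrite count_coprime // -sum_mu_div // !mulr_sumr -sumrB.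
apply: le_trans (ler_norm_sum _ _ _) _.
rewrite big_seq [leRHS]big_seq; apply: ler_sum => d.
rewrite -dvdn_divisors // => /(dvdn_gt0 r0) d0.
rewrite mulrCA -mulrBr normrM -divnMA.
have -> : N%:R / c%:R / d%:R = N%:R / (c * d)%:R :> R by rewrite natrM invfM mulrA.
have cd0 : (0 < c * d)%N by rewrite muln_gt0 c0.
apply: (@le_trans _ _ (1 * (N%:R / (c * d)%:R) `^ 2^-1)).
  by rewrite ler_pM // ?mu_le1 // floor_err.
rewrite mul1r natrM invfM mulrA powRM ?invr_ge0 ?divr_ge0 // ler_wpM2l ?powR_ge0 //.
have E : d%:R^-1 = d%:R `^ (-1) :> R by rewrite powR_inv1.
by rewrite E -powRrM mulN1r.
Qed.

(** The density of the n with q | n and r | n + h. *)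
Definition kappa h q r : R := if (gcdn q r %| h)%N then (lcmn q r)%:R^-1 else 0.

Lemma kappaC h q r : kappa h q r = kappa h r q.
Proof. by rewrite /kappa gcdnC lcmnC. Qed.

Lemma kappa_ge0 h q r : 0 <= kappa h q r.
Proof. by rewrite /kappa; case: ifP. Qed.

Lemma kappa_le h q r : (0 < h)%N -> (0 < q)%N -> (0 < r)%N ->
  kappa h q r <= h%:R / (q%:R * r%:R).
Proof.
move=> h0 q0 r0; rewrite /kappa; case: ifP => gh; last by rewrite divr_ge0 ?mulr_ge0.
have l0 : (0 < lcmn q r)%N by rewrite lcmn_gt0 q0.
rewrite ler_pdivlMr ?mulr_gt0 ?ltr0n // mulrC ler_pdivrMr ?ltr0n // -!natrM ler_nat.
by rewrite -muln_lcm_gcd mulnC leq_mul2r dvdn_leq // orbT.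
Qed.

(** The conditions q | n and g | n amount to lcm(q, g) | n. When gcd(q, r) divides h, the quotient
    lcm(q, g)/g is coprime to r/g, so only coprimality of the cofactor of n to r/g remains. *)
Lemma count_dvd_gcd h q r N : (0 < h)%N -> (0 < q)%N -> (0 < r)%N ->
  let g := gcdn h r in
  \sum_(1 <= n < N.+1 | (q %| n)%N && (gcdn n r == g)) (1 : R) =
  if (gcdn q r %| h)%N
  then \sum_(1 <= n < (N %/ lcmn q g).+1) (coprime n (r %/ g))%:R else 0.
Proof.
move=> h0 q0 r0 g; have g0 : (0 < g)%N by rewrite gcdn_gt0 h0.
case: ifP => qrh; last first.
  apply: big1 => n /andP[qn /eqP gE]; exfalso; move/negP: qrh; apply.
  rewrite (dvdn_trans _ (dvdn_gcdl h r)) // -/g -gE dvdn_gcd dvdn_gcdr andbT.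
  exact: dvdn_trans (dvdn_gcdl _ _) qn.
have l0 : (0 < lcmn q g)%N by rewrite lcmn_gt0 q0.
have gl : (g %| lcmn q g)%N := dvdn_lcmr _ _.
have gr : (g %| r)%N := dvdn_gcdr _ _.
rewrite (eq_bigl (fun n => (lcmn q g %| n)%N && (gcdn n r == g))); last first.
  move=> n; rewrite dvdn_lcm; case: (q %| n)%N => //=.
  by case: eqP => [gE|]; rewrite ?andbF // -[in X in (X %| _)%N]gE dvdn_gcdl.
rewrite big_mkcondr /= sum_multiples //; apply: eq_bigr => n _.
suff -> : (gcdn (lcmn q g * n) r == g) = coprime n (r %/ g) by case: coprime.
have cop : coprime (lcmn q g %/ g) (r %/ g).
  have uE : (lcmn q g %/ g = q %/ gcdn q g)%N.
    apply/eqP; rewrite -(eqn_pmul2r g0) divnK // /lcmn.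
    by rewrite divn_mulAC ?dvdn_gcdl.
  rewrite uE /coprime; set e := gcdn _ _.
  have qg0 : (0 < gcdn q g)%N by rewrite gcdn_gt0 q0.
  have h1 : (gcdn q g * e %| q)%N.
    by rewrite -{2}(divnK (dvdn_gcdl q g)) mulnC dvdn_pmul2r // dvdn_gcdl.
  have h2 : (gcdn q g * e %| r)%N.
    rewrite -(divnK gr) mulnC dvdn_mul // ?dvdn_gcdr //.
  have h3 : (gcdn q g * e %| gcdn q g)%N.
    rewrite dvdn_gcd h1 /= (@dvdn_trans (gcdn q r)) // ?dvdn_gcd ?h1 //.
    by rewrite qrh dvdn_gcdr.
  by rewrite -dvdn1 -(@dvdn_pmul2l (gcdn q g)) // muln1.
have lE : (lcmn q g * n = (lcmn q g %/ g * n) * g)%N by rewrite mulnAC divnK.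
rewrite lE -[X in gcdn _ X](divnK gr) -muln_gcdl -[X in _ == X]mul1n eqn_pmul2r //.
by rewrite -/(coprime _ _) coprimeMl cop.
Qed.

Lemma count_dvd_gcd_err h q r N : (0 < h)%N -> (0 < q)%N -> (0 < r)%N ->
  `|\sum_(1 <= n < N.+1 | (q %| n)%N && (gcdn n r == gcdn h r)) (1 : R) -
    N%:R * (totient (r %/ gcdn h r))%:R * kappa h q r| <=
  (N%:R / q%:R) `^ (2^-1) * wt (2^-1) r.
Proof.
move=> h0 q0 r0; set g := gcdn h r; have g0 : (0 < g)%N by rewrite gcdn_gt0 h0.
rewrite count_dvd_gcd // /kappa -/g; case: ifP => qrh; last first.
  by rewrite mulr0 subrr normr0 mulr_ge0 ?powR_ge0 ?wt_ge0.
have gr : (g %| r)%N := dvdn_gcdr _ _.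
have R0 : (0 < r %/ g)%N := divn_dvd_gt0 r0 gr.
have l0 : (0 < lcmn q g)%N by rewrite lcmn_gt0 q0.
have E : N%:R / (lcmn q g)%:R * ((totient (r %/ g))%:R / (r %/ g)%:R) =
   N%:R * (totient (r %/ g))%:R * (lcmn q r)%:R^-1 :> R.
  (* This uses gcd(q, g) = gcd(q, r), which holds because gcd(q, r) divides h. *)
  have -> : (lcmn q r = lcmn q g * (r %/ g))%N.
    have gE : gcdn q g = gcdn q r.
      by rewrite /g gcdnCA; apply/gcdn_idPr.
    apply/eqP; rewrite -(@eqn_pmul2r (gcdn q r)) ?gcdn_gt0 ?q0 //.
    rewrite muln_lcm_gcd -gE mulnAC muln_lcm_gcd -mulnA [(g * _)%N]mulnC.
    by rewrite divnK.
  by rewrite natrM invfM; ring.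
rewrite -E; apply: le_trans (count_coprime_err _ R0 l0) _.
rewrite ler_pM ?powR_ge0 ?wt_ge0 //; last by rewrite wt_dvd // dvdn_div.
rewrite ge0_ler_powR ?nnegrE ?divr_ge0 ?invr_ge0 // ler_wpM2l //.
by rewrite lef_pV2 ?posrE ?ltr0n // ler_nat dvdn_leq // dvdn_lcml.
Qed.

(** * Logarithmic averages of divisor functions *)

Definition dksum_dvd j e Y : R := \sum_(1 <= q < Y.+1 | (e %| q)%N) dk j q / q%:R.

Lemma dvdn_gcd_div e b q : (0 < e)%N -> (e %| q * b)%N = (e %/ gcdn b e %| q)%N.
Proof.
move=> e0; have g0 : (0 < gcdn b e)%N by rewrite gcdn_gt0 e0 orbT.
have -> : (e %| q * b)%N = (e %/ gcdn b e * gcdn b e %| (q * (b %/ gcdn b e)) * gcdn b e)%N.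
  by rewrite -mulnA !divnK ?dvdn_gcdl ?dvdn_gcdr.
rewrite dvdn_pmul2r //.
rewrite Gauss_dvdl // /coprime -(@eqn_pmul2r (gcdn b e)) // muln_gcdl mul1n.
by rewrite !divnK ?dvdn_gcdl ?dvdn_gcdr // gcdnC.
Qed.

Lemma dksum_dvdS j e Y : (0 < e)%N ->
  dksum_dvd j.+1 e Y = \sum_(1 <= b < Y.+1) b%:R^-1 * dksum_dvd j (e %/ gcdn b e) (Y %/ b).
Proof.
move=> e0; rewrite /dksum_dvd big_mkcond /=.
rewrite (eq_bigr (fun n => dk j.+1 n * (if (e %| n)%N then n%:R^-1 else 0))); last first.
  by move=> n _; case: ifP; rewrite ?mulr0.
rewrite sum_dkS_rev; apply: eq_bigr => b _.
rewrite mulr_sumr [RHS]big_mkcond /=; apply: eq_bigr => q _.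
rewrite dvdn_gcd_div //; case: ifP => _; last by rewrite mulr0.
by rewrite natrM invfM; ring.
Qed.

Lemma dksum_dvd0 e Y : (0 < e)%N -> (0 < Y)%N -> dksum_dvd 0 e Y = (e == 1%N)%:R.
Proof.
move=> e0 Y0; rewrite /dksum_dvd big_mkcond big_ltn // dk0 dvdn1 eqxx divr1 big1_seq.
  by rewrite /= addr0; case: eqP.
move=> n; rewrite mem_index_iota dk0 => /andP[_ /andP[/gtn_eqF->]].
by rewrite mul0r; case: ifP.
Qed.

Lemma sum_inv_multiples d Y : (0 < d)%N ->
  \sum_(1 <= b < Y.+1 | (d %| b)%N) b%:R^-1 <= lg Y / d%:R :> R.
Proof.
move=> d0; rewrite sum_multiples //.
under eq_bigr do rewrite natrM invfM.
rewrite -mulr_sumr mulrC ler_wpM2r ?invr_ge0 //.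
by apply: le_trans (harm_le _) _; rewrite lg_homo // leq_div.
Qed.

Lemma powR_div_le (a : R) f e : 0 <= a -> (0 < e)%N -> (f %| e)%N ->
  (e %/ f)%:R `^ (- a) = f%:R `^ a * e%:R `^ (- a).
Proof.
move=> a0 e0 fe; have f0 := dvdn_gt0 e0 fe.
have ef0 := divn_dvd_gt0 e0 fe.
rewrite -{2}(divnK fe) natrM powRM // mulrCA powRN -powRD ?subrr ?powRr0 ?mulr1 //.
by rewrite pnatr_eq0 -lt0n f0 implybT.
Qed.

Lemma dk2_lg_small c (b : R) : 0 < b -> exists2 C : R, 0 <= C &
  forall n, (0 < n)%N -> dk 2 n * lg n ^+ c <= C * n%:R `^ b.
Proof.
move=> b0; have b2 : 0 < b / 2 by lra.
have [C1 C10 HC1] := dk2_small b2; have [C2 C20 HC2] := lg_pow c b2.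
exists (C1 * C2) => [|n n0]; first by rewrite mulr_ge0.
rewrite [in leRHS](_ : b = b / 2 + b / 2); last by lra.
rewrite powRD; last by rewrite pnatr_eq0 -lt0n n0 implybT.
by rewrite mulrACA ler_pM ?dk_ge0 ?exprn_ge0 ?lg_ge0 ?HC1 ?HC2.
Qed.

(** Induction on j, splitting off one factor b. The inner main term has the coefficient c(e/gcd(b,
    e)); Moebius inversion opens this gcd, and replacing Y by Y/d costs [lg d] and saves a power of
    [lg Y]. The exponent a' between a and 1 pays for the divisor counts and for [lg d]. The factor j
    in the error makes the case j = 0 exact, where [j.-1] is 0. *)
Lemma dksum_dvd_approx j (a : R) : 0 < a < 1 -> exists2 C : R, 0 <= C &
  exists c : nat -> R, forall e, (0 < e)%N ->
  `|c e| <= C * e%:R `^ (- a) /\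
  forall Y, (0 < Y)%N ->
    `|dksum_dvd j e Y - c e * dksum j Y| <= C * e%:R `^ (- a) * (j%:R * lg Y ^+ j.-1).
Proof.
elim: j a => [|j IH] a /andP[a0 a1].
  exists 1 => //; exists (fun e => (e == 1%N)%:R) => e e0; split.
    by case: eqP => [->|_]; rewrite ?normr1 ?powR1 ?mulr1 // normr0 mul1r powR_ge0.
  by move=> Y Y0; rewrite dksum_dvd0 // dksum0 // mulr1 subrr normr0 mul0r mulr0.
pose a' := (1 + a) / 2.
have aa' : a < a' < 1 by rewrite /a'; apply/andP; split; lra.
have /andP[a'a a'1] := aa'; have a'0 : 0 < a' by lra.
have [|C C0 [c Hc]] := IH a'; first by rewrite a'0.
have [C1 C10 HC1] := @dk2_lg_small 1 (1 - a') ltac:(lra).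
have [C3 C30 HC3] := @dk2_small (a' - a) ltac:(lra).
pose w e f := c (e %/ f)%N.
pose gam e := moebius_inv (w e).
have gamB e d : (0 < e)%N -> (d %| e)%N ->
    `|gam e d| <= C * e%:R `^ (- a') * (d%:R `^ a' * dk 2 d).
  move=> e0 de; have d0 := dvdn_gt0 e0 de.
  apply: le_trans (moebius_inv_le _ _) _.
  rewrite dk2 // !mulr_sumr big_seq [leRHS]big_seq; apply: ler_sum => f.
  rewrite -dvdn_divisors // mulr1 => fd; have f0 := dvdn_gt0 d0 fd.
  have fe := dvdn_trans fd de.
  have [+ _] := Hc _ (divn_dvd_gt0 e0 fe).
  move=> /le_trans; apply; rewrite powR_div_le ?(ltW a'0) //.
  rewrite -mulrA ler_wpM2l // mulrC ler_wpM2l ?powR_ge0 //.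
  by rewrite ge0_ler_powR ?nnegrE ?(ltW a'0) // ler_nat dvdn_leq.
have sumB e : (0 < e)%N -> \sum_(d <- divisors e) `|gam e d| / d%:R * lg d <=
    C * C1 * C3 * e%:R `^ (- a).
  move=> e0.
  apply: (@le_trans _ _ (\sum_(d <- divisors e) C * e%:R `^ (- a') * C1)).
    rewrite big_seq [leRHS]big_seq; apply: ler_sum => d.
    rewrite -dvdn_divisors // => de; have d0 := dvdn_gt0 e0 de.
    have d0' : (0 : R) < d%:R by rewrite ltr0n.
    apply: (@le_trans _ _ (C * e%:R `^ (- a') * (d%:R `^ a' * dk 2 d) / d%:R * lg d)).
      by rewrite ler_wpM2r ?lg_ge0 // ler_wpM2r ?invr_ge0 // gamB.
    rewrite -!mulrA ler_wpM2l // ler_wpM2l ?powR_ge0 //.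
    have := HC1 d d0; rewrite expr1.
    rewrite powRD; last by rewrite pnatr_eq0 -lt0n d0 implybT.
    rewrite powRr1 // powRN => h.
    rewrite (_ : _ * _ = d%:R `^ a' / d%:R * (dk 2 d * lg d)); last by rewrite mulrA; ring.
    apply: le_trans (ler_wpM2l _ h) _; first by rewrite divr_ge0 ?powR_ge0.
    have p0 : d%:R `^ a' != 0 by rewrite gt_eqF // powR_gt0.
    rewrite le_eqVlt; apply/orP; left; apply/eqP; field.
    by rewrite p0 gt_eqF.
  rewrite (eq_bigr (fun d => C * e%:R `^ (- a') * C1 * 1)) => [|d _]; last by rewrite mulr1.
  rewrite -mulr_sumr -dk2 //.
  rewrite (_ : C * C1 * C3 * _ = C * C1 * (C3 * e%:R `^ (- a))); last by ring.
  rewrite (_ : C * _ * C1 * _ = C * C1 * (e%:R `^ (- a') * dk 2 e)); last by ring.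
  rewrite ler_wpM2l ?mulr_ge0 //.
  have e0' : (0 : R) < e%:R by rewrite ltr0n.
  rewrite powRN mulrC ler_pdivrMr ?powR_gt0 //.
  apply: le_trans (HC3 e e0) _; rewrite -mulrA ler_wpM2l // -powRD.
    by rewrite (_ : - a + a' = a' - a) // addrC.
  by rewrite pnatr_eq0 -lt0n e0 implybT.
have K0 : 0 <= C * C1 * C3 by rewrite !mulr_ge0.
(* The new coefficient is the mean value of c(e/gcd(b, e)) over b. *)
pose c' e := \sum_(d <- divisors e) gam e d / d%:R.
exists (C * C1 * C3 + C * C3) => [|]; first by rewrite addr_ge0 // mulr_ge0.
exists c' => e e0.
have ea0 : 0 <= e%:R `^ (- a) by exact: powR_ge0.
split.
  apply: (@le_trans _ _ (C * C1 * C3 * e%:R `^ (- a))); last first.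
    by rewrite ler_wpM2r // lerDl mulr_ge0.
  apply: le_trans (sumB e e0); apply: le_trans (ler_norm_sum _ _ _) _.
  apply: ler_sum => d _; rewrite normrM normfV normr_nat ler_peMr ?lg_ge1 //.
move=> Y Y0.
have L0 : 0 <= lg Y ^+ j by rewrite exprn_ge0 ?lg_ge0.
pose M := \sum_(1 <= b < Y.+1) b%:R^-1 * (c (e %/ gcdn b e)%N * dksum j (Y %/ b)).
have ME : `|M - c' e * dksum j.+1 Y| <= C * C1 * C3 * e%:R `^ (- a) * lg Y ^+ j.
  have -> : M = \sum_(d <- divisors e) gam e d / d%:R * dksum j.+1 (Y %/ d).
    rewrite /M (eq_bigr (fun b => w e (gcdn b e) * (b%:R^-1 * dksum j (Y %/ b)))); last first.
      by move=> b _; rewrite mulrCA.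
    rewrite sum_gcd // big_seq [RHS]big_seq; apply: eq_bigr => d.
    rewrite -dvdn_divisors // => /(dvdn_gt0 e0) d0.
    rewrite sum_multiples // dksumS_rev -mulrA; congr (_ * _); rewrite mulr_sumr.
    by apply: eq_bigr => b _; rewrite natrM invfM divnMA mulrA.
  rewrite /c' mulr_suml -sumrB; apply: le_trans (ler_norm_sum _ _ _) _.
  apply: le_trans (ler_wpM2r L0 (sumB e e0)); rewrite mulr_suml.
  rewrite big_seq [leRHS]big_seq; apply: ler_sum => d.
  rewrite -dvdn_divisors // => /(dvdn_gt0 e0) d0.
  rewrite -mulrBr normrM normrM normfV normr_nat -[leRHS]mulrA.
  rewrite ler_wpM2l ?mulr_ge0 ?invr_ge0 // distrC ger0_norm ?dksum_diff //.
  rewrite subr_ge0 /dksum; apply: ler_sum_widen; rewrite ?leq_div // => n _.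
  by rewrite divr_ge0 ?dk_ge0.
have HE : `|dksum_dvd j.+1 e Y - M| <= C * C3 * e%:R `^ (- a) * (j%:R * lg Y ^+ j).
  rewrite dksum_dvdS // /M -sumrB; apply: le_trans (ler_norm_sum _ _ _) _.
  pose G b := C * e%:R `^ (- a') * (j%:R * lg Y ^+ j.-1) *
     \sum_(d <- divisors e) (if (d %| b)%N then d%:R `^ a' * b%:R^-1 else 0).
  apply: (@le_trans _ _ (\sum_(1 <= b < Y.+1) G b)).
    apply: ler_sum_nat => b /andP[b0 bY]; rewrite -mulrBr normrM normfV normr_nat.
    have g0 : (0 < gcdn b e)%N by rewrite gcdn_gt0 b0.
    have [_ +] := Hc _ (divn_dvd_gt0 e0 (dvdn_gcdr b e)).
    move=> /(_ (Y %/ b)%N) hb.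
    have Yb0 : (0 < Y %/ b)%N by rewrite divn_gt0.
    have bi0 : (0 : R) <= b%:R^-1 by rewrite invr_ge0.
    apply: le_trans (ler_wpM2l bi0 (hb Yb0)) _.
    rewrite powR_div_le ?(ltW a'0) ?dvdn_gcdr // /G.
    have lY : j%:R * lg (Y %/ b) ^+ j.-1 <= j%:R * lg Y ^+ j.-1.
      by rewrite ler_wpM2l // lerXn2r ?nnegrE ?lg_ge0 ?lg_homo ?leq_div.
    have W0 : 0 <= C * e%:R `^ (- a') by rewrite mulr_ge0 ?powR_ge0.
    have J0 : 0 <= j%:R * lg Y ^+ j.-1 by rewrite mulr_ge0 ?exprn_ge0 ?lg_ge0.
    apply: (@le_trans _ _ (C * e%:R `^ (- a') * (j%:R * lg Y ^+ j.-1) *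
       ((gcdn b e)%:R `^ a' * b%:R^-1))).
      rewrite (_ : b%:R^-1 * _ = C * e%:R `^ (- a') * (j%:R * lg (Y %/ b) ^+ j.-1) *
         ((gcdn b e)%:R `^ a' * b%:R^-1)); last by ring.
      by rewrite ler_wpM2r ?mulr_ge0 ?powR_ge0 // ler_wpM2l.
    rewrite ler_wpM2l ?mulr_ge0 ?powR_ge0 ?exprn_ge0 ?lg_ge0 //.
    rewrite (bigD1_seq (gcdn b e)) ?divisors_uniq -?dvdn_divisors ?dvdn_gcdr //=.
    rewrite dvdn_gcdl lerDl sumr_ge0 // => d _; case: ifP => // _.
  rewrite -mulr_sumr exchange_big /=.
  have S : \sum_(d <- divisors e) \sum_(1 <= b < Y.+1)
      (if (d %| b)%N then d%:R `^ a' * b%:R^-1 else 0) <= dk 2 e * lg Y.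
    rewrite dk2 // mulr_suml big_seq [leRHS]big_seq; apply: ler_sum => d.
    rewrite -dvdn_divisors // mul1r => /(dvdn_gt0 e0) d0.
    rewrite -big_mkcond -mulr_sumr.
    apply: le_trans (ler_wpM2l (powR_ge0 _ _) (sum_inv_multiples _ d0)) _.
    rewrite mulrCA ler_piMr ?lg_ge0 // ler_pdivrMr ?ltr0n // mul1r.
    by rewrite -[leRHS]powRr1 // ler_powR ?ler1n // ltW.
  have W0 : 0 <= C * e%:R `^ (- a') * (j%:R * lg Y ^+ j.-1).
    by rewrite !mulr_ge0 ?powR_ge0 ?exprn_ge0 ?lg_ge0.
  apply: le_trans (ler_wpM2l W0 S) _.
  case: (posnP j) => [->|j0]; first by rewrite !(mul0r, mulr0).
  have eE : e%:R `^ (- a') * dk 2 e <= C3 * e%:R `^ (- a).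
    have e0' : (0 : R) < e%:R by rewrite ltr0n.
    rewrite powRN mulrC ler_pdivrMr ?powR_gt0 //.
    apply: le_trans (HC3 e e0) _; rewrite -mulrA ler_wpM2l // -powRD.
      by rewrite (_ : - a + a' = a' - a) // addrC.
    by rewrite pnatr_eq0 -lt0n e0 implybT.
  have lE : lg Y ^+ j = lg Y * lg Y ^+ j.-1 by rewrite -exprS prednK.
  have P0 : 0 <= lg Y ^+ j.-1 by rewrite exprn_ge0 ?lg_ge0.
  rewrite lE; set P := lg Y ^+ j.-1 in P0 *.
  rewrite [leLHS](_ : _ = C * (j%:R * (lg Y * P)) * (e%:R `^ (- a') * dk 2 e)); last by ring.
  rewrite [leRHS](_ : _ = C * (j%:R * (lg Y * P)) * (C3 * e%:R `^ (- a))); last by ring.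
  by rewrite ler_wpM2l // !mulr_ge0 ?lg_ge0.
have -> : dksum_dvd j.+1 e Y - c' e * dksum j.+1 Y =
  (dksum_dvd j.+1 e Y - M) + (M - c' e * dksum j.+1 Y) by ring.
apply: le_trans (ler_normD _ _) _; apply: le_trans (lerD HE ME) _.
rewrite /= [leLHS](_ : _ = e%:R `^ (- a) * lg Y ^+ j * (C * C3 * j%:R + C * C1 * C3)); last by ring.
rewrite [leRHS](_ : _ = e%:R `^ (- a) * lg Y ^+ j * ((C * C1 * C3 + C * C3) * j.+1%:R)); last by ring.
rewrite ler_wpM2l ?mulr_ge0 // -natr1.
have : 0 <= C * C3 by rewrite mulr_ge0.
have : 0 <= (C * C1 * C3) * j%:R by rewrite mulr_ge0.
lra.
Qed.

Lemma ler_normB_exp j (x y L : R) : 0 <= x <= L -> 0 <= y <= L ->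
  `|x ^+ j - y ^+ j| <= j%:R * `|x - y| * L ^+ j.-1.
Proof.
move=> /andP[x0 xL] /andP[y0 yL]; have L0 : 0 <= L by exact: le_trans xL.
elim: j => [|j IH]; first by rewrite !expr0 subrr normr0 !mul0r.
have -> : x ^+ j.+1 - y ^+ j.+1 = x * (x ^+ j - y ^+ j) + (x - y) * y ^+ j.
  by rewrite !exprS; ring.
apply: le_trans (ler_normD _ _) _; rewrite !normrM ger0_norm // [`|y ^+ j|]ger0_norm ?exprn_ge0 //=.
have h1 : x * `|x ^+ j - y ^+ j| <= j%:R * `|x - y| * L ^+ j.
  apply: le_trans (ler_wpM2l x0 IH) _; case: j {IH} => [|j]; first by rewrite !mul0r mulr0.
  by rewrite mulrCA ler_wpM2l ?mulr_ge0 //= exprS ler_wpM2r ?exprn_ge0.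
have h2 : `|x - y| * y ^+ j <= `|x - y| * L ^+ j by rewrite ler_wpM2l // lerXn2r.
by rewrite -natr1 !mulrDl mul1r lerD.
Qed.

(* Comparison with the telescoping sum of ln(Y/b)^(j+1) - ln(Y/(b+1))^(j+1) replaces an integral. *)
Lemma sum_ln_pow j Y : (0 < Y)%N ->
  `|\sum_(1 <= b < Y.+1) ln (Y%:R / b%:R : R) ^+ j / b%:R
    - ln Y%:R ^+ j.+1 / j.+1%:R| <= lg Y ^+ j.
Proof.
move=> Y0; pose u b : R := ln (Y%:R / b%:R).
have Y0' : (0 : R) < Y%:R by rewrite ltr0n.
have uE b : (0 < b)%N -> u b = ln Y%:R - ln b%:R.
  by move=> b0; rewrite /u ln_div ?posrE ?ltr0n.
have u0 b : (0 < b <= Y)%N -> 0 <= u b.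
  move=> /andP[b0 bY]; rewrite /u ln_ge0 // ler_pdivlMr ?ltr0n // mul1r ler_nat //.
have u1 : u 1%N = ln Y%:R by rewrite /u divr1.
have uY : u Y = 0 by rewrite /u divff ?ln1 // gt_eqF.
have j0 : (0 : R) < j.+1%:R by rewrite ltr0n.
have step (x y : R) : 0 <= y <= x ->
    j.+1%:R * y ^+ j * (x - y) <= x ^+ j.+1 - y ^+ j.+1 <= j.+1%:R * x ^+ j * (x - y).
  move=> /andP[y0 yx]; have x0 := le_trans y0 yx.
  elim: (j) => [|k]; first by rewrite !expr0 !expr1 !mulr1 !mul1r lexx.
  have -> : x ^+ k.+2 - y ^+ k.+2 = x * (x ^+ k.+1 - y ^+ k.+1) + y ^+ k.+1 * (x - y).
    by rewrite !(exprS _ k.+1); ring.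
  move=> /andP[h1 h2]; have d0 : 0 <= x - y by rewrite subr_ge0.
  have yk : y ^+ k.+1 <= x ^+ k.+1 by rewrite lerXn2r.
  have k0 : (0 : R) <= k.+1%:R by [].
  apply/andP; split.
    have h3 : k.+1%:R * y ^+ k.+1 * (x - y) <= x * (x ^+ k.+1 - y ^+ k.+1).
      apply: le_trans (ler_wpM2l x0 h1); rewrite mulrA ler_wpM2r // mulrCA ler_wpM2l //.
      by rewrite exprS ler_wpM2r ?exprn_ge0.
    rewrite -(@natr1 R k.+1); move: h3; set z := y ^+ _; lra.
  have h3 : x * (x ^+ k.+1 - y ^+ k.+1) <= k.+1%:R * x ^+ k.+1 * (x - y).
    apply: le_trans (ler_wpM2l x0 h2) _; rewrite mulrA ler_wpM2r // mulrCA ler_wpM2l //.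
    by rewrite exprS.
  have h4 := ler_wpM2r d0 yk.
  rewrite -(@natr1 R k.+1); move: h3 h4; set z := x ^+ _; set t := y ^+ _; lra.
have tel (F : nat -> R) : \sum_(1 <= b < Y) (F b - F b.+1) = F 1%N - F Y.
  by rewrite -[RHS]opprB -(telescope_sumr F Y0) -sumrN; apply: eq_bigr => b _; rewrite opprB.
set S := \sum_(1 <= b < Y.+1) _.
have bnd b : (0 < b < Y)%N -> (b.+1%:R : R)^-1 <= u b - u b.+1 <= (b%:R : R)^-1.
  move=> /andP[b0 _]; rewrite !uE //.
  have -> : ln Y%:R - ln b%:R - (ln Y%:R - ln b.+1%:R) = ln b.+1%:R - ln b%:R :> R by ring.
  exact: lnS_bounds.
have uS b : (0 < b < Y)%N -> 0 <= u b.+1 <= u b.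
  move=> /andP[b0 bY]; rewrite u0 // /= -subr_ge0.
  by have /andP[+ _] := bnd b (introT andP (conj b0 bY)); apply: le_trans; rewrite invr_ge0.
have telE : \sum_(1 <= b < Y) (u b ^+ j.+1 - u b.+1 ^+ j.+1) = ln Y%:R ^+ j.+1.
  by rewrite (tel (fun b => u b ^+ j.+1)) u1 uY expr0n subr0.
have lo : ln Y%:R ^+ j.+1 <= j.+1%:R * S.
  rewrite -telE.
  rewrite /S big_nat_recr //= mulrDr -[leLHS]addr0 lerD //; last first.
    by rewrite !mulr_ge0 ?exprn_ge0 ?invr_ge0 // -/(u Y) uY.
  rewrite mulr_sumr; apply: ler_sum_nat => b bY.
  have /andP[_ h] := step _ _ (uS b bY); apply: le_trans h _.
  rewrite -mulrA ler_wpM2l // -/(u b) ler_wpM2l //.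
    by rewrite exprn_ge0 // u0 //; case/andP: bY => -> /ltnW.
  by have /andP[] := bnd b bY.
have hi : j.+1%:R * S <= ln Y%:R ^+ j.+1 + j.+1%:R * ln Y%:R ^+ j.
  rewrite /S big_nat_recl // mulrDr -/(u 1%N) u1 divr1 addrC lerD2r.
  rewrite -telE.
  rewrite mulr_sumr; apply: ler_sum_nat => b bY.
  have /andP[h _] := step _ _ (uS b bY); apply: le_trans h.
  rewrite -mulrA ler_wpM2l // -/(u b.+1) ler_wpM2l //.
    by rewrite exprn_ge0 //; case/andP: (uS b bY).
  by have /andP[] := bnd b bY.
have lY0 : 0 <= ln Y%:R :> R by rewrite ln_ge0 // ler1n.
have e1 : ln Y%:R ^+ j.+1 / j.+1%:R <= S by rewrite ler_pdivrMr // mulrC.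
have e2 : S <= ln Y%:R ^+ j.+1 / j.+1%:R + ln Y%:R ^+ j.
  rewrite -(ler_pM2l j0); apply: le_trans hi _.
  by rewrite mulrDr mulrCA divff ?gt_eqF // mulr1.
rewrite ger0_norm ?subr_ge0 // lerBlDl (le_trans e2) // lerD2l.
by rewrite lerXn2r ?nnegrE ?lg_ge0 // /lg lerDr.
Qed.

Lemma ln_divn_diff Y b : (0 < b <= Y)%N ->
  `|ln (Y %/ b)%:R - ln (Y%:R / b%:R)| <= 1 :> R.
Proof.
move=> /andP[b0 bY]; have b0' : (0 : R) < b%:R by rewrite ltr0n.
have q0 : (0 < Y %/ b)%N by rewrite divn_gt0.
have q0' : (0 : R) < (Y %/ b)%:R by rewrite ltr0n.
have z0 : (0 : R) < Y%:R / b%:R by rewrite divr_gt0 // ltr0n (leq_trans b0).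
have h1 : (Y %/ b)%:R <= Y%:R / b%:R :> R by rewrite ler_pdivlMr // -natrM ler_nat leq_divM.
have h2 : Y%:R / b%:R <= 2 * (Y %/ b)%:R :> R.
  rewrite ler_pdivrMr // -!natrM ler_nat; have := ltn_ceil Y b0.
  by move=> /ltnW /leq_trans; apply; rewrite leq_mul2r -addn1 mul2n -addnn leq_add2l q0 orbT.
rewrite distrC ger0_norm ?subr_ge0 ?ler_ln ?posrE // lerBlDr.
apply: (@le_trans _ _ (ln (2 * (Y %/ b)%:R))); first by rewrite ler_ln ?posrE // mulr_gt0.
rewrite lnM ?posrE // lerD2r.
by have := @lg_le 2 isT; rewrite /lg; lra.
Qed.

(** Splitting off a factor b leaves sums of log^j of the integer part of Y/b, over b. Dropping the
    integer part changes a logarithm by at most 1, and [sum_ln_pow] evaluates the result; these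
    steps account for the increments of the constant. *)
Lemma dksum_approx j : exists2 C : R, 0 <= C & forall Y, (0 < Y)%N ->
  `|dksum j Y - ln Y%:R ^+ j / (j`!)%:R| <= C * (j%:R * lg Y ^+ j.-1).
Proof.
elim: j => [|j [C C0 IH]].
  by exists 0 => // Y Y0; rewrite dksum0 // expr0 divr1 subrr normr0 mul0r.
exists (C + 2) => [|Y Y0]; first by rewrite addr_ge0.
pose f : R := (j`!)%:R; have f1 : 1 <= f by rewrite ler1n fact_gt0.
have f0 : 0 < f by exact: lt_le_trans f1.
have L0 k : 0 <= lg Y ^+ k by rewrite exprn_ge0 ?lg_ge0.
have L1 := @lg_ge1 Y.
pose S1 := \sum_(1 <= b < Y.+1) (ln (Y%:R / b%:R : R) ^+ j / b%:R).
have h1 : `|S1 / f - ln Y%:R ^+ j.+1 / (j.+1`!)%:R| <= lg Y ^+ j.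
  have -> : ln Y%:R ^+ j.+1 / (j.+1`!)%:R = (ln Y%:R ^+ j.+1 / j.+1%:R) / f :> R.
    by rewrite factS natrM invfM mulrA.
  rewrite -mulrBl normrM normfV (ger0_norm (ltW f0)).
  rewrite ler_pdivrMr // (le_trans (sum_ln_pow j Y0)) //.
  by rewrite ler_peMr.
have h2 : `|dksum j.+1 Y - S1 / f| <= (C + 1) * (j%:R * lg Y ^+ j).
  rewrite dksumS_rev /S1 mulr_suml -sumrB; apply: le_trans (ler_norm_sum _ _ _) _.
  case: (posnP j) => [j0|j0].
    rewrite j0 mul0r mulr0 big1_seq // => b; rewrite mem_index_iota ltnS => /andP[_ /andP[b0 bY]].
    rewrite dksum0 ?divn_gt0 // expr0 /f j0 fact0 divr1 mulr1 div1r subrr normr0 //.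
  have lE : lg Y ^+ j = lg Y ^+ j.-1 * lg Y by rewrite -exprSr prednK.
  rewrite lE !mulrA -[leRHS]mulrA.
  apply: (@le_trans _ _ (((C + 1) * j%:R) * (lg Y ^+ j.-1 * harm Y))); last first.
    by rewrite ler_wpM2l ?mulr_ge0 ?addr_ge0 // ler_wpM2l ?harm_le.
  rewrite mulrA /harm mulr_sumr; apply: ler_sum_nat => b /andP[b0 bY].
  have Yb0 : (0 < Y %/ b)%N by rewrite divn_gt0.
  have b0' : (0 : R) < b%:R by rewrite ltr0n.
  have -> : b%:R^-1 * dksum j (Y %/ b) - ln (Y%:R / b%:R) ^+ j / b%:R / f =
    b%:R^-1 * ((dksum j (Y %/ b) - ln (Y %/ b)%:R ^+ j / f) +
      (ln (Y %/ b)%:R ^+ j - ln (Y%:R / b%:R) ^+ j) / f) by ring.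
  rewrite normrM normfV normr_nat mulrC ler_wpM2r ?invr_ge0 //.
  apply: le_trans (ler_normD _ _) _; rewrite -[leRHS]mulrA [leRHS]mulrDl mul1r lerD //.
    apply: le_trans (IH _ Yb0) _; rewrite ler_wpM2l // ler_wpM2l //.
    by rewrite lerXn2r ?nnegrE ?lg_ge0 // lg_homo // leq_div.
  rewrite normrM normfV (ger0_norm (ltW f0)) ler_pdivrMr //.
  have hx : (0 : R) <= ln (Y %/ b)%:R <= lg Y.
    rewrite ln_ge0 ?ler1n //=; apply: (@le_trans _ _ (lg (Y %/ b))).
      by rewrite /lg lerDr.
    by rewrite lg_homo // leq_div.
  have hy : (0 : R) <= ln (Y%:R / b%:R) <= lg Y.
    rewrite ln_ge0 ?ler_pdivlMr ?mul1r ?ler_nat //=; apply: (@le_trans _ _ (ln Y%:R)).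
      rewrite ler_ln ?posrE ?divr_gt0 ?ltr0n // ler_pdivrMr // ler_peMr // ler1n //.
    by rewrite /lg lerDr.
  apply: le_trans (ler_normB_exp j hx hy) _.
  apply: (@le_trans _ _ (j%:R * 1 * lg Y ^+ j.-1)).
    by rewrite ler_wpM2r // ler_wpM2l // ln_divn_diff // b0.
  by rewrite mulr1 ler_peMr // mulr_ge0.
have -> : dksum j.+1 Y - ln Y%:R ^+ j.+1 / (j.+1`!)%:R =
  (dksum j.+1 Y - S1 / f) + (S1 / f - ln Y%:R ^+ j.+1 / (j.+1`!)%:R) by ring.
apply: le_trans (ler_normD _ _) _; apply: le_trans (lerD h2 h1) _.
rewrite /= -natr1; set P := lg Y ^+ j; have P0 : 0 <= P by exact: L0.
have : 0 <= j%:R * P by rewrite mulr_ge0.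
have : 0 <= C * P by rewrite mulr_ge0.
lra.
Qed.

(** The leading terms are log^j N / j! and log^j (N^B) / j!, whose ratio is B^(-j); the integer part
    in [Num.truncn] shifts the logarithm by at most 1. *)
Lemma dksum_scale j (B : R) : 0 < B <= 1 -> exists2 C : R, 0 <= C & forall N, (0 < N)%N ->
  `|dksum j N - B ^- j * dksum j (Num.truncn (N%:R `^ B))| <= C * (j%:R * lg N ^+ j.-1).
Proof.
move=> /andP[B0 B1]; have [C C0 HC] := dksum_approx j.
have Bj0 : 0 < B ^- j by rewrite invr_gt0 exprn_gt0.
exists (C + B ^- j * C + B^-1) => [|N N0].
  have Bj0' := ltW Bj0; have BV0 : 0 <= B^-1 by rewrite invr_ge0 ltW.
  by rewrite !addr_ge0 // mulr_ge0.
have B01 : 0 <= B <= 1 by rewrite ltW.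
have [] := truncn_powR B01 N0; set Y := Num.truncn _ => /andP[Y0 YN] Y1 Y2.
have N0' : (0 : R) < N%:R by rewrite ltr0n.
have Y0' : (0 : R) < Y%:R by rewrite ltr0n.
have nb : 0 < N%:R `^ B by rewrite powR_gt0.
have l1 : ln Y%:R <= B * ln N%:R by rewrite -ln_powR ler_ln ?posrE.
have l2 : B * ln N%:R <= 1 + ln Y%:R :> R.
  rewrite -ln_powR; apply: (@le_trans _ _ (ln (2 * Y%:R))).
    by rewrite ler_ln ?posrE // mulr_gt0.
  rewrite lnM ?posrE // lerD2r.
  by have := @lg_le 2 isT; rewrite /lg; lra.
have lY : 0 <= ln Y%:R :> R by rewrite ln_ge0 // ler1n.
have lN : 0 <= ln N%:R :> R by rewrite ln_ge0 // ler1n.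
have lNN : ln N%:R <= lg N by rewrite /lg lerDr.
pose z := ln Y%:R / B.
have zN : z <= ln N%:R by rewrite ler_pdivrMr // mulrC.
have z0 : 0 <= z by rewrite divr_ge0 // ltW.
have hz : `|ln N%:R ^+ j - z ^+ j| <= B^-1 * (j%:R * lg N ^+ j.-1).
  have hN : (0 : R) <= ln N%:R <= lg N by apply/andP; split.
  have hzz : (0 : R) <= z <= lg N by rewrite z0 (le_trans zN).
  apply: le_trans (ler_normB_exp j hN hzz) _.
  rewrite [B^-1 * _]mulrCA mulrA ler_wpM2r ?exprn_ge0 ?lg_ge0 // ler_wpM2l //.
  rewrite ger0_norm ?subr_ge0 // lerBlDr.
  have : ln N%:R <= (1 + ln Y%:R) / B by rewrite ler_pdivlMr // mulrC.
  by rewrite mulrDl mul1r.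
pose f : R := (j`!)%:R; have f1 : 1 <= f by rewrite ler1n fact_gt0.
have f0 : 0 < f by exact: lt_le_trans f1.
have P0 : 0 <= j%:R * lg N ^+ j.-1 by rewrite mulr_ge0 ?exprn_ge0 ?lg_ge0.
have zE : z ^+ j = B ^- j * ln Y%:R ^+ j by rewrite /z exprMn exprVn mulrC.
have -> : dksum j N - B ^- j * dksum j Y =
  (dksum j N - ln N%:R ^+ j / f) - B ^- j * (dksum j Y - ln Y%:R ^+ j / f) +
  (ln N%:R ^+ j - z ^+ j) / f by rewrite zE; ring.
rewrite [leRHS]mulrDl; apply: le_trans (ler_normD _ _) _; apply: lerD; last first.
  rewrite normrM normfV (ger0_norm (ltW f0)) ler_pdivrMr //.
  apply: le_trans hz _; by rewrite ler_peMr // mulr_ge0 // invr_ge0; exact: ltW.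
rewrite [leRHS]mulrDl; apply: le_trans (ler_normB _ _) _; apply: lerD; first exact: HC.
rewrite normrM (ger0_norm (ltW Bj0)) -mulrA ler_wpM2l ?(ltW Bj0) //.
apply: le_trans (HC Y Y0) _; rewrite ler_wpM2l // ler_wpM2l //.
by rewrite lerXn2r ?nnegrE ?lg_ge0 ?lg_homo.
Qed.

Definition dksum_kappa h j r Y : R := \sum_(1 <= q < Y.+1) dk j q * kappa h q r.

(** Up to 1/(q r), [kappa h q r] is a function of gcd(q, r), so Moebius inversion leads to sums over
    multiples of e | r. Their coefficients [c e] are the same for the lengths N and N^B, so their
    values are irrelevant and only the scaling of [dksum] enters. *)
Lemma dksum_kappa_scale h j (B a : R) : (0 < h)%N -> 0 < B <= 1 -> 0 < a < 1 ->
  exists2 C : R, 0 <= C & forall r N, (0 < r)%N -> (0 < N)%N ->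
  `|dksum_kappa h j r N - B ^- j * dksum_kappa h j r (Num.truncn (N%:R `^ B))| <=
  C * (j%:R * lg N ^+ j.-1) * (wt a r / r%:R).
Proof.
move=> h0 B01 a01; have [C C0 [c Hc]] := dksum_dvd_approx j a01.
have [C' C'0 HC'] := dksum_scale j B01.
have /andP[B0 B1] := B01.
have B01' : 0 <= B <= 1 by rewrite ltW.
have Bj0 : 0 <= B ^- j by rewrite invr_ge0 exprn_ge0 // ltW.
(* Here [kappa h q r] = w(gcd(q, r))/(q r). As w is supported on divisors of h, its Moebius
   transform is bounded by the divisor sum [s] of h. *)
pose w n : R := if (n %| h)%N then n%:R else 0.
pose s : R := \sum_(f <- divisors h) f%:R.
have s0 : 0 <= s by exact: sumr_ge0.
have ws n : (0 < n)%N -> `|moebius_inv w n| <= s.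
  move=> n0; apply: le_trans (moebius_inv_le _ _) _.
  rewrite (eq_bigr (fun f => if (f %| h)%N then f%:R else 0)); last first.
    by move=> f _; rewrite /w; case: ifP => _; rewrite ?normr0 ?normr_nat.
  rewrite -big_mkcond -big_filter; apply: ler_sum_sub => //.
    by rewrite filter_uniq ?divisors_uniq.
  by move=> f; rewrite mem_filter -!dvdn_divisors // => /andP[].
have KE r Y : (0 < r)%N -> dksum_kappa h j r Y = r%:R^-1 * \sum_(e <- divisors r) moebius_inv w e * dksum_dvd j e Y.
  move=> r0; rewrite -sum_gcd // /dksum_kappa mulr_sumr; apply: eq_big_nat => q /andP[q0 _].
  rewrite /kappa /w; case: ifP => qrh; last by rewrite mul0r !mulr0.
  have g0 : ((gcdn q r)%:R : R) != 0 by rewrite pnatr_eq0 -lt0n gcdn_gt0 q0.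
  have l0 : ((lcmn q r)%:R : R) != 0 by rewrite pnatr_eq0 -lt0n lcmn_gt0 q0.
  have q0' : (q%:R : R) != 0 by rewrite pnatr_eq0 -lt0n.
  have r0' : (r%:R : R) != 0 by rewrite pnatr_eq0 -lt0n.
  have E : (lcmn q r)%:R * (gcdn q r)%:R = q%:R * r%:R :> R by rewrite -!natrM muln_lcm_gcd.
  have -> : (gcdn q r)%:R = q%:R * r%:R / (lcmn q r)%:R :> R by rewrite -E mulrAC divff // mul1r.
  by field; rewrite l0 q0' r0'.
exists (s * C + s * (C * C') + B ^- j * (s * C)) => [|r N r0 N0].
  by rewrite !addr_ge0 ?mulr_ge0.
have [] := truncn_powR B01' N0; set Y := Num.truncn _ => /andP[Y0 YN] Y1 Y2.
have P0 : 0 <= j%:R * lg N ^+ j.-1 by rewrite mulr_ge0 ?exprn_ge0 ?lg_ge0.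
set P := j%:R * _ in P0 *.
rewrite !KE // mulrCA -mulrBr normrM normfV normr_nat.
rewrite [leRHS]mulrC -mulrA [wt _ _ * _]mulrC -mulrA ler_wpM2l ?invr_ge0 //.
rewrite [leRHS](_ : _ = (s * C + s * (C * C') + B ^- j * (s * C)) * P * wt a r); last by ring.
rewrite mulr_sumr -sumrB /wt mulr_sumr; apply: le_trans (ler_norm_sum _ _ _) _.
rewrite big_seq [leRHS]big_seq; apply: ler_sum => e.
rewrite -dvdn_divisors // => er; have e0 := dvdn_gt0 r0 er.
have [ce He] := Hc e e0; have := HC' N N0; rewrite -/Y -/P => HD.
have ea : 0 <= e%:R `^ (- a) by exact: powR_ge0.
have HN : `|dksum_dvd j e N - c e * dksum j N| <= C * e%:R `^ (- a) * P by exact: He.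
have HY : `|dksum_dvd j e Y - c e * dksum j Y| <= C * e%:R `^ (- a) * P.
  apply: le_trans (He Y Y0) _; rewrite ler_wpM2l ?mulr_ge0 // ler_wpM2l //.
  by rewrite lerXn2r ?nnegrE ?lg_ge0 ?lg_homo.
have -> : moebius_inv w e * dksum_dvd j e N - B ^- j * (moebius_inv w e * dksum_dvd j e Y) =
  moebius_inv w e * ((dksum_dvd j e N - c e * dksum j N) + c e * (dksum j N - B ^- j * dksum j Y)
    - B ^- j * (dksum_dvd j e Y - c e * dksum j Y)) by ring.
rewrite normrM.
rewrite (_ : _ * P * _ = s * (C * e%:R `^ (- a) * P + C * e%:R `^ (- a) * (C' * P) + B ^- j * (C * e%:R `^ (- a) * P))); last by ring.
rewrite ler_pM ?ws //; apply: le_trans (ler_normB _ _) _; apply: lerD.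
  apply: le_trans (ler_normD _ _) _; rewrite lerD // normrM ler_pM //.
by rewrite normrM (ger0_norm Bj0) ler_wpM2l.
Qed.

(** * Distribution in residue classes *)

Implicit Types (f : nat -> R).

Definition sum_class f N q a : R := \sum_(1 <= n < N.+1 | (n == a %[mod q])%N) f n.
Definition sum_gcdn f N q g : R := \sum_(1 <= n < N.+1 | gcdn n q == g) f n.
(** The reciprocal of the number of classes b modulo q with gcd(b, q) = gcd(a, q). Thus [disc]
    measures the deviation of one class from the average over these classes. *)
Definition om q a : R := ((totient (q %/ gcdn a q))%:R)^-1.
Definition disc f N q a : R := sum_class f N q a - om q a * sum_gcdn f N q (gcdn a q).

Lemma om_ge0 q a : 0 <= om q a. Proof. by rewrite invr_ge0. Qed.

Lemma gcdn_eqmod a b q : (a == b %[mod q])%N -> gcdn a q = gcdn b q.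
Proof. by move=> /eqP ab; rewrite -gcdn_modl ab gcdn_modl. Qed.

Lemma count_gcdn g q : (0 < q)%N -> (g %| q)%N ->
  \sum_(0 <= b < q | gcdn b q == g) (1 : R) = (totient (q %/ g))%:R.
Proof.
move=> q0 gq; have g0 := dvdn_gt0 q0 gq.
rewrite totient_count ?divn_dvd_gt0 //.
transitivity (\sum_(1 <= b < q.+1 | gcdn b q == g) (1 : R)).
  rewrite big_mkcond [RHS]big_mkcond big_nat_recr //= big_ltn //=.
  by rewrite gcd0n gcdnn addrC.
transitivity (\sum_(1 <= b < q.+1 | (g %| b)%N) (gcdn b q == g)%:R : R).
  rewrite big_mkcond [RHS]big_mkcond; apply: eq_bigr => b _.
  by case: eqP => [<-|_]; rewrite ?dvdn_gcdl //; case: ifP.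
rewrite sum_multiples //; apply: eq_bigr => b _; congr (nat_of_bool _)%:R.
rewrite -{1}(divnK gq) mulnC -muln_gcdl /coprime.
by rewrite -[X in _ == X]mul1n eqn_pmul2r.
Qed.

Lemma sum_gcdn_class f N q g : (0 < q)%N ->
  sum_gcdn f N q g = \sum_(0 <= b < q | gcdn b q == g) sum_class f N q b.
Proof.
move=> q0; rewrite /sum_class.
under eq_bigr do rewrite big_mkcond.
rewrite exchange_big /= /sum_gcdn big_mkcond /=; apply: eq_bigr => n _.
rewrite big_mkcond /= (bigD1_seq (n %% q)%N) ?iota_uniq ?mem_index_iota ?ltn_mod //=.
rewrite gcdn_modl modn_mod eqxx big1_seq ?addr0 // => b /andP[bn].
rewrite mem_index_iota => /andP[_ bq]; case: ifP => // _; case: ifP => // /eqP nb.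
by move: bn; rewrite nb modn_small // eqxx.
Qed.

Lemma disc_of_classes f N q a (c : R) : (0 < q)%N ->
  (forall b, gcdn b q = gcdn a q ->
     `|sum_class f N q a - sum_class f N q b| <= c) ->
  `|disc f N q a| <= c.
Proof.
move=> q0 H; have gq : (gcdn a q %| q)%N := dvdn_gcdr _ _.
have f0 : (0 : R) < (totient (q %/ gcdn a q))%:R.
  by rewrite ltr0n totient_gt0 divn_dvd_gt0.
rewrite /disc /om sum_gcdn_class //; set F := (totient _)%:R in f0 *.
have FE : F = \sum_(0 <= b < q | gcdn b q == gcdn a q) (1 : R) by rewrite count_gcdn.
have -> : sum_class f N q a = F^-1 * (F * sum_class f N q a) by rewrite mulKf // gt_eqF.
rewrite {2}FE mulr_suml -mulrBr -sumrB normrM ger0_norm ?invr_ge0 ?(ltW f0) //.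
rewrite ler_pdivrMl //; rewrite {}FE mulr_suml.
apply: le_trans (ler_norm_sum _ _ _) _; apply: ler_sum => b /eqP gb.
by rewrite !mul1r; exact: H.
Qed.

(** The class 0, which the exponent of distribution excludes, is the only class with gcd q and so
    equals its own average. *)
Lemma disc_dvd f N q a : (0 < q)%N -> (q %| a)%N -> disc f N q a = 0.
Proof.
move=> q0 qa; rewrite /disc /om.
have -> : gcdn a q = q by apply/gcdn_idPr.
rewrite divnn q0 /= invr1 mul1r; apply/eqP; rewrite subr_eq0; apply/eqP.
apply: eq_bigl => n; rewrite (eqP (_ : (a %% q == 0)%N)) //.
rewrite -/(dvdn q n); by apply/idP/eqP => /gcdn_idPr.
Qed.

Lemma sum_class_disc f N q a : sum_class f N q a = disc f N q a + om q a * sum_gcdn f N q (gcdn a q).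
Proof. by rewrite subrK. Qed.

(* The residue depends only on gcd(a, q), so it cancels between two classes
   with the same gcd. *)
Lemma disc_at g k (theta eta : R) : exponent_of_distribution_at g k theta ->
  eta < theta -> exists2 C : R, 0 <= C & exists2 delta : R, 0 < delta < 1 &
  forall N q a, (0 < N)%N -> (0 < q)%N -> q%:R <= N%:R `^ eta -> gcdn a q = g ->
  `|disc (dk k) N q a| <= C * (N%:R `^ (1 - delta) * om q a).
Proof.
move=> [_ Hth] et; have e0 : 0 < theta - eta by rewrite subr_gt0.
have [delta d0 [C HC]] := Hth _ e0.
exists (2 * `|C|) => //.
(* Capping the saving keeps 1 - delta positive, so the power of N is monotone in N. *)
exists (Num.min delta 2^-1).
  rewrite lt_min d0 invr_gt0 ltr0n /= gt_min; apply/orP; right.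
  by rewrite invf_lt1 // ltr1n.
move=> N q a N0 q0 qN ga; have N1 : (1 : R) <= N%:R by rewrite ler1n.
have P0 : 0 <= N%:R `^ (1 - Num.min delta 2^-1) * om q a.
  by rewrite mulr_ge0 ?powR_ge0 ?om_ge0.
case: (boolP (q %| a)%N) => qa; first by rewrite disc_dvd // normr0 !mulr_ge0 ?powR_ge0 ?om_ge0.
have H b : gcdn b q = g -> ~~ (q %| b)%N -> exists z : R[i],
    z = (totient (q %/ g))%:R^-1 * residue (fun s => cpow N%:R s / s *
                    continuation_at1 (divisor_dirichlet k q g) s) 1 /\
    `|(sum_class (dk k) N q b)%:C%C - z| <= (`|C| * (N%:R `^ (1 - Num.min delta 2^-1) * om q a))%:C%C.
  move=> gb qb; eexists; split; first by [].
  have := HC N%:R N1 q q0; rewrite subKr => /(_ qN b qb gb).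
  have -> : ((\sum_(1 <= n < (Num.truncn (N%:R : R)).+1 | (n == b %[mod q])%N)
          divisor_fun k n)%:R : R[i]) = (sum_class (dk k) N q b)%:C%C.
    rewrite /sum_class /dk -natr_sum; rewrite rmorph_nat natrK //.
  move=> /le_trans; apply; rewrite lecR.
  rewrite /om ga; apply: le_trans (_ : `|C| * (N%:R `^ (1 - delta) / (totient (q %/ g))%:R) <= _).
    by rewrite ler_wpM2r ?ler_norm // divr_ge0 ?powR_ge0.
  by rewrite ler_wpM2l // ler_wpM2r ?invr_ge0 // ler_powR // lerD2l lerN2 ge_min lexx.
apply: disc_of_classes => // b gb.
have qb : ~~ (q %| b)%N.
  apply: contra qa => /gcdn_idPr; rewrite gb => gE; by apply/gcdn_idPr.
have [z [zE hz]] := H a ga qa; have [z' [zE' hz']] := H b (etrans gb ga) qb.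
rewrite -mulrA; apply: normB_le_complex hz _; by rewrite zE -zE'.
Qed.

(** The constants supplied for a gcd g depend on g. Only g <= h occurs, and induction on h combines
    these finitely many bounds. *)
Lemma disc_exponent h k (theta eta : R) : (0 < h)%N -> exponent_of_distribution k theta ->
  eta < theta -> exists2 C : R, 0 <= C & exists2 delta : R, 0 < delta < 1 &
  forall N q a, (0 < N)%N -> (0 < q)%N -> q%:R <= N%:R `^ eta -> (gcdn a q %| h)%N ->
  `|disc (dk k) N q a| <= C * (N%:R `^ (1 - delta) * om q a).
Proof.
move=> h0 Hth et.
suff : exists2 C : R, 0 <= C & exists2 delta : R, 0 < delta < 1 &
  forall N q a, (0 < N)%N -> (0 < q)%N -> q%:R <= N%:R `^ eta -> (gcdn a q <= h)%N ->
  `|disc (dk k) N q a| <= C * (N%:R `^ (1 - delta) * om q a).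
  move=> [C C0 [d d0 H]]; exists C => //; exists d => // N q a N0 q0 qN gh.
  by apply: H => //; exact: dvdn_leq.
elim: h {h0} => [|h [C C0 [d /andP[d0 d1] IH]]].
  exists 0 => //; exists 2^-1 => [|N q a _ q0 _].
    by rewrite invr_gt0 ltr0n /= invf_lt1 // ltr1n.
  by rewrite leqn0 eqn0Ngt gcdn_gt0 q0 orbT.
have [C' C'0 [d' /andP[d'0 d'1] H']] := disc_at (Hth h.+1 isT) et.
exists (C + C'); first exact: addr_ge0.
exists (Num.min d d') => [|N q a N0 q0 qN gh].
  by rewrite lt_min d0 d'0 gt_min d1.
have N1 : (1 : R) <= N%:R by rewrite ler1n.
have hd : N%:R `^ (1 - d) * om q a <= N%:R `^ (1 - Num.min d d') * om q a.
  by rewrite ler_wpM2r ?om_ge0 // ler_powR // lerD2l lerN2 ge_min lexx.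
have hd' : N%:R `^ (1 - d') * om q a <= N%:R `^ (1 - Num.min d d') * om q a.
  by rewrite ler_wpM2r ?om_ge0 // ler_powR // lerD2l lerN2 ge_min lexx orbT.
have P0 : 0 <= N%:R `^ (1 - Num.min d d') * om q a.
  by rewrite mulr_ge0 ?powR_ge0 ?om_ge0.
move: gh; rewrite leq_eqVlt ltnS mulrDl => /orP[/eqP gh|gh].
  apply: le_trans (H' N q a N0 q0 qN gh) _; apply: le_trans (ler_wpM2l C'0 hd') _.
  by rewrite lerDr mulr_ge0.
apply: le_trans (IH N q a N0 q0 qN gh) _; apply: le_trans (ler_wpM2l C0 hd) _.
by rewrite lerDl mulr_ge0.
Qed.

Lemma sum_gcdn_le f N q g : (forall n, 0 <= f n) ->
  sum_gcdn f N q g <= \sum_(1 <= n < N.+1) f n.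
Proof.
by move=> f0; rewrite /sum_gcdn big_mkcond; apply: ler_sum => n _; case: ifP.
Qed.

(** For nonnegative f the class sum and the average both grow with the length, so the longer sums
    bound the shorter ones. *)
Lemma normr_disc_le f M N q a : (M <= N)%N -> (forall n, 0 <= f n) ->
  `|disc f M q a| <= `|disc f N q a| + 2 * (om q a * \sum_(1 <= n < N.+1) f n).
Proof.
move=> MN f0; set S := \sum_(_ <= _ < _) _.
have w := om_ge0 q a.
have c0 : 0 <= sum_class f M q a by exact: sumr_ge0.
have g0 L : 0 <= sum_gcdn f L q (gcdn a q) by exact: sumr_ge0.
have cN : sum_class f M q a <= sum_class f N q a.
  rewrite /sum_class big_mkcond [leRHS]big_mkcond; apply: ler_sum_widen => // n _.
  by case: ifP.
have gM : sum_gcdn f M q (gcdn a q) <= S.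
  by apply: le_trans (sum_gcdn_le _ _ _ f0) _; apply: ler_sum_widen.
have gN := sum_gcdn_le N q (gcdn a q) f0; rewrite -/S in gN.
have h1 := ler_wpM2l w gM; have h2 := ler_wpM2l w gN.
have h3 := mulr_ge0 w (g0 M).
have h4 : sum_class f N q a <= `|disc f N q a| + om q a * S.
  by rewrite sum_class_disc lerD // ler_norm.
have h5 : 0 <= `|disc f N q a| by [].
rewrite {1}/disc ler_norml; apply/andP; split; lra.
Qed.

(* For q beyond the level, monotonicity in N reduces to N = q^(1/eta') with eta < eta' < theta. *)
Lemma disc_exponent_all h k (theta eta : R) : (0 < h)%N -> exponent_of_distribution k theta ->
  0 < eta < theta -> exists2 C : R, 0 <= C & exists2 delta : R, 0 < delta < 1 &
  forall N q a, (0 < q)%N -> (gcdn a q %| h)%N ->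
  `|disc (dk k) N q a| <= C * ((N%:R `^ (1 - delta) + q%:R `^ eta^-1) * om q a).
Proof.
move=> h0 Hth /andP[e0 et]; pose e1 := (eta + theta) / 2.
have e11 : eta < e1 < theta by rewrite /e1; apply/andP; split; lra.
have /andP[ee1 e1t] := e11; have e10 : 0 < e1 by lra.
have [C C0 [d /andP[d0 d1] H]] := disc_exponent h0 Hth e1t.
(* Chosen so that M^(1+r) has order q^(1/eta) when M has order q^(1/e1); the surplus M^r absorbs the
   logarithms of the trivial bound. *)
pose r := e1 / eta - 1.
have r0 : 0 < r by rewrite subr_gt0 ltr_pdivlMr // mul1r.
have [C1 C10 H1] := lg_pow k r0.
exists (C + (C + 2 * C1) * 2 `^ (1 + r)).
  by rewrite addr_ge0 // mulr_ge0 ?powR_ge0 // addr_ge0 // mulr_ge0.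
exists d => [|N q a q0 gh]; first by rewrite d0.
have W0 : 0 <= om q a by exact: om_ge0.
have X0 : 0 <= N%:R `^ (1 - d) by exact: powR_ge0.
have Y0 : 0 <= q%:R `^ eta^-1 by exact: powR_ge0.
have c20 : 0 <= 2 `^ (1 + r) :> R by exact: powR_ge0.
have [qN|qN] := leP (q%:R) (N%:R `^ e1).
  have N0 : (0 < N)%N.
    rewrite lt0n; apply/eqP => N0; move: qN; rewrite N0 powR0 ?gt_eqF //.
    by rewrite lern0 => /eqP qe; rewrite qe in q0.
  apply: le_trans (H N q a N0 q0 qN gh) _.
  rewrite [leRHS]mulrDl -[leLHS]addr0 lerD //; last first.
    by rewrite !mulr_ge0 ?addr_ge0 ?mulr_ge0.
  by rewrite ler_wpM2l // ler_wpM2r // lerDl.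
pose M := tau e1 q.
have NM : (N <= M)%N by rewrite ltnW // ltnNge -tauP // -ltNge.
have M0 : (0 < M)%N by exact: tau_gt0.
have M1 : (1 : R) <= M%:R by rewrite ler1n.
have hM := H M q a M0 q0 (le_tau_powR q e10) gh.
apply: le_trans (normr_disc_le q a NM (dk_ge0 k)) _.
have B1 : `|disc (dk k) M q a| <= C * (M%:R `^ (1 + r) * om q a).
  by apply: le_trans hM _; rewrite ler_wpM2l // ler_wpM2r // ler_powR //; lra.
have B2 : \sum_(1 <= n < M.+1) dk k n <= C1 * M%:R `^ (1 + r).
  apply: le_trans (sum_dk_le _ _) _.
  rewrite powRD ?pnatr_eq0 -?lt0n ?M0 ?implybT // powRr1 // mulrCA ler_wpM2l //.
  exact: H1.
have B3 : M%:R `^ (1 + r) <= 2 `^ (1 + r) * q%:R `^ eta^-1.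
  apply: (@le_trans _ _ ((2 * q%:R `^ e1^-1) `^ (1 + r))).
    rewrite ge0_ler_powR ?nnegrE ?mulr_ge0 ?powR_ge0 ?tau_le //; lra.
  rewrite powRM ?powR_ge0 // -powRrM (_ : e1^-1 * (1 + r) = eta^-1) //.
  by rewrite /r addrC subrK mulrA mulVf ?mul1r // gt_eqF.
have B4 := ler_wpM2l W0 B2.
apply: le_trans (lerD B1 (ler_wpM2l (ler0n _ 2) B4)) _.
rewrite (_ : C * _ + _ = (C + 2 * C1) * om q a * M%:R `^ (1 + r)); last by ring.
have K0 : 0 <= (C + 2 * C1) * om q a by rewrite mulr_ge0 // addr_ge0 // mulr_ge0.
apply: le_trans (ler_wpM2l K0 B3) _.
rewrite [leRHS](_ : _ = (C + 2 * C1) * om q a * (2 `^ (1 + r) * q%:R `^ eta^-1) +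
  (C * ((N%:R `^ (1 - d) + q%:R `^ eta^-1) * om q a) +
   (C + 2 * C1) * 2 `^ (1 + r) * N%:R `^ (1 - d) * om q a)); last by ring.
rewrite lerDl addr_ge0 // ?mulr_ge0 ?addr_ge0 // mulr_ge0 //.
Qed.

(** If e = gcd(u, q) divides h, then r u = h (mod q) is a single class a modulo q/e, and the gcd
    condition and the totient transform accordingly. Hence [disc_mul] is an ordinary discrepancy to
    the modulus q/e; otherwise both of its sums are empty. *)
Lemma linear_class u q h : (0 < u)%N -> (0 < q)%N -> (0 < h)%N ->
  (forall r, gcdn (r * u) q <> gcdn h q) \/
  exists a, let q' := (q %/ gcdn u q)%N in
  [/\ (0 < q' <= q)%N, (gcdn a q' %| h)%N, (q %/ gcdn h q = q' %/ gcdn a q')%N,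
      (forall r, (r * u == h %[mod q])%N = (r == a %[mod q'])%N) &
      (forall r, (gcdn (r * u) q == gcdn h q) = (gcdn r q' == gcdn a q'))].
Proof.
move=> u0 q0 h0; set e := gcdn u q; have e0 : (0 < e)%N by rewrite gcdn_gt0 u0.
have eu : (e %| u)%N := dvdn_gcdl _ _; have eq : (e %| q)%N := dvdn_gcdr _ _.
case: (boolP (e %| h)%N) => [eh|neh]; last first.
  left => r rE; move/negP: neh; apply.
  rewrite (dvdn_trans _ (dvdn_gcdl h q)) // -rE dvdn_gcd eq andbT.
  exact: dvdn_mull.
right; pose q' := (q %/ e)%N.
have [b _ qb] := Bezoutr u q0; rewrite -/e in qb.
(* Bezout gives b u = -e (mod q), and [q.-1] represents -1. *)
pose a := (q.-1 * b * (h %/ e))%N.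
have aE : (a * u = h %[mod q])%N.
  have E : (a * u + (e + b * u) * (h %/ e) = q * (b * u * (h %/ e)) + h)%N.
    rewrite -{3}(divnK eh) /a -{2}(prednK q0); ring.
  have := congr1 (modn^~ q) E.
  case/dvdnP: qb => c ->; rewrite mulnAC addnC !modnMDl.
  by rewrite [(q * _)%N]mulnC modnMDl.
have cop : coprime (u %/ e) q'.
  by rewrite /coprime -(eqn_pmul2r e0) muln_gcdl !divnK // mul1n.
have gE r : gcdn (r * u) q = (gcdn r q' * e)%N.
  have -> : (r * u = r * (u %/ e) * e)%N by rewrite -mulnA divnK.
  rewrite -[X in gcdn _ X](divnK eq) -muln_gcdl gcdnC; congr (_ * _)%N.
  by rewrite Gauss_gcdl // 1?coprime_sym // gcdnC.
have ghE : gcdn h q = (gcdn a q' * e)%N.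
  by rewrite -gE; apply: gcdn_eqmod; apply/eqP.
exists a => q''; split.
- by rewrite divn_dvd_gt0 // leq_div.
- by apply: dvdn_trans (dvdn_gcdl h q); rewrite ghE dvdn_mulr.
- by rewrite ghE -{1}(divnK eq) divnMr.
- move=> r; rewrite -aE; have [ra|/ltnW ra] := leqP r a.
    rewrite [LHS]eq_sym [RHS]eq_sym !eqn_mod_dvd ?leq_mul2r ?ra ?orbT //.
    by rewrite -mulnBl dvdn_gcd_div // gcdnC.
  rewrite !eqn_mod_dvd ?leq_mul2r ?ra ?orbT //.
  by rewrite -mulnBl dvdn_gcd_div // gcdnC.
- by move=> r; rewrite gE ghE eqn_pmul2r.
Qed.

Definition disc_mul u h f Z q : R :=
  \sum_(1 <= r < Z.+1 | (r * u == h %[mod q])%N) f r -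
  om q h * \sum_(1 <= r < Z.+1 | gcdn (r * u) q == gcdn h q) f r.

Lemma disc_mul_exponent h k (theta eta : R) : (0 < h)%N -> exponent_of_distribution k theta ->
  0 < eta < theta -> exists2 C : R, 0 <= C & exists2 delta : R, 0 < delta < 1 &
  forall u Z q, (0 < u)%N -> (0 < q)%N ->
  `|disc_mul u h (dk k) Z q| <= C * ((Z%:R `^ (1 - delta) + q%:R `^ eta^-1) * om q h).
Proof.
move=> h0 Hth et; have [C C0 [d d0 H]] := disc_exponent_all h0 Hth et.
exists C => //; exists d => // u Z q u0 q0.
have [nE|[a]] := linear_class u0 q0 h0.
  rewrite /disc_mul !big1 ?mulr0 ?subrr ?normr0.
  - by rewrite !mulr_ge0 ?addr_ge0 ?powR_ge0 ?om_ge0.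
  - by move=> r /eqP /nE.
  - by move=> r /gcdn_eqmod /nE.
move=> /= []; set q' := (q %/ _)%N => /andP[q'0 q'q] aq' omE E1 E2.
have -> : disc_mul u h (dk k) Z q = disc (dk k) Z q' a.
  rewrite /disc_mul /disc /om omE; congr (_ - _ * _); exact: eq_bigl.
apply: le_trans (H Z q' a q'0 aq') _; rewrite /om omE.
rewrite ler_wpM2l // ler_wpM2r ?invr_ge0 // lerD2l.
have /andP[e0 _] := et.
by rewrite ge0_ler_powR ?nnegrE ?invr_ge0 ?(ltW e0) // ler_nat.
Qed.

(** * Truncated divisor functions in residue classes *)

(** The index is that of the summand: this is d_(k+1)(n, A). For fixed q the truncation is a lower
    bound on n. *)
Definition dkA (A : R) k n : R := \sum_(q <- divisors n | (tau A q <= n)%N) dk k q.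

Lemma dkA_ge0 (A : R) k n : 0 <= dkA A k n.
Proof. by apply: sumr_ge0 => q _; exact: dk_ge0. Qed.

Lemma dkA_le (A : R) k n : (0 < n)%N -> dkA A k n <= dk k.+1 n.
Proof.
move=> n0; rewrite dkS // /dkA big_mkcond; apply: ler_sum => q _; case: ifP => // _.
Qed.

Lemma discB f g N q a : disc (fun n => f n - g n) N q a = disc f N q a - disc g N q a.
Proof. by rewrite /disc /sum_class /sum_gcdn !sumrB; ring. Qed.

Lemma eq_disc f g N q a : (forall n, (0 < n)%N -> f n = g n) -> disc f N q a = disc g N q a.
Proof.
move=> fg; rewrite /disc /sum_class /sum_gcdn.
by congr (_ - _ * _); rewrite big_nat_cond [RHS]big_nat_cond; apply: eq_bigr => n /andP[/andP[n0 _] _]; exact: fg.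
Qed.

(* By [sigmaP], for fixed u the condition r > (r u)^A is r > sigma A u. *)
Definition sigma (A : R) u : nat := Num.truncn (u%:R `^ (A / (1 - A)) : R).

Lemma sigmaP (A : R) u r : 0 < A < 1 -> (0 < u)%N ->
  (r * u < tau A r)%N = (sigma A u < r)%N.
Proof.
move=> /andP[A0 A1] u0; have A1' : 0 < 1 - A by rewrite subr_gt0.
have u0' : (0 : R) < u%:R by rewrite ltr0n.
rewrite ltnNge -tauP // -ltNge /sigma truncn_lt_nat ?powR_ge0 //.
case: (posnP r) => [->|r0]; first by rewrite mul0n powR0 ?gt_eqF // ltxx ltNge powR_ge0.
have r0' : (0 : R) < r%:R by rewrite ltr0n.
have rE : r%:R = r%:R `^ A * r%:R `^ (1 - A) :> R.
  rewrite -powRD; last by rewrite pnatr_eq0 -lt0n r0 implybT.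
  by rewrite addrC subrK powRr1.
rewrite natrM powRM // {2}rE ltr_pM2l ?powR_gt0 // ltNge.
have A10 : 0 < (1 - A)^-1 by rewrite invr_gt0.
have := le_powR_root A10 (ltW r0') (powR_ge0 u%:R A); rewrite invrK => <-.
by rewrite -powRrM -ltNge.
Qed.

(** Some r > u^(A/(1-A)) satisfies r u <= M, whence u^(1/(1-A)) <= M. *)
Lemma sigma_bound (A : R) u M : 0 < A < 1 -> (0 < u)%N ->
  (sigma A u < M %/ u)%N -> u%:R <= M%:R `^ (1 - A).
Proof.
move=> /andP[A0 A1] u0; have A1' : 0 < 1 - A by rewrite subr_gt0.
have u0' : (0 : R) < u%:R by rewrite ltr0n.
rewrite /sigma truncn_lt_nat ?powR_ge0 // => H.
have h : (M %/ u)%:R * u%:R <= M%:R :> R by rewrite -natrM ler_nat leq_divM.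
rewrite le_powR_root // (le_trans _ h) //.
apply: (@le_trans _ _ (u%:R `^ (A / (1 - A)) * u%:R)); last by rewrite ler_wpM2r // ltW.
rewrite -{3}[u%:R]powRr1 // -powRD; last by rewrite pnatr_eq0 -lt0n u0 implybT.
have -> : A / (1 - A) + 1 = (1 - A)^-1.
  rewrite -[X in _ + X](divff (lt0r_neq0 A1')) -mulrDl.
  by rewrite addrC subrK mul1r.
by [].
Qed.

Lemma gtn_min_left s z r : (minn s z < r)%N -> (r < z.+1)%N -> (s < r)%N.
Proof. lia. Qed.

Lemma leq_min_left s z r : (r < (minn s z).+1)%N -> (r <= s)%N.
Proof. lia. Qed.

(* The complementary divisor u = m/r of a divisor r > m^A is at most m^(1-A),
   so for fixed u the sum runs over r up to M/u, which is at least M^A. *)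
Lemma disc_dkA h k (A B thk thk1 : R) : (0 < h)%N ->
  exponent_of_distribution k.+1 thk -> exponent_of_distribution k thk1 ->
  0 < A < 1 -> 0 < B -> B < thk -> B < A * thk1 ->
  exists2 C : R, 0 <= C & exists2 rho : R, 0 < rho < 1 &
  forall M M0 q, (0 < M <= M0)%N -> (0 < q)%N -> q%:R <= M0%:R `^ B ->
  `|disc (dkA A k) M q h| <= C * (M0%:R `^ (1 - rho) * om q h).
Proof.
move=> h0 Hk Hk1 A01 B0 Bk Bk1; have /andP[A0 A1] := A01.
(* Midpoints leave room on both sides: B/e1 < 1 and B/e2 < A keep q^(1/e1) and M0^(1-A) q^(1/e2) a
   power of M0 below M0. *)
pose e1 := (B + thk) / 2; pose e2 := (B / A + thk1) / 2.
have BA : B / A < thk1 by rewrite ltr_pdivrMr // mulrC.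
have e1b : 0 < e1 < thk by rewrite /e1; apply/andP; split; lra.
have BA0 : 0 < B / A by rewrite divr_gt0.
have e2b : 0 < e2 < thk1 by rewrite /e2; apply/andP; split; lra.
have Be1 : B / e1 < 1.
  by have /andP[p _] := e1b; rewrite ltr_pdivrMr // mul1r /e1; lra.
have Be2 : B / e2 < A.
  have /andP[p _] := e2b; rewrite ltr_pdivrMr // mulrC -ltr_pdivrMr // /e2; lra.
have [C1 C10 [d1 /andP[d10 d11] H1]] := disc_exponent_all h0 Hk e1b.
have [C2 C20 [d2 /andP[d20 d21] H2]] := disc_mul_exponent h0 Hk1 e2b.
have Ad0 : 0 < A * d2 / 2 by rewrite divr_gt0 // mulr_gt0.
have [C3 C30 H3] := lg_pow 1 Ad0.
(* The first two savings come from d_(k+1) in full: from the length and from q^(1/e1). The last two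
   come from the sum over u: from the lengths M0/u, where half of A d2 pays for a logarithm, and
   from q^(1/e2). *)
pose rho := Num.min (Num.min d1 (1 - B / e1)) (Num.min (A * d2 / 2) (A - B / e2)).
have rho0 : 0 < rho < 1.
  rewrite /rho !lt_min !gt_min d10 d11 Ad0 !subr_gt0 Be1 Be2 //.
have /andP[r0 r1] := rho0.
have [rd1 rB1 rAd rB2] : [/\ rho <= d1, rho <= 1 - B / e1, rho <= A * d2 / 2 & rho <= A - B / e2].
  by rewrite /rho; split; rewrite !ge_min lexx ?orbT.
exists (C1 * 2 + 2 * C2 * (C3 + 1)).
  by rewrite addr_ge0 ?mulr_ge0 // addr_ge0.
exists rho => // M M0 q /andP[M1 MM] q0 qM.
have M00 : (0 < M0)%N by exact: leq_trans MM.
have M01 : (1 : R) <= M0%:R by rewrite ler1n.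
have W0 := om_ge0 q h.
have X0 : 0 <= M0%:R `^ (1 - rho) by exact: powR_ge0.
have qpow e : 0 < e -> q%:R `^ e^-1 <= M0%:R `^ (B / e).
  move=> e0; rewrite powRrM ge0_ler_powR ?nnegrE ?powR_ge0 ?invr_ge0 //.
  exact: ltW.
have /andP[e10 _] := e1b; have /andP[e20 _] := e2b.
pose E m := \sum_(r <- divisors m | (m < tau A r)%N) dk k r.
have -> : disc (dkA A k) M q h = disc (dk k.+1) M q h - disc E M q h.
  rewrite -discB; apply: eq_disc => n n0; rewrite /E dkS // (bigID (fun r => tau A r <= n)%N) /=.
  by rewrite [X in _ + X - _](eq_bigl _ _ (fun r => esym (ltnNge _ _))) addrK.
(* The range sigma < r <= M/u is a difference of two initial segments; [minn] makes them coincide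
   when the range is empty, which is the case for u > M^(1-A). *)
pose T u := disc_mul u h (dk k) (M %/ u) q - disc_mul u h (dk k) (minn (sigma A u) (M %/ u)) q.
have EP (P : pred nat) : \sum_(1 <= m < M.+1 | P m) E m =
    \sum_(1 <= u < M.+1) (\sum_(1 <= r < (M %/ u).+1 | P (r * u)%N) dk k r -
      \sum_(1 <= r < (minn (sigma A u) (M %/ u)).+1 | P (r * u)%N) dk k r).
  rewrite big_mkcond /=.
  rewrite (eq_bigr (fun m => \sum_(r <- divisors m) if P m && (m < tau A r)%N then dk k r else 0)); last first.
    move=> m _; case: (P m) => /=; last by rewrite big1.
    by rewrite /E big_mkcond.
  rewrite sum_sum_divisors_rev; apply: eq_big_nat => u /andP[u0 _].
  set m := minn _ _; have mM : (m <= M %/ u)%N by rewrite geq_minr.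
  rewrite [X in _ = X - _](big_cat_nat (n := m.+1)) //= [X in _ = X - _]addrC addrK.
  rewrite (big_cat_nat (n := m.+1)) //= big1_seq ?add0r.
    rewrite [RHS]big_mkcond; apply: eq_big_nat => r /andP[mr rM].
    rewrite sigmaP //; have -> : (sigma A u < r)%N by exact: gtn_min_left mr rM.
    by rewrite andbT.
  move=> r /andP[_]; rewrite mem_index_iota sigmaP // => /andP[_ rm].
  have -> : (sigma A u < r)%N = false by apply/negbTE; rewrite -leqNgt; exact: leq_min_left rm.
  by rewrite andbF.
have disE : disc E M q h = \sum_(1 <= u < M.+1) T u.
  rewrite /disc /sum_class /sum_gcdn !EP mulr_sumr -sumrB; apply: eq_bigr => u _.
  by rewrite /T /disc_mul; ring.
pose Y := Num.truncn (M%:R `^ (1 - A)).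
have A1' : 0 <= 1 - A <= 1 by rewrite subr_ge0 ltW // gerBl ltW.
have [/andP[Y0 YM] Y1 _] := truncn_powR A1' M1; rewrite -/Y in Y0 YM Y1.
have Tbound : \sum_(1 <= u < M.+1) `|T u| <=
    2 * C2 * (M0%:R `^ (1 - A * d2) * lg M0 + M0%:R `^ (1 - A) * q%:R `^ e2^-1) * om q h.
  rewrite (big_cat_nat (n := Y.+1)) //= [X in _ + X]big1_seq ?addr0; last first.
    move=> u; rewrite mem_index_iota => /andP[_ /andP[Yu uM]].
    have u0 : (0 < u)%N by exact: leq_ltn_trans Yu.
    rewrite /T (minn_idPr _) ?subrr ?normr0 // leqNgt; apply/negP => /(sigma_bound A01 u0).
    by rewrite leNgt (lt_le_trans (truncnS_gt _)) // ler_nat.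
  apply: (@le_trans _ _ (\sum_(1 <= u < Y.+1) (2 * C2 * om q h *
     (M0%:R `^ (1 - A * d2) * u%:R^-1 + q%:R `^ e2^-1)))); last first.
    rewrite -mulr_sumr big_split /= -mulr_sumr [leRHS]mulrAC ler_wpM2l ?mulr_ge0 //.
    apply: lerD.
      rewrite ler_wpM2l ?powR_ge0 // (le_trans (harm_le Y)) // lg_homo //.
      exact: leq_trans YM MM.
    rewrite sumr_const_nat subSS subn0 -[leLHS]mulr_natl ler_wpM2r ?powR_ge0 //.
    apply: le_trans Y1 _; rewrite ge0_ler_powR ?nnegrE ?ler_nat //; by case/andP: A1'.
  apply: ler_sum_nat => u /andP[u0 uY].
  have u0' : (0 : R) < u%:R by rewrite ltr0n.
  have uM : u%:R <= M0%:R `^ (1 - A) :> R.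
    apply: (@le_trans _ _ Y%:R); first by rewrite ler_nat.
    apply: le_trans Y1 _; rewrite ge0_ler_powR ?nnegrE ?ler_nat //; by case/andP: A1'.
  (* Since M0/u >= M0^A, the saving (M0/u)^(-d2) is at least as good as M0^(-A d2), and 1/u is left
     for a harmonic sum. *)
  have Z (z : nat) : (z <= M %/ u)%N -> z%:R `^ (1 - d2) <= M0%:R `^ (1 - A * d2) * u%:R^-1.
    move=> zM; have MU : M0%:R `^ A <= M0%:R / u%:R.
      rewrite ler_pdivlMr // -[leRHS]powRr1 //.
      apply: le_trans (ler_wpM2l (powR_ge0 _ _) uM) _.
      rewrite -powRD; last by rewrite pnatr_eq0 -lt0n M00 implybT.
      by rewrite addrC subrK.
    have d2' : 0 <= 1 - d2 by rewrite subr_ge0 ltW.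
    apply: (@le_trans _ _ ((M0%:R / u%:R) `^ (1 - d2))).
      rewrite ge0_ler_powR ?nnegrE ?divr_ge0 // ler_pdivlMr // -natrM ler_nat.
      by rewrite (leq_trans _ MM) // (leq_trans _ (leq_divM M u)) // leq_mul2r zM orbT.
    have mu0 : (0 : R) < M0%:R / u%:R by rewrite divr_gt0 // ltr0n.
    rewrite powRD; last by rewrite (gt_eqF mu0) implybT.
    rewrite powRr1 ?(ltW mu0) // [leRHS](_ : _ = M0%:R / u%:R * (M0%:R `^ A) `^ (- d2)).
      rewrite ler_wpM2l ?(ltW mu0) // !powRN lef_pV2 ?posrE ?powR_gt0 ?ltr0n //.
      by rewrite ge0_ler_powR ?nnegrE ?powR_ge0 ?(ltW mu0) ?(ltW d20).
    rewrite -powRrM mulrN powRD; last by rewrite pnatr_eq0 -lt0n M00 implybT.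
    by rewrite powRr1 // mulrAC.
  rewrite /T; apply: le_trans (ler_normB _ _) _.
  have hz z : (z <= M %/ u)%N -> `|disc_mul u h (dk k) z q| <=
     C2 * om q h * (M0%:R `^ (1 - A * d2) * u%:R^-1 + q%:R `^ e2^-1).
    move=> zM; apply: le_trans (H2 u z q u0 q0) _.
    by rewrite [leRHS]mulrAC -mulrA ler_wpM2l // ler_wpM2r // lerD2r Z.
  apply: le_trans (lerD (hz _ (leqnn _)) (hz _ (geq_minr _ _))) _.
  rewrite le_eqVlt; apply/orP; left; apply/eqP; ring.
apply: le_trans (ler_normB _ _) _.
have h1 : `|disc (dk k.+1) M q h| <= C1 * 2 * (M0%:R `^ (1 - rho) * om q h).
  apply: le_trans (H1 M q h q0 (dvdn_gcdl _ _)) _.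
  rewrite -mulrA ler_wpM2l // mulrA ler_wpM2r // mulrDl mul1r lerD //.
    apply: (@le_trans _ _ (M0%:R `^ (1 - d1))).
      by rewrite ge0_ler_powR ?nnegrE ?ler_nat // subr_ge0 ltW.
    by rewrite ler_powR // lerD2l lerN2.
  apply: le_trans (qpow _ e10) _; rewrite ler_powR //; lra.
have h2 : `|disc E M q h| <= 2 * C2 * (C3 + 1) * (M0%:R `^ (1 - rho) * om q h).
  rewrite disE; apply: le_trans (ler_norm_sum _ _ _) _; apply: le_trans Tbound _.
  rewrite -!mulrA ler_wpM2l // ler_wpM2l // mulrA ler_wpM2r // mulrDl mul1r lerD //.
    apply: (@le_trans _ _ (M0%:R `^ (1 - A * d2) * (C3 * M0%:R `^ (A * d2 / 2)))).
      by rewrite ler_wpM2l ?powR_ge0 // -[lg M0]expr1 H3.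
    rewrite mulrCA ler_wpM2l // -powRD; last by rewrite pnatr_eq0 -lt0n M00 implybT.
    by rewrite ler_powR //; lra.
  apply: le_trans (ler_wpM2l (powR_ge0 _ _) (qpow _ e20)) _.
  rewrite -powRD; last by rewrite pnatr_eq0 -lt0n M00 implybT.
  by rewrite ler_powR //; lra.
by rewrite mulrDl lerD.
Qed.

(** * The two shifted sums *)

Lemma om_wt h : (0 < h)%N -> exists2 C : R, 0 <= C &
  forall r, (0 < r)%N -> om r h <= C * (wt 4^-1 r / r%:R).
Proof.
move=> h0; have [C C0 H] := totientV_wt h; exists C => // r r0.
by apply: H => //; rewrite ?dvdn_gcdr // dvdn_leq // dvdn_gcdl.
Qed.

(** Both weights are at most [wt 4^-1], whose square is dominated by [wt 8^-1]. *)
Lemma om_mul_wt h : (0 < h)%N -> exists2 C : R, 0 <= C &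
  forall r, (0 < r)%N -> om r h * wt 2^-1 r <= C * (wt 8^-1 r / r%:R).
Proof.
move=> h0; have [C C0 H] := om_wt h0.
have [C1 C10 H1] := @wt_sqr 4^-1 8^-1 ltac:(lra) ltac:(lra).
exists (C * C1) => [|r r0]; first exact: mulr_ge0.
apply: le_trans (ler_pM (om_ge0 _ _) (wt_ge0 _ _) (H r r0) (@wt_anti 4^-1 2^-1 r ltac:(lra) r0)) _.
rewrite [leLHS](_ : _ = C * (wt 4^-1 r ^+ 2 / r%:R)); last by ring.
rewrite -[leRHS]mulrA ler_wpM2l // mulrA ler_wpM2r ?invr_ge0 //; exact: H1.
Qed.

Lemma sum_om h i : (0 < h)%N -> exists2 C : R, 0 <= C &
  forall N, \sum_(1 <= r < N.+1) dk i r * om r h <= C * lg N ^+ i.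
Proof.
move=> h0; have [C C0 H] := om_wt h0.
have [C1 C10 H1] := @sum_dk_wt_div i 4^-1 ltac:(lra).
exists (C * C1) => [|N]; first exact: mulr_ge0.
rewrite -mulrA; apply: le_trans (ler_wpM2l C0 (H1 N)); rewrite mulr_sumr.
apply: ler_sum_nat => r /andP[r0 _].
by rewrite -mulrA mulrCA ler_wpM2l ?dk_ge0 ?H.
Qed.

Lemma sum_om_wt h i : (0 < h)%N -> exists2 C : R, 0 <= C &
  forall N, \sum_(1 <= r < N.+1) dk i r * (om r h * wt 2^-1 r) <= C * lg N ^+ i.
Proof.
move=> h0; have [C C0 H] := om_mul_wt h0.
have [C1 C10 H1] := @sum_dk_wt_div i 8^-1 ltac:(lra).
exists (C * C1) => [|N]; first exact: mulr_ge0.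
rewrite -mulrA; apply: le_trans (ler_wpM2l C0 (H1 N)); rewrite mulr_sumr.
apply: ler_sum_nat => r /andP[r0 _].
by rewrite -[in leRHS]mulrA [leRHS]mulrCA ler_wpM2l ?dk_ge0 ?H.
Qed.

Lemma sum_om_tau h i (A : R) : (0 < h)%N -> 0 < A <= 1 -> exists2 C : R, 0 <= C &
  forall M, (0 < M)%N ->
  lg M * \sum_(1 <= r < M.+1 | (tau A r <= M)%N) dk i r * om r h * (tau A r)%:R
  <= C * (M%:R * lg M ^+ i).
Proof.
move=> h0 A01; have [C C0 H] := om_wt h0.
have [C1 C10 H1] := @sum_tau i A 4^-1 A01 ltac:(lra).
exists (C * C1) => [|M M0]; first exact: mulr_ge0.
rewrite -mulrA; apply: le_trans (ler_wpM2l C0 (H1 M M0)).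
rewrite mulrCA ler_wpM2l ?lg_ge0 // mulr_sumr big_mkcond [leRHS]big_mkcond.
apply: ler_sum_nat => r /andP[r0 _]; case: ifP => // _.
rewrite (_ : C * _ = dk i r * (C * (wt 4^-1 r / r%:R)) * (tau A r)%:R); last by ring.
by rewrite ler_wpM2r // ler_wpM2l ?dk_ge0 // H.
Qed.

Lemma sum_dk_tau i (A : R) : 0 < A <= 1 -> exists2 C : R, 0 <= C &
  forall M, (0 < M)%N ->
  lg M * \sum_(1 <= r < M.+1 | (tau A r <= M)%N) dk i r * ((tau A r)%:R / r%:R)
  <= C * (M%:R * lg M ^+ i).
Proof.
move=> A01; have [C C0 H] := @sum_tau i A 4^-1 A01 ltac:(lra).
exists C => // M M0; apply: le_trans (H M M0).
rewrite ler_wpM2l ?lg_ge0 // big_mkcond [leRHS]big_mkcond.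
apply: ler_sum_nat => r /andP[r0 _]; case: ifP => // _.
by rewrite ler_wpM2r ?divr_ge0 // ler_peMr ?dk_ge0 ?wt_ge1.
Qed.

Lemma powR_lg_le (rho : R) c : 0 < rho -> exists2 C : R, 0 <= C &
  forall M, (0 < M)%N -> M%:R `^ (1 - rho) * lg M ^+ c <= C * M%:R.
Proof.
move=> r0; have [C C0 H] := lg_pow c r0; exists C => // M M0.
apply: le_trans (ler_wpM2l (powR_ge0 _ _) (H M M0)) _.
rewrite mulrCA ler_wpM2l // -powRD; last by rewrite pnatr_eq0 -lt0n M0 implybT.
by rewrite subrK powRr1.
Qed.

(** Lengths N <= M are arbitrary, so the initial segments removed by a truncation are covered too;
    with A < e < theta the term q^(1/e) <= M^(A/e) stays a power below M. *)
Lemma disc_level h k (A theta : R) : (0 < h)%N -> exponent_of_distribution k theta ->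
  0 < A < theta -> A < 1 -> exists2 C : R, 0 <= C & exists2 rho : R, 0 < rho < 1 &
  forall N M q a, (N <= M)%N -> (0 < M)%N -> (0 < q)%N -> (gcdn a q %| h)%N ->
  q%:R <= M%:R `^ A ->
  `|disc (dk k) N q a| <= C * (M%:R `^ (1 - rho) * om q a).
Proof.
move=> h0 Hth /andP[A0 At] A1; pose e := (A + theta) / 2.
have eb : 0 < e < theta by rewrite /e; apply/andP; split; lra.
have /andP[e0 _] := eb.
have Ae : A / e < 1 by rewrite ltr_pdivrMr // mul1r /e; lra.
have Ae0 : 0 < A / e by rewrite divr_gt0.
have [C C0 [d /andP[d0 d1] H]] := disc_exponent_all h0 Hth eb.
exists (C * 2); first exact: mulr_ge0.
exists (Num.min d (1 - A / e)).
  by rewrite lt_min d0 subr_gt0 Ae gt_min d1.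
move=> N M q a NM M0 q0 ga qM.
have M1 : (1 : R) <= M%:R by rewrite ler1n.
apply: le_trans (H N q a q0 ga) _; rewrite -mulrA ler_wpM2l // mulrA ler_wpM2r ?om_ge0 //.
rewrite mulrDl mul1r lerD //.
  apply: (@le_trans _ _ (M%:R `^ (1 - d))).
    by rewrite ge0_ler_powR ?nnegrE ?ler_nat // subr_ge0 ltW.
  by rewrite ler_powR // lerD2l lerN2 ge_min lexx.
apply: (@le_trans _ _ (M%:R `^ (A / e))).
  by rewrite powRrM ge0_ler_powR ?nnegrE ?powR_ge0 ?invr_ge0 // ltW.
rewrite ler_powR //; have : Num.min d (1 - A / e) <= 1 - A / e by rewrite ge_min lexx orbT.
lra.
Qed.

Definition cnt h q r N : R :=
  \sum_(1 <= n < N.+1 | (q %| n)%N && (gcdn n r == gcdn h r)) 1.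

Lemma cnt_ge0 h q r N : 0 <= cnt h q r N. Proof. exact: sumr_ge0. Qed.

Lemma cnt_le h q r N : (0 < q)%N -> cnt h q r N <= N%:R / q%:R.
Proof.
move=> q0; apply: (@le_trans _ _ (\sum_(1 <= n < N.+1 | (q %| n)%N) 1)).
  by rewrite /cnt big_mkcond [leRHS]big_mkcond; apply: ler_sum => n _; case: (q %| n)%N => //=; case: ifP.
by rewrite sum_multiples // sum1_nat ler_pdivlMr ?ltr0n // -natrM ler_nat leq_divM.
Qed.

(** The totient in the counting main term cancels against [om], which leaves the density [kappa]. *)
Lemma om_cnt h q r N : (0 < h)%N -> (0 < q)%N -> (0 < r)%N ->
  `|om r h * cnt h q r N - N%:R * kappa h q r| <=
  (N%:R / q%:R) `^ 2^-1 * (om r h * wt 2^-1 r).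
Proof.
move=> h0 q0 r0; have := count_dvd_gcd_err N h0 q0 r0; rewrite -/(cnt h q r N) => H.
have R0 : (0 : R) < (totient (r %/ gcdn h r))%:R.
  by rewrite ltr0n totient_gt0 divn_dvd_gt0 // dvdn_gcdr.
have -> : om r h * cnt h q r N - N%:R * kappa h q r =
  om r h * (cnt h q r N - N%:R * (totient (r %/ gcdn h r))%:R * kappa h q r).
  rewrite /om mulrBr; congr (_ - _).
  by rewrite -mulrA mulrCA; congr (_ * _); rewrite mulKf // gt_eqF.
by rewrite normrM ger0_norm ?om_ge0 // [leRHS]mulrCA ler_wpM2l ?om_ge0.
Qed.

Lemma sum_gcdn_dkS i h r N :
  sum_gcdn (dk i.+1) N r (gcdn h r) = \sum_(1 <= q < N.+1) dk i q * cnt h q r N.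
Proof.
rewrite /sum_gcdn big_mkcond /=.
rewrite (eq_bigr (fun n => dk i.+1 n * (gcdn n r == gcdn h r)%:R)); last first.
  by move=> n _; case: ifP; rewrite ?mulr0 ?mulr1.
rewrite sum_dkS; apply: eq_big_nat => q /andP[q0 _]; congr (_ * _).
rewrite /cnt big_mkcondr /= sum_multiples //; apply: eq_bigr => b _.
by case: eqP.
Qed.

(** The errors sqrt(N/q), summed against d_(i+1)(q) for q <= N, give N log^i N: the square root
    saves the logarithm that a sum against 1/q would produce. *)
Lemma om_sum_gcdn i h r N : (0 < h)%N -> (0 < r)%N ->
  `|om r h * sum_gcdn (dk i.+2) N r (gcdn h r) - N%:R * dksum_kappa h i.+1 r N| <=
  2 * (N%:R * lg N ^+ i) * (om r h * wt 2^-1 r).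
Proof.
move=> h0 r0; rewrite sum_gcdn_dkS /dksum_kappa [X in `|X - _|]mulr_sumr [X in `|_ - X|]mulr_sumr -sumrB.
have W : 0 <= om r h * wt 2^-1 r by rewrite mulr_ge0 ?om_ge0 ?wt_ge0.
have N2 : 0 <= N%:R `^ 2^-1 :> R by exact: powR_ge0.
apply: (@le_trans _ _ (N%:R `^ 2^-1 * (2 * N%:R `^ 2^-1 * lg N ^+ i) * (om r h * wt 2^-1 r))).
  apply: le_trans (ler_wpM2r W (ler_wpM2l N2 (sum_dkS_sqrt i N))).
  rewrite mulr_sumr mulr_suml; apply: le_trans (ler_norm_sum _ _ _) _.
  apply: ler_sum_nat => q /andP[q0 _].
  rewrite [om r h * _]mulrCA [N%:R * _]mulrCA -mulrBr normrM ger0_norm ?dk_ge0 //.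
  apply: le_trans (ler_wpM2l (dk_ge0 _ _) (om_cnt N h0 q0 r0)) _.
  rewrite powRM ?invr_ge0 // (_ : q%:R^-1 `^ 2^-1 = q%:R `^ (- 2^-1)); last first.
    have E : q%:R^-1 = q%:R `^ (-1) :> R by rewrite powR_inv1.
    by rewrite E -powRrM mulN1r.
  rewrite le_eqVlt; apply/orP; left; apply/eqP; ring.
have E : N%:R `^ 2^-1 * N%:R `^ 2^-1 = N%:R :> R.
  by rewrite -expr2 powR12_sqrt // sqr_sqrtr.
by rewrite -[in leRHS]E le_eqVlt; apply/orP; left; apply/eqP; ring.
Qed.

(* h (r - 1) represents -h modulo r. *)
Lemma dvdn_addr_class h r n : (0 < r)%N ->
  (r %| n + h)%N = (n == h * r.-1 %[mod r])%N.
Proof.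
move=> r0; rewrite -(eqn_modDr h) -mulnSr prednK // modnMl.
by rewrite /dvdn.
Qed.

Lemma gcdn_neg_class h r : (0 < r)%N -> gcdn (h * r.-1) r = gcdn h r.
Proof.
move=> r0; rewrite gcdnC [RHS]gcdnC Gauss_gcdl // -{1}(prednK r0).
by rewrite coprimeSn.
Qed.

Lemma sum_classB f t N q a : (t <= N)%N ->
  sum_class f N q a - sum_class f t q a = \sum_(t.+1 <= n < N.+1 | (n == a %[mod q])%N) f n.
Proof. by move=> tN; rewrite /sum_class (big_cat_nat (n := t.+1)) //= addrAC subrr add0r. Qed.

(** Divisibility of n + h by r is the class -h modulo r, and the truncation removes n < [tau A r] -
    h. Truncated subtraction makes the removed segment empty when h is large. *)
Lemma sum_shift_trunc h i (A : R) N f : 0 < A ->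
  \sum_(1 <= n < N.+1) dkA A i (n + h) * f n =
  \sum_(1 <= r < (N + h).+1 | (tau A r <= N + h)%N) dk i r *
    (sum_class f N r (h * r.-1) - sum_class f (tau A r - h.+1) r (h * r.-1)).
Proof.
move=> A0.
rewrite (eq_big_nat _ _ (F2 := fun n => \sum_(1 <= r < (N + h).+1)
    if ((r %| n + h) && (tau A r <= n + h))%N then dk i r * f n else 0)); last first.
  move=> n /andP[n0 nN]; have hn : (0 < n + h <= N + h)%N by rewrite addn_gt0 n0 leq_add2r.
  rewrite /dkA mulr_suml big_mkcond (sum_divisors _ hn) big_mkcond /=.
  by apply: eq_bigr => r _; case: (r %| n + h)%N.
rewrite exchange_big /= [RHS]big_mkcond; apply: eq_big_nat => r /andP[r0 rM].
case: ifP => trM; last first.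
  apply: big1_seq => n /andP[_]; rewrite mem_index_iota ltnS => /andP[_ nN].
  case: ifP => // /andP[_ tn]; move/negP: trM; case; apply: leq_trans tn _.
  by rewrite leq_add2r.
set t := (tau A r - h.+1)%N.
have tN : (t <= N)%N by rewrite /t leq_subLR addSn addnC ltnW.
rewrite sum_classB // mulr_sumr [RHS]big_mkcond /=.
rewrite (big_cat_nat (n := t.+1)) //= big1_seq ?add0r.
  apply: eq_big_nat => n /andP[tn nN]; rewrite -dvdn_addr_class //.
  have -> : (tau A r <= n + h)%N by move: tn; rewrite /t; lia.
  by rewrite andbT; case: ifP; rewrite ?mulr0.
move=> n /andP[_]; rewrite mem_index_iota => /andP[n0 nt].
have -> : (tau A r <= n + h)%N = false by apply/negbTE; move: nt n0; rewrite /t; lia.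
by rewrite andbF.
Qed.

(** In terms of m = n + h the class is h modulo q, and n >= [tau B q] removes m up to
    [tau B q + h.-1]. As [tau B q] >= 1, this also discards every m <= h. *)
Lemma sum_trunc_shift h j (B : R) N f : 0 < B -> (0 < h)%N ->
  \sum_(1 <= n < N.+1) f (n + h)%N * dkA B j n =
  \sum_(1 <= q < N.+1 | (tau B q <= N)%N) dk j q *
    (sum_class f (N + h) q h - sum_class f (tau B q + h.-1) q h).
Proof.
move=> B0 h0.
rewrite (eq_big_nat _ _ (F2 := fun n => \sum_(1 <= q < N.+1)
    if ((q %| n) && (tau B q <= n))%N then dk j q * f (n + h)%N else 0)); last first.
  move=> n hn; rewrite /dkA mulr_sumr big_mkcond (sum_divisors _ hn) big_mkcond /=.
  by apply: eq_bigr => r _; case: (r %| n)%N => //=; case: ifP => // _; rewrite mulrC.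
rewrite exchange_big /= [RHS]big_mkcond; apply: eq_big_nat => q /andP[q0 qN].
case: ifP => tqN; last first.
  apply: big1_seq => n /andP[_]; rewrite mem_index_iota ltnS => /andP[_ nN].
  by case: ifP => // /andP[_ tn]; rewrite (leq_trans tn nN) in tqN.
have t0 : (0 < tau B q)%N by exact: tau_gt0.
set t := (tau B q + h.-1)%N.
have tN : (t <= N + h)%N by rewrite /t leq_add // leq_pred.
rewrite sum_classB // mulr_sumr.
rewrite (_ : t.+1 = tau B q + h)%N; last by rewrite /t -addnS prednK.
rewrite (_ : (N + h).+1 = N.+1 + h)%N // big_addn addnK.
rewrite (big_cat_nat t0 (leqW tqN)) /= big1_seq ?add0r.
  rewrite [RHS]big_mkcond.
  apply: eq_big_nat => n /andP[tn nN]; rewrite tn andbT.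
  by rewrite -[X in _ == X %[mod _]]add0n eqn_modDr mod0n -/(dvdn q n); case: ifP; rewrite ?mulr0.
move=> n /andP[_]; rewrite mem_index_iota => /andP[n0 nt].
by rewrite [(tau B q <= n)%N]leqNgt nt andbF.
Qed.

Lemma sum_gcdn_dkA h i (A : R) M q :
  sum_gcdn (dkA A i) M q (gcdn h q) =
  \sum_(1 <= r < M.+1 | (tau A r <= M)%N) dk i r *
    (cnt h r q M - cnt h r q (tau A r).-1).
Proof.
rewrite /sum_gcdn big_mkcond /=.
rewrite (eq_big_nat _ _ (F2 := fun n => \sum_(1 <= r < M.+1)
    if [&& (r %| n)%N, (tau A r <= n)%N & gcdn n q == gcdn h q] then dk i r else 0)); last first.
  move=> n hn; rewrite /dkA big_mkcond (sum_divisors _ hn) big_mkcond /=.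
  case: ifP => ng; last by rewrite big1 // => r _; rewrite !andbF.
  by apply: eq_bigr => r _; rewrite andbT; case: (r %| n)%N.
rewrite exchange_big /= [RHS]big_mkcond; apply: eq_big_nat => r /andP[r0 rM].
case: ifP => trM; last first.
  apply: big1_seq => n /andP[_]; rewrite mem_index_iota ltnS => /andP[_ nM].
  by case: ifP => // /and3P[_ tn _]; rewrite (leq_trans tn nM) in trM.
have [t0|t0] := posnP (tau A r).
  rewrite t0 /= /cnt [X in _ - X]big_geq // subr0 mulr_sumr big_mkcond [RHS]big_mkcond.
  by apply: eq_bigr => n _ /=; case: (r %| n)%N => //=; case: ifP; rewrite ?mulr1.
rewrite /cnt (big_cat_nat (n := (tau A r).-1.+1)) ?prednK // ?leqW //=.
rewrite big1_seq ?add0r; last first.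
  move=> n /andP[_]; rewrite mem_index_iota => /andP[_ nt].
  by rewrite [(tau A r <= n)%N]leqNgt nt andbF.
rewrite [X in _ = _ * (X - _)](big_cat_nat (n := tau A r)) ?leqW //=.
rewrite addrAC subrr add0r mulr_sumr [RHS]big_mkcond; apply: eq_big_nat => n /andP[tn _].
by rewrite tn /=; case: (r %| n)%N => //=; case: ifP; rewrite ?mulr1 ?mulr0.
Qed.

(** The admissible error. The lemmas below use d_(k+1) and d_(j+2), so the exponent k + j here is
    the one of the theorem. *)
Definition err h k j N : R := (N + h)%:R * (lg (N + h) ^+ k * lg (N + h) ^+ j).

(* d_(k+1)(n+h, A) is opened and the level of distribution of d_(j+2) is used. *)
Lemma shifted_sum_full h k j (A theta : R) : (0 < h)%N ->
  exponent_of_distribution j.+2 theta -> 0 < A < theta -> A < 1 ->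
  exists2 C : R, 0 <= C & forall N, (0 < N)%N ->
  `|\sum_(1 <= n < N.+1) dkA A k (n + h) * dk j.+2 n -
    N%:R * \sum_(1 <= r < (N + h).+1 | (tau A r <= N + h)%N) dk k r * dksum_kappa h j.+1 r N| <=
  C * err h k j N.
Proof.
move=> h0 Hth At A1; have [C1 C10 [rho r01 H1]] := disc_level h0 Hth At A1.
have /andP[A0 _] := At; have /andP[rho0 rho1] := r01.
have A01 : 0 < A <= 1 by rewrite A0 ltW.
have [C2 C20 H2] := sum_om k h0.
have [C3 C30 H3] := sum_om_wt k h0.
have [C4 C40 H4] := sum_om_tau k h0 A01.
have [C5 C50 H5] := powR_lg_le k rho0.
exists (2 * C1 * (C2 * C5) + C4 + 2 * C3) => [|N N0].
  by rewrite !addr_ge0 ?mulr_ge0.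
set M := (N + h)%N; have M0 : (0 < M)%N by rewrite addn_gt0 N0.
have NM : (N <= M)%N by rewrite leq_addr.
have L1 c : 1 <= lg M ^+ c by rewrite exprn_ege1 ?lg_ge1.
have L0 c : 0 <= lg M ^+ c by exact: le_trans (L1 c).
rewrite sum_shift_trunc // -/M mulr_sumr -sumrB.
(* For each r: the discrepancies of the full and the removed segment, the trivial bound for the mean
   value over the removed segment, and the error of the main term. *)
pose E r := dk k r * (2 * C1 * M%:R `^ (1 - rho) * om r h +
   lg M ^+ j.+1 * (om r h * (tau A r)%:R) + 2 * (M%:R * lg M ^+ j) * (om r h * wt 2^-1 r)).
apply: (@le_trans _ _ (\sum_(1 <= r < M.+1 | (tau A r <= M)%N) E r)).
  apply: le_trans (ler_norm_sum _ _ _) _.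
  apply: ler_sum_nat_cond => r /andP[r0 rM] trM.
  rewrite mulrCA -mulrBr normrM ger0_norm ?dk_ge0 // /E ler_wpM2l ?dk_ge0 //.
  set a := (h * r.-1)%N; have ga : gcdn a r = gcdn h r by exact: gcdn_neg_class.
  have omE : om r a = om r h by rewrite /om ga.
  have rA : r%:R <= M%:R `^ A by rewrite tauP.
  have gah : (gcdn a r %| h)%N by rewrite ga dvdn_gcdl.
  set t := (tau A r - h.+1)%N.
  have tM : (t <= M)%N by rewrite (leq_trans (leq_subr _ _)).
  have hN := H1 N M r a NM M0 r0 gah rA; rewrite omE in hN.
  have ht := H1 t M r a tM M0 r0 gah rA; rewrite omE in ht.
  rewrite !sum_class_disc ga omE.
  have hG := om_sum_gcdn j N h0 r0.
  have hS : om r h * sum_gcdn (dk j.+2) t r (gcdn h r) <= lg M ^+ j.+1 * (om r h * (tau A r)%:R).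
    rewrite mulrCA ler_wpM2l ?om_ge0 //.
    apply: le_trans (sum_gcdn_le _ _ _ _) _; first exact: dk_ge0.
    apply: le_trans (sum_dkS_le _ _) _; rewrite mulrC ler_pM ?exprn_ge0 ?lg_ge0 //.
      by rewrite lerXn2r ?nnegrE ?lg_ge0 ?lg_homo.
    by rewrite ler_nat leq_subr.
  have hS0 : 0 <= om r h * sum_gcdn (dk j.+2) t r (gcdn h r).
    by rewrite mulr_ge0 ?om_ge0 // sumr_ge0 // => n _; exact: dk_ge0.
  have hW : 2 * (N%:R * lg N ^+ j) * (om r h * wt 2^-1 r) <= 2 * (M%:R * lg M ^+ j) * (om r h * wt 2^-1 r).
    rewrite ler_wpM2r ?mulr_ge0 ?om_ge0 ?wt_ge0 // ler_wpM2l // ler_pM ?exprn_ge0 ?lg_ge0 ?ler_nat //.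
    by rewrite lerXn2r ?nnegrE ?lg_ge0 ?lg_homo.
  move: hN ht hG hS hS0 hW.
  set x1 := disc _ N _ _; set x2 := disc _ t _ _; set x3 := om r h * sum_gcdn _ N _ _.
  set x4 := om r h * sum_gcdn _ t _ _; set x5 := N%:R * dksum_kappa _ _ _ _.
  set y1 := C1 * _; set y2 := lg M ^+ _ * _; set y3 := 2 * (N%:R * _) * _; set y4 := 2 * (M%:R * _) * _.
  move=> hN ht hG hS hS0 hW.
  rewrite (_ : 2 * C1 * _ * _ = 2 * y1); last by rewrite /y1; ring.
  rewrite (_ : x1 + x3 - (x2 + x4) - x5 = x1 - x2 - x4 + (x3 - x5)); last by ring.
  apply: le_trans (ler_normD _ _) _; apply: lerD; last exact: le_trans hW.
  apply: le_trans (ler_normB _ _) _; apply: lerD; last by rewrite ger0_norm.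
  by apply: le_trans (ler_normB _ _) _; rewrite mulrDl mul1r lerD.
rewrite /E.
rewrite (eq_bigr (fun r => 2 * C1 * M%:R `^ (1 - rho) * (dk k r * om r h) +
   lg M ^+ j.+1 * (dk k r * om r h * (tau A r)%:R) +
   2 * (M%:R * lg M ^+ j) * (dk k r * (om r h * wt 2^-1 r)))); last by move=> r _; ring.
rewrite !big_split /= -!mulr_sumr.
have s1 : \sum_(1 <= r < M.+1 | (tau A r <= M)%N) dk k r * om r h <= C2 * lg M ^+ k.
  apply: le_trans (H2 M); apply: ler_sum_cond_widen => // r _.
  by rewrite mulr_ge0 ?dk_ge0 ?om_ge0.
have s3 : \sum_(1 <= r < M.+1 | (tau A r <= M)%N) dk k r * (om r h * wt 2^-1 r) <= C3 * lg M ^+ k.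
  apply: le_trans (H3 M); apply: ler_sum_cond_widen => // r _.
  by rewrite !mulr_ge0 ?dk_ge0 ?om_ge0 ?wt_ge0.
have s2 := H4 M M0.
rewrite /err -/M [leRHS]mulrDl [X in _ <= X + _]mulrDl; apply: lerD; first apply: lerD.
- rewrite -!mulrA ler_wpM2l // ler_wpM2l //.
  apply: le_trans (ler_wpM2l (powR_ge0 _ _) s1) _.
  rewrite mulrCA ler_wpM2l //; apply: le_trans (H5 M M0) _.
  by rewrite ler_wpM2l // ler_peMr // -[leLHS]mulr1 ler_pM.
- rewrite exprS [lg M * _]mulrC -mulrA.
  apply: le_trans (ler_wpM2l (L0 j) s2) _.
  by rewrite le_eqVlt; apply/orP; left; apply/eqP; ring.
- have P0 : 0 <= 2 * (M%:R * lg M ^+ j) by rewrite !mulr_ge0.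
  apply: le_trans (ler_wpM2l P0 s3) _.
  by rewrite le_eqVlt; apply/orP; left; apply/eqP; ring.
Qed.

(** The counterpart of [om_sum_gcdn] with modulus q and r the opened divisor. The second error
    bounds the multiples of r below the threshold [tau A r]. *)
Lemma om_sum_gcdn_dkA h k (A : R) q M : (0 < h)%N -> (0 < q)%N -> 0 < A ->
  `|om q h * sum_gcdn (dkA A k) M q (gcdn h q) -
    M%:R * \sum_(1 <= r < M.+1 | (tau A r <= M)%N) dk k r * kappa h r q| <=
  om q h * wt 2^-1 q *
     \sum_(1 <= r < M.+1 | (tau A r <= M)%N) dk k r * (M%:R / r%:R) `^ 2^-1 +
  om q h * \sum_(1 <= r < M.+1 | (tau A r <= M)%N) dk k r * ((tau A r)%:R / r%:R).
Proof.
move=> h0 q0 A0; rewrite sum_gcdn_dkA.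
rewrite [X in `|X - _|]mulr_sumr [X in `|_ - X|]mulr_sumr -sumrB.
rewrite [X in _ <= X + _]mulr_sumr [X in _ <= _ + X]mulr_sumr -big_split /=.
apply: le_trans (ler_norm_sum _ _ _) _.
apply: ler_sum_nat_cond => r /andP[r0 _] _.
have t0 : (0 < tau A r)%N by exact: tau_gt0.
have -> : om q h * (dk k r * (cnt h r q M - cnt h r q (tau A r).-1)) - M%:R * (dk k r * kappa h r q) =
   dk k r * ((om q h * cnt h r q M - M%:R * kappa h r q) - om q h * cnt h r q (tau A r).-1) by ring.
rewrite normrM ger0_norm ?dk_ge0 //.
have H1 := om_cnt M h0 r0 q0.
have H2 : om q h * cnt h r q (tau A r).-1 <= om q h * ((tau A r)%:R / r%:R).
  rewrite ler_wpM2l ?om_ge0 //; apply: le_trans (cnt_le _ _ _ r0) _.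
  by rewrite ler_wpM2r ?invr_ge0 // ler_nat leq_pred.
have H3 : 0 <= om q h * cnt h r q (tau A r).-1 by rewrite mulr_ge0 ?om_ge0 ?cnt_ge0.
rewrite [leRHS](_ : _ = dk k r * ((M%:R / r%:R) `^ 2^-1 * (om q h * wt 2^-1 q) + om q h * ((tau A r)%:R / r%:R))); last by ring.
rewrite ler_wpM2l ?dk_ge0 //; apply: le_trans (ler_normB _ _) _.
by rewrite [X in _ + X]ger0_norm // lerD.
Qed.

(** Restricting r to M^A with A < 1 turns the square roots into a power saving, M^(1/2 + A/2). *)
Lemma sum_dk_sqrt_tau k (A : R) M : 0 < A <= 1 -> (0 < M)%N ->
  \sum_(1 <= r < M.+1 | (tau A r <= M)%N) dk k r * (M%:R / r%:R) `^ 2^-1 <=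
  2 * (M%:R `^ (1 - (1 - A) / 2) * lg M ^+ k).
Proof.
move=> A01 M0; rewrite sum_tau_truncn //; have /andP[A0 A1] := A01.
have A01' : 0 <= A <= 1 by rewrite ltW.
have [] := truncn_powR A01' M0; set Y := Num.truncn _ => /andP[Y0 YM] Y1 _.
have M2 : 0 <= M%:R `^ 2^-1 :> R by exact: powR_ge0.
apply: (@le_trans _ _ (M%:R `^ 2^-1 * (2 * Y%:R `^ 2^-1 * lg Y ^+ k))).
  apply: le_trans (ler_wpM2l M2 (sum_dk_sqrt k Y)).
  rewrite mulr_sumr; apply: ler_sum_nat => r /andP[r0 _].
  rewrite powRM ?invr_ge0 // (_ : r%:R^-1 `^ 2^-1 = r%:R `^ (- 2^-1)); last first.
    have E : r%:R^-1 = r%:R `^ (-1) :> R by rewrite powR_inv1.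
    by rewrite E -powRrM mulN1r.
  by rewrite mulrCA.
rewrite [leLHS](_ : _ = 2 * ((M%:R `^ 2^-1 * Y%:R `^ 2^-1) * lg Y ^+ k)); last by ring.
rewrite ler_wpM2l // ler_pM ?mulr_ge0 ?powR_ge0 ?exprn_ge0 ?lg_ge0 //; last first.
  by rewrite lerXn2r ?nnegrE ?lg_ge0 ?lg_homo.
apply: (@le_trans _ _ (M%:R `^ 2^-1 * (M%:R `^ A) `^ 2^-1)).
  by rewrite ler_wpM2l // ge0_ler_powR ?nnegrE ?powR_ge0 ?invr_ge0.
rewrite -powRrM -powRD; last by rewrite pnatr_eq0 -lt0n M0 implybT.
by rewrite (_ : 2^-1 + A * 2^-1 = 1 - (1 - A) / 2) //; lra.
Qed.

Lemma dksum_kappa_le h j r Y : (0 < h)%N -> (0 < r)%N -> dksum_kappa h j r Y <= h%:R / r%:R * lg Y ^+ j.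
Proof.
move=> h0 r0; have hr : (0 : R) <= h%:R / r%:R by rewrite divr_ge0.
apply: le_trans (ler_wpM2l hr (dksum_le j Y)); rewrite /dksum_kappa /dksum mulr_sumr.
apply: ler_sum_nat => q /andP[q0 _].
rewrite (_ : _ / _ * _ = dk j q * (h%:R / (q%:R * r%:R))); last by rewrite invfM; ring.
by rewrite ler_wpM2l ?dk_ge0 // kappa_le.
Qed.

Lemma dksum_kappa_ge0 h j r Y : 0 <= dksum_kappa h j r Y.
Proof. by apply: sumr_ge0 => q _; rewrite mulr_ge0 ?dk_ge0 ?kappa_ge0. Qed.

(* d_(j+2)(n, B) is opened and the level of distribution of d_(k+1)(., A) is used. *)
Lemma shifted_sum_trunc h k j (A B thk thk1 : R) : (0 < h)%N ->
  exponent_of_distribution k.+1 thk -> exponent_of_distribution k thk1 ->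
  0 < A < 1 -> 0 < B <= 1 -> B < thk -> B < A * thk1 ->
  exists2 C : R, 0 <= C & forall N, (0 < N)%N ->
  `|\sum_(1 <= n < N.+1) dkA A k (n + h) * dkA B j.+1 n -
    N%:R * \sum_(1 <= r < (N + h).+1 | (tau A r <= N + h)%N)
       dk k r * dksum_kappa h j.+1 r (Num.truncn (N%:R `^ B))| <=
  C * err h k j N.
Proof.
move=> h0 Hk Hk1 A01 B01 Bk Bk1; have /andP[A0 A1] := A01; have /andP[B0 B1] := B01.
have [C1 C10 [rho /andP[rho0 rho1] H1]] := disc_dkA h0 Hk Hk1 A01 B0 Bk Bk1.
have A01' : 0 < A <= 1 by rewrite A0 ltW.
have [C2 C20 H2] := sum_om j.+1 h0.
have [C3 C30 H3] := sum_om_wt j.+1 h0.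
have [C4 C40 H4] := sum_om_tau j.+1 h0 B01.
have [C5 C50 H5] := powR_lg_le j.+1 rho0.
have A2 : 0 < (1 - A) / 2 by lra.
have [C6 C60 H6] := powR_lg_le (k + j.+1) A2.
have [C7 C70 H7] := sum_dk_tau k A01'.
have [C8 C80 H8] := @lg_pow 1 (k + j.+1) ltr01.
exists (2 * C1 * (C2 * C5) + h%:R * C4 + 2 * C3 * C6 + C2 * C7 + h%:R ^+ 2 * C8) => [|N N0].
  by rewrite !addr_ge0 ?mulr_ge0 ?exprn_ge0.
set M := (N + h)%N; have M0 : (0 < M)%N by rewrite addn_gt0 N0.
have NM : (N <= M)%N by rewrite leq_addr.
have M0' : (0 : R) <= M%:R by [].
have L1 c : 1 <= lg M ^+ c by rewrite exprn_ege1 ?lg_ge1.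
have L0 c : 0 <= lg M ^+ c by exact: le_trans (L1 c).
have lM0 : 0 < lg M by exact: lt_le_trans (lg_ge1 M).
have MT : M%:R <= err h k j N.
  by rewrite /err -/M ler_peMr // -[leLHS]mulr1 ler_pM.
have T0 : 0 <= err h k j N by exact: le_trans MT.
set P := \sum_(1 <= r < M.+1 | (tau A r <= M)%N) dk k r * (M%:R / r%:R) `^ 2^-1.
set Q := \sum_(1 <= r < M.+1 | (tau A r <= M)%N) dk k r * ((tau A r)%:R / r%:R).
have P0 : 0 <= P by apply: sumr_ge0 => r _; rewrite mulr_ge0 ?dk_ge0 ?powR_ge0.
have Q0 : 0 <= Q by apply: sumr_ge0 => r _; rewrite mulr_ge0 ?dk_ge0 ?divr_ge0.
pose X q := \sum_(1 <= r < M.+1 | (tau A r <= M)%N) dk k r * kappa h r q.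
(* The main term is the same double sum as before with its order exchanged; [kappa] is symmetric in
   q and r. *)
have XE : \sum_(1 <= r < M.+1 | (tau A r <= M)%N) dk k r * dksum_kappa h j.+1 r (Num.truncn (N%:R `^ B)) =
   \sum_(1 <= q < N.+1 | (tau B q <= N)%N) dk j.+1 q * X q.
  rewrite (eq_bigr (fun r => \sum_(1 <= q < N.+1 | (tau B q <= N)%N) dk k r * (dk j.+1 q * kappa h q r))); last first.
    by move=> r _; rewrite /dksum_kappa -sum_tau_truncn // mulr_sumr.
  rewrite exchange_big /=; apply: eq_bigr => q _; rewrite /X mulr_sumr; apply: eq_bigr => r _.
  by rewrite mulrCA kappaC.
set S := \sum_(1 <= r < M.+1 | _) dk k r * dksum_kappa _ _ _ _ in XE *.
have S0 : 0 <= S by apply: sumr_ge0 => r _; rewrite mulr_ge0 ?dk_ge0 ?dksum_kappa_ge0.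
(* The modulus q is applied to sums of length M = N + h, so the main term appears with M; its excess
   h S over N S has no power of N and is negligible. *)
have SE : h%:R * S <= h%:R ^+ 2 * C8 * err h k j N.
  rewrite expr2 -!mulrA ler_wpM2l //.
  have S1 : S <= \sum_(1 <= r < M.+1) dk k r * (h%:R / r%:R * lg M ^+ j.+1).
    apply: (@le_trans _ _ (\sum_(1 <= r < M.+1 | (tau A r <= M)%N) dk k r * (h%:R / r%:R * lg M ^+ j.+1))).
      apply: ler_sum_nat_cond => r /andP[r0 _] _.
      rewrite ler_wpM2l ?dk_ge0 //; apply: le_trans (dksum_kappa_le _ _ h0 r0) _.
      rewrite ler_wpM2l ?divr_ge0 // lerXn2r ?nnegrE ?lg_ge0 // lg_homo //.
      have B01' : 0 <= B <= 1 by rewrite ltW.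
      by have [/andP[_ YN] _ _] := truncn_powR B01' N0; exact: leq_trans YN NM.
    by apply: ler_sum_cond_widen => // r _; rewrite !mulr_ge0 ?dk_ge0 ?invr_ge0.
  apply: le_trans S1 _.
  rewrite (eq_bigr (fun r => h%:R * lg M ^+ j.+1 * (dk k r / r%:R))); last by move=> r _; ring.
  rewrite -mulr_sumr -mulrA ler_wpM2l //.
  apply: le_trans (ler_wpM2l (L0 j.+1) (dksum_le k M)) _.
  rewrite -exprD addnC; apply: le_trans (H8 M M0) _; rewrite powRr1 // ler_wpM2l //.
have -> : \sum_(1 <= n < N.+1) dkA A k (n + h) * dkA B j.+1 n - N%:R * S =
  (\sum_(1 <= n < N.+1) dkA A k (n + h) * dkA B j.+1 n - M%:R * S) + h%:R * S.
  by rewrite /M natrD; ring.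
rewrite [leRHS]mulrDl; apply: le_trans (ler_normD _ _) _; apply: lerD; last first.
  by rewrite ger0_norm ?mulr_ge0.
rewrite (sum_trunc_shift j.+1 N (dkA A k) B0 h0) -/M XE mulr_sumr -sumrB.
(* For each q: two discrepancies, the trivial bound for the segment up to [tau B q + h.-1], at most
   h [tau B q] long, and the two errors of the main term. *)
pose E q := dk j.+1 q * (2 * C1 * M%:R `^ (1 - rho) * om q h +
   h%:R * lg M ^+ k * (om q h * (tau B q)%:R) + (om q h * wt 2^-1 q * P + om q h * Q)).
apply: (@le_trans _ _ (\sum_(1 <= q < N.+1 | (tau B q <= N)%N) E q)).
  apply: le_trans (ler_norm_sum _ _ _) _.
  apply: ler_sum_nat_cond => q /andP[q0 qN] tqN.
  rewrite mulrCA -mulrBr normrM ger0_norm ?dk_ge0 // /E ler_wpM2l ?dk_ge0 //.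
  have t0 : (0 < tau B q)%N by exact: tau_gt0.
  set t := (tau B q + h.-1)%N.
  have tM : (0 < t <= M)%N by rewrite addn_gt0 t0 /= leq_add // leq_pred.
  have qB : q%:R <= M%:R `^ B by rewrite tauP // (leq_trans tqN).
  have MM : (0 < M <= M)%N by rewrite M0 leqnn.
  have hM := H1 M M q MM q0 qB; have ht := H1 t M q tM q0 qB.
  have hG := om_sum_gcdn_dkA k M h0 q0 A0; rewrite -/P -/Q -/(X q) in hG.
  rewrite !sum_class_disc.
  have hS : om q h * sum_gcdn (dkA A k) t q (gcdn h q) <= h%:R * lg M ^+ k * (om q h * (tau B q)%:R).
    rewrite [leRHS]mulrCA ler_wpM2l ?om_ge0 //.
    apply: le_trans (sum_gcdn_le _ _ _ _) _; first exact: dkA_ge0.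
    apply: (@le_trans _ _ (\sum_(1 <= n < t.+1) dk k.+1 n)).
      by apply: ler_sum_nat => n /andP[n0 _]; exact: dkA_le.
    apply: le_trans (sum_dkS_le _ _) _.
    rewrite [leRHS]mulrAC mulrC [leRHS]mulrC; have /andP[_ tM'] := tM.
    rewrite ler_pM ?exprn_ge0 ?lg_ge0 //; first by rewrite lerXn2r ?nnegrE ?lg_ge0 ?lg_homo.
    rewrite -natrM ler_nat /t -{2}(prednK h0) mulSn leq_add2l leq_pmulr //.
  have hS0 : 0 <= om q h * sum_gcdn (dkA A k) t q (gcdn h q).
    by rewrite mulr_ge0 ?om_ge0 // sumr_ge0 // => n _; exact: dkA_ge0.
  move: hM ht hG hS hS0.
  set x1 := disc _ M _ _; set x2 := disc _ t _ _; set x3 := om q h * sum_gcdn _ M _ _.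
  set x4 := om q h * sum_gcdn _ t _ _; set x5 := M%:R * X q.
  set y1 := C1 * _; set y2 := h%:R * _ * _; set y3 := om q h * _ * P + _.
  move=> hM ht hG hS hS0.
  rewrite (_ : 2 * C1 * _ * _ = 2 * y1); last by rewrite /y1; ring.
  rewrite (_ : x1 + x3 - (x2 + x4) - x5 = x1 - x2 - x4 + (x3 - x5)); last by ring.
  apply: le_trans (ler_normD _ _) _; apply: lerD => //.
  apply: le_trans (ler_normB _ _) _; apply: lerD; last by rewrite ger0_norm.
  by apply: le_trans (ler_normB _ _) _; rewrite mulrDl mul1r lerD.
rewrite /E.
rewrite (eq_bigr (fun q => 2 * C1 * M%:R `^ (1 - rho) * (dk j.+1 q * om q h) +
   h%:R * lg M ^+ k * (dk j.+1 q * om q h * (tau B q)%:R) +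
   P * (dk j.+1 q * (om q h * wt 2^-1 q)) + Q * (dk j.+1 q * om q h))); last by move=> q _; ring.
rewrite !big_split /= -!mulr_sumr.
have s1 : \sum_(1 <= q < N.+1 | (tau B q <= N)%N) dk j.+1 q * om q h <= C2 * lg M ^+ j.+1.
  apply: le_trans (H2 M); apply: ler_sum_cond_widen => // q _.
  by rewrite mulr_ge0 ?dk_ge0 ?om_ge0.
have s3 : \sum_(1 <= q < N.+1 | (tau B q <= N)%N) dk j.+1 q * (om q h * wt 2^-1 q) <= C3 * lg M ^+ j.+1.
  apply: le_trans (H3 M); apply: ler_sum_cond_widen => // q _.
  by rewrite !mulr_ge0 ?dk_ge0 ?om_ge0 ?wt_ge0.
have s2 : \sum_(1 <= q < N.+1 | (tau B q <= N)%N) dk j.+1 q * om q h * (tau B q)%:R <= C4 * (M%:R * lg M ^+ j).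
  rewrite -(ler_pM2l lM0) [leRHS](_ : _ = C4 * (M%:R * lg M ^+ j.+1)); last by rewrite exprS; ring.
  apply: le_trans (H4 M M0); rewrite ler_pM2l //; apply: ler_sum_cond_widen => // q.
    by move=> _ tN; exact: leq_trans tN NM.
  by move=> _; rewrite !mulr_ge0 ?dk_ge0 ?om_ge0.
rewrite [leRHS]mulrDl [X in _ <= X + _]mulrDl [X in _ <= X + _ + _]mulrDl.
apply: lerD; first apply: lerD; first apply: lerD.
- rewrite -!mulrA ler_wpM2l // ler_wpM2l //.
  apply: le_trans (ler_wpM2l (powR_ge0 _ _) s1) _.
  rewrite mulrCA ler_wpM2l //; apply: le_trans (H5 M M0) _.
  by rewrite ler_wpM2l.
- have p0 : 0 <= h%:R * lg M ^+ k by rewrite mulr_ge0.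
  apply: le_trans (ler_wpM2l p0 s2) _; rewrite /err -/M.
  by rewrite le_eqVlt; apply/orP; left; apply/eqP; ring.
- apply: le_trans (ler_wpM2l P0 s3) _.
  have := sum_dk_sqrt_tau k A01' M0; rewrite -/P => hP.
  have p0 : 0 <= C3 * lg M ^+ j.+1 by rewrite mulr_ge0.
  apply: le_trans (ler_wpM2r p0 hP) _.
  rewrite [leLHS](_ : _ = 2 * C3 * (M%:R `^ (1 - (1 - A) / 2) * lg M ^+ (k + j.+1))); last by rewrite exprD; ring.
  have c0 : 0 <= 2 * C3 by rewrite mulr_ge0.
  apply: le_trans (ler_wpM2l c0 (H6 M M0)) _.
  by rewrite mulrA ler_wpM2l // mulr_ge0.
- apply: le_trans (ler_wpM2l Q0 s1) _; have := H7 M M0; rewrite -/Q => hQ.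
  rewrite [leLHS](_ : _ = C2 * lg M ^+ j * (lg M * Q)); last by rewrite exprS; ring.
  have p0 : 0 <= C2 * lg M ^+ j by rewrite mulr_ge0.
  apply: le_trans (ler_wpM2l p0 hQ) _; rewrite /err -/M.
  by rewrite le_eqVlt; apply/orP; left; apply/eqP; ring.
Qed.

(** * Comparison of the main terms and conclusion *)

(** Both sums run over the same r, so the scaling is applied to each r separately; the weights
    [wt 2^-1 r] are then summed without losing a logarithm. *)
Lemma main_terms h k j (A B : R) : (0 < h)%N -> 0 < A <= 1 -> 0 < B <= 1 ->
  exists2 C : R, 0 <= C & forall N, (0 < N)%N ->
  `|N%:R * (\sum_(1 <= r < (N + h).+1 | (tau A r <= N + h)%N) dk k r * dksum_kappa h j.+1 r N) -
    B ^- j.+1 * (N%:R * \sum_(1 <= r < (N + h).+1 | (tau A r <= N + h)%N)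
       dk k r * dksum_kappa h j.+1 r (Num.truncn (N%:R `^ B)))| <=
  C * err h k j N.
Proof.
move=> h0 A01 B01.
have [C1 C10 H1] := @dksum_kappa_scale h j.+1 B 2^-1 h0 B01 ltac:(lra).
have [C2 C20 H2] := @sum_dk_wt_div k 2^-1 ltac:(lra).
exists (C1 * j.+1%:R * C2) => [|N N0]; first by rewrite !mulr_ge0.
rewrite mulrCA -mulrBr !mulr_sumr -sumrB normrM ger0_norm //.
set M := (N + h)%N; have NM : (N <= M)%N by rewrite leq_addr.
rewrite /err -/M.
have P0 : 0 <= C1 * (j.+1%:R * lg M ^+ j) by rewrite !mulr_ge0 ?exprn_ge0 ?lg_ge0.
have S : `|\sum_(1 <= r < M.+1 | (tau A r <= M)%N)
     (dk k r * dksum_kappa h j.+1 r N - B ^- j.+1 * (dk k r * dksum_kappa h j.+1 r (Num.truncn (N%:R `^ B))))| <=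
   C1 * (j.+1%:R * lg M ^+ j) * (C2 * lg M ^+ k).
  apply: le_trans (ler_wpM2l P0 (H2 M)); apply: le_trans (ler_norm_sum _ _ _) _.
  apply: (@le_trans _ _ (\sum_(1 <= r < M.+1 | (tau A r <= M)%N)
     C1 * (j.+1%:R * lg M ^+ j) * (dk k r * wt 2^-1 r / r%:R))).
    apply: ler_sum_nat_cond => r /andP[r0 _] _.
    rewrite [B ^- _ * _]mulrCA -mulrBr normrM ger0_norm ?dk_ge0 //.
    rewrite [leRHS](_ : _ = dk k r * (C1 * (j.+1%:R * lg M ^+ j) * (wt 2^-1 r / r%:R))); last by ring.
    apply: ler_wpM2l; first exact: dk_ge0.
    apply: le_trans (H1 r N r0 N0) _; rewrite ler_wpM2r ?divr_ge0 ?wt_ge0 //.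
    by rewrite ler_wpM2l // ler_wpM2l //= lerXn2r ?nnegrE ?lg_ge0 ?lg_homo.
  rewrite -mulr_sumr ler_wpM2l //; apply: ler_sum_cond_widen => // r _.
  by rewrite divr_ge0 // mulr_ge0 ?dk_ge0 ?wt_ge0.
apply: (@le_trans _ _ (M%:R * (C1 * (j.+1%:R * lg M ^+ j) * (C2 * lg M ^+ k)))).
  by rewrite ler_pM // ler_nat.
by rewrite le_eqVlt; apply/orP; left; apply/eqP; ring.
Qed.

Lemma divisor_fun_truncE k n (A : R) : 0 < A ->
  (divisor_fun_trunc k n A)%:R = dkA A k.-1 n.
Proof.
move=> A0; rewrite /divisor_fun_trunc /dkA natr_sum; apply: eq_bigl => q.
by rewrite tauP.
Qed.

Lemma dkA0 (B : R) n : 0 < B -> (0 < n)%N -> dkA B 0 n = 1.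
Proof.
move=> B0 n0; rewrite /dkA big_mkcond (bigD1_seq 1%N) ?divisors_uniq ?divisor1 //=.
rewrite -tauP // natr_powR_ge1 ?(ltW B0) // dk0 big1 ?addr0 // => q q1.
by rewrite dk0 (negPf q1); case: ifP.
Qed.

Lemma err_le h k j : exists C : R, \forall x \near +oo,
  0 <= err h k j (Num.truncn x) <= C * (x * ln x ^+ (k + j)).
Proof.
(* For large x one has N + h <= 2 x and [lg (N + h)] <= 2 + ln x <= 3 ln x. *)
exists (2 * 3 ^+ (k + j)); near=> x.
have x3 : 3 <= x by near: x; apply: nbhs_pinfty_ge; rewrite num_real.
have xh : h%:R <= x by near: x; apply: nbhs_pinfty_ge; rewrite num_real.
have xe : expR 1 <= x by near: x; apply: nbhs_pinfty_ge; rewrite num_real.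
have x0 : 0 < x by lra.
have lx : 1 <= ln x by rewrite -[leLHS]expRK ler_ln ?posrE ?expR_gt0.
set N := Num.truncn x; have Nx : N%:R <= x by rewrite truncn_le // ltW.
have N0 : (0 < N)%N by rewrite truncn_gt0; lra.
have Mx : (N + h)%:R <= 2 * x by rewrite natrD; lra.
have M0 : (0 : R) < (N + h)%:R by rewrite ltr0n addn_gt0 N0.
have lM : lg (N + h) <= 3 * ln x.
  have h1 : ln (N + h)%:R <= ln (2 * x) by rewrite ler_ln ?posrE // mulr_gt0.
  have h2 : ln (2 * x) <= 1 + ln x.
    rewrite lnM ?posrE // lerD2r.
    by have := @lg_le 2 isT; rewrite /lg; lra.
  by rewrite /lg; lra.
rewrite /err -exprD !mulr_ge0 ?exprn_ge0 ?lg_ge0 //=.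
rewrite [leRHS](_ : _ = 2 * x * (3 * ln x) ^+ (k + j)); last by rewrite exprMn; ring.
by rewrite ler_pM ?exprn_ge0 ?lg_ge0 // lerXn2r ?nnegrE ?lg_ge0 // mulr_ge0 //; lra.
Unshelve. all: by end_near.
Qed.

Lemma log_exponentE k j : k.+1%:Z + j.+2%:Z - 3 = (k + j)%N%:Z.
Proof. lia. Qed.

Lemma B_exponentE (B : R) j : B ^ (1 - j.+2%:Z) = B ^- j.+1.
Proof. by have -> : 1 - j.+2%:Z = - j.+1%:Z by lia. Qed.
End Real.

Theorem corollary1p7 (R : realType) (h k l : nat) (theta : nat -> R) (A B : R) :
  (0 < h)%N -> (0 < k)%N -> (0 < l)%N ->
  (forall j : nat, j \in [:: l; k; k.-1] ->
    exponent_of_distribution j (theta j)) ->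
  0 < A < theta l ->
  0 < B < Num.min (theta k) (A * theta k.-1) ->
  exists C : R, \forall x \near +oo,
    `| \sum_(1 <= n < (Num.truncn x).+1)
         (divisor_fun_trunc k (n + h) A)%:R *
         ((divisor_fun l n)%:R
          - B ^ (1 - l%:Z) * (divisor_fun_trunc l n B)%:R) |
    <= C * (x * ln x ^ (k%:Z + l%:Z - 3)).
Proof.
move=> h0; case: k => // k _; case: l => // l _ Hth /andP[A0 Al].
rewrite lt_min => /and3P[B0 Bk Bk1].
have Hl : exponent_of_distribution l.+1 (theta l.+1) by apply: Hth; rewrite !inE eqxx.
have Hk : exponent_of_distribution k.+1 (theta k.+1) by apply: Hth; rewrite !inE eqxx orbT.
have Hk1 : exponent_of_distribution k (theta k) by apply: Hth; rewrite !inE eqxx !orbT.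
have [/andP[_ tl1] _] := Hl 1%N isT; have [/andP[_ tk1] _] := Hk 1%N isT.
have A1 : A < 1 by exact: lt_le_trans tl1.
have B1 : B <= 1 by exact: le_trans (ltW Bk) tk1.
case: l => [|j] in Hl Al tl1 Hth *.
  (* Only for l = 1 can the exponent k + l - 3 be negative; as the sum is zero, so is the
     constant. *)
  exists 0; near=> x; rewrite mul0r normr_le0; apply/eqP/big1_seq => n /andP[_].
  rewrite mem_index_iota => /andP[n0 _].
  rewrite -/(dk R 1 n) dk1 // (divisor_fun_truncE 1 n B0) /= dkA0 //.
  by rewrite subrr expr0z mulr1 subrr mulr0.
have A01 : 0 < A < 1 by rewrite A0. have A01' : 0 < A <= 1 by rewrite A0 ltW.
have B01 : 0 < B <= 1 by rewrite B0.
have Alt : 0 < A < theta j.+2 by rewrite A0.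
have [C1 C10 H1] := shifted_sum_full k h0 Hl Alt A1.
have [C2 C20 H2] := shifted_sum_trunc j h0 Hk Hk1 A01 B01 Bk Bk1.
have [C3 C30 H3] := main_terms k j h0 A01' B01.
have [C4 H4] := err_le R h k j.
have Bj0 : 0 <= B ^- j.+1 by rewrite invr_ge0 exprn_ge0 // ltW.
exists ((C1 + B ^- j.+1 * C2 + C3) * C4); near=> x.
have /andP[e0 ex] : 0 <= err R h k j (Num.truncn x) <= C4 * (x * ln x ^+ (k + j)).
  by near: x.
have x1 : 1 <= x by near: x; apply: nbhs_pinfty_ge; rewrite num_real.
set N := Num.truncn x in e0 ex *; have N0 : (0 < N)%N by rewrite truncn_gt0.
rewrite log_exponentE.
rewrite -exprnP -mulrA.
have C0 : 0 <= C1 + B ^- j.+1 * C2 + C3 by rewrite !addr_ge0 ?mulr_ge0.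
apply: le_trans (ler_wpM2l C0 ex).
rewrite B_exponentE.
have := H1 N N0; have := H2 N N0; have := H3 N N0.
set T := err R h k j N in e0 ex *.
set S1 := \sum_(1 <= n < N.+1) dkA A k (n + h) * dk R j.+2 n.
set S2 := \sum_(1 <= n < N.+1) dkA A k (n + h) * dkA B j.+1 n.
set m1 := N%:R * \sum_(_ <= _ < _ | _) dk R k _ * dksum_kappa R h _ _ N.
set m2 := N%:R * \sum_(_ <= _ < _ | _) _ => h3 h2 h1.
have -> : \sum_(1 <= n < N.+1) (divisor_fun_trunc k.+1 (n + h) A)%:R *
   ((divisor_fun j.+2 n)%:R - B ^- j.+1 * (divisor_fun_trunc j.+2 n B)%:R) = S1 - B ^- j.+1 * S2.
  rewrite /S1 /S2 mulr_sumr -sumrB; apply: eq_bigr => n _.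
  rewrite !divisor_fun_truncE // -/(dk R j.+2 n) /=; ring.
have -> : S1 - B ^- j.+1 * S2 = (S1 - m1) - B ^- j.+1 * (S2 - m2) + (m1 - B ^- j.+1 * m2) by ring.
rewrite [leRHS]mulrDl [X in _ <= X + _]mulrDl.
apply: le_trans (ler_normD _ _) _; apply: lerD => //.
apply: le_trans (ler_normB _ _) _; apply: lerD => //.
by rewrite normrM ger0_norm // -mulrA ler_wpM2l.
Unshelve. all: by end_near.
Qed.
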